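(* Let $m>0$ and let $q=(q_n)_{n\in\mathbb Z}$ be a real sequence with $q_n\neq 1$ for all $n\in\mathbb Z$. If $q\in\ell^1_1(\mathbb Z)$, i.e. $\sum_{n\in\mathbb Z}(1+|n|)|q_n|<\infty$, then the transmission coefficient $T(\theta)$ and the reflection coefficients $R^{+}(\theta)$, $R^-(\theta)$ of the discrete Dirac operator $\mathcal D=\mathcal D_0+Q$ belong to the Wiener algebra $\mathcal A$.
   Context: For sequences ${\bf w}=({\bf w}_n)_{n\in\mathbb Z}$, ${\bf w}_n=(u_n,v_n)\in\mathbb C^2$, the discrete Dirac operator is $\mathcal D=\mathcal D_0+Q$ with $\mathcal D_0=\begin{pmatrix} m & d\\ d^* & -m\end{pmatrix}$, $Q_n=\begin{pmatrix}0&q_n\\ q_n&0\end{pmatrix}$, where $(du)_n=u_{n+1}-u_n$ and $(d^*u)_n=u_{n-1}-u_n$. Explicitly, $(\mathcal D{\bf w})_n=\big(m u_n+v_{n+1}-v_n+q_nv_n,\; u_{n-1}-u_n+q_nu_n-m v_n\big)$. For $\theta\in[-\pi,\pi]$ (with $\pi$ and $-\pi$ identified) put $\lambda=\lambda(\theta)=\sqrt{2-2\cos\theta+m^2}>0$ and $\alpha_\pm(\theta)=\frac{e^{\pm i\theta}-1}{m+\lambda}$. The Jost solutions ${\bf w}^\pm(\theta)=(u^\pm(\theta),v^\pm(\theta))$ are the solutions of $\mathcal D{\bf w}=\lambda{\bf w}$ determined by ${\bf w}^\pm_n(\theta)e^{\mp i\theta n}\to(1,\alpha_\mp(\theta))$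 as $n\to\pm\infty$; they exist for all $\theta\in[-\pi,\pi]$ when $q\in\ell^1_1$. The Wronskian of two solutions ${\bf w}^1,{\bf w}^2$ of $\mathcal D{\bf w}=\lambda{\bf w}$ is $W({\bf w}^1,{\bf w}^2)=u^1_nv^2_{n+1}-u^2_nv^1_{n+1}$, which is independent of $n$. Set $W(\theta)=W({\bf w}^+(\theta),{\bf w}^-(\theta))$ and $W^\pm(\theta)=W({\bf w}^\mp(\theta),{\bf w}^\pm(-\theta))$. It is known that $W(\theta)\ne0$ for $\theta\in(-\pi,0)\cup(0,\pi)$. The transmission and reflection coefficients are $$T(\theta)=\frac{2i\sin\theta}{(m+\lambda)W(\theta)},\qquad R^\pm(\theta)=\pm\frac{W^\pm(\theta)}{W(\theta)},$$ defined for $\theta\in(-\pi,0)\cup(0,\pi)$ (and extended by continuity to $\theta=0$ and $\theta=\pm\pi$). The Wiener algebra is $\mathcal A=\{f(\theta)=\sum_{k\in\mathbb Z}\hat f_ke^{ik\theta}:\ \sum_{k\in\mathbb Z}|\hat f_k|<\infty\}$. *)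

(* Defs.v *)
From Stdlib Require Import Reals ZArith ClassicalEpsilon.
From Coquelicot Require Import Coquelicot.

Open Scope R_scope.

(** * Series and limits over [Z] *)

(* The two half-series are required to converge separately; this is the
   ordinary notion for the absolutely convergent series considered here. *)
Definition is_zseries {K : AbsRing} {V : NormedModule K} (a : Z -> V) (s : V)
    : Prop :=
  exists s1 s2 : V,
    is_series (fun n : nat => a (Z.of_nat n)) s1 /\
    is_series (fun n : nat => a (- Z.of_nat (S n))%Z) s2 /\
    s = plus s1 s2.

Definition ex_zseries {K : AbsRing} {V : NormedModule K} (a : Z -> V) : Prop :=
  exists s : V, is_zseries a s.

Definition is_lim_pos (a : Z -> C) (l : C) : Prop :=
  filterlim (fun n : nat => a (Z.of_nat n)) eventually (locally l).

Definition is_lim_neg (a : Z -> C) (l : C) : Prop :=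
  filterlim (fun n : nat => a (- Z.of_nat n)%Z) eventually (locally l).

Definition l11 (q : Z -> R) : Prop :=
  ex_zseries (fun n : Z => (1 + Rabs (IZR n)) * Rabs (q n)).

(** [expi x] is $e^{ix}$. *)
Definition expi (x : R) : C := (cos x, sin x).

(** * The discrete Dirac operator *)

Definition dfwd (u : Z -> C) : Z -> C := fun n => (u (n + 1)%Z - u n)%C.
Definition dadj (u : Z -> C) : Z -> C := fun n => (u (n - 1)%Z - u n)%C.

Definition ucomp (w : Z -> C * C) : Z -> C := fun n => fst (w n).
Definition vcomp (w : Z -> C * C) : Z -> C := fun n => snd (w n).

Definition dirac0 (m : R) (w : Z -> C * C) : Z -> C * C := fun n =>
  ((RtoC m * ucomp w n + dfwd (vcomp w) n)%C,
   (dadj (ucomp w) n - RtoC m * vcomp w n)%C).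

Definition potential (q : Z -> R) (w : Z -> C * C) : Z -> C * C := fun n =>
  ((RtoC (q n) * vcomp w n)%C, (RtoC (q n) * ucomp w n)%C).

Definition dirac (m : R) (q : Z -> R) (w : Z -> C * C) : Z -> C * C := fun n =>
  ((fst (dirac0 m w n) + fst (potential q w n))%C,
   (snd (dirac0 m w n) + snd (potential q w n))%C).

Definition is_solution (m : R) (q : Z -> R) (lam : R) (w : Z -> C * C) : Prop :=
  forall n : Z,
    dirac m q w n = ((RtoC lam * ucomp w n)%C, (RtoC lam * vcomp w n)%C).

(** * Jost solutions *)

Definition lambda (m theta : R) : R := sqrt (2 - 2 * cos theta + m ^ 2).

Definition alpha_plus (m theta : R) : C :=
  ((expi theta - 1) / RtoC (m + lambda m theta))%C.
Definition alpha_minus (m theta : R) : C :=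
  ((expi (- theta) - 1) / RtoC (m + lambda m theta))%C.

Definition is_jost_plus (m : R) (q : Z -> R) (theta : R) (w : Z -> C * C)
    : Prop :=
  is_solution m q (lambda m theta) w /\
  is_lim_pos (fun n => (ucomp w n * expi (- (theta * IZR n)))%C) 1 /\
  is_lim_pos (fun n => (vcomp w n * expi (- (theta * IZR n)))%C)
    (alpha_minus m theta).

Definition is_jost_minus (m : R) (q : Z -> R) (theta : R) (w : Z -> C * C)
    : Prop :=
  is_solution m q (lambda m theta) w /\
  is_lim_neg (fun n => (ucomp w n * expi (theta * IZR n))%C) 1 /\
  is_lim_neg (fun n => (vcomp w n * expi (theta * IZR n))%C)
    (alpha_plus m theta).

Definition seq_inhabited : inhabited (Z -> C * C) :=
  inhabits (fun _ : Z => (RtoC 0, RtoC 0)).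

(* [epsilon] picks the Jost solution; it is an arbitrary sequence if there is
   none, which does not happen for [l11 q] and [theta] in $[-\pi,\pi]$. *)
Definition jost_plus (m : R) (q : Z -> R) (theta : R) : Z -> C * C :=
  epsilon seq_inhabited (is_jost_plus m q theta).
Definition jost_minus (m : R) (q : Z -> R) (theta : R) : Z -> C * C :=
  epsilon seq_inhabited (is_jost_minus m q theta).

(** * Scattering data *)

Definition wronskian_at (n : Z) (w1 w2 : Z -> C * C) : C :=
  (ucomp w1 n * vcomp w2 (n + 1)%Z - ucomp w2 n * vcomp w1 (n + 1)%Z)%C.

(* For two solutions with the same spectral parameter, [wronskian_at n] does
   not depend on [n]. *)
Definition wronskian (w1 w2 : Z -> C * C) : C := wronskian_at 0 w1 w2.

Definition W (m : R) (q : Z -> R) (theta : R) : C :=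
  wronskian (jost_plus m q theta) (jost_minus m q theta).
Definition W_plus (m : R) (q : Z -> R) (theta : R) : C :=
  wronskian (jost_minus m q theta) (jost_plus m q (- theta)).
Definition W_minus (m : R) (q : Z -> R) (theta : R) : C :=
  wronskian (jost_plus m q theta) (jost_minus m q (- theta)).

(* The three coefficients are meaningful for [theta] in [punctured] below. *)
Definition transmission (m : R) (q : Z -> R) (theta : R) : C :=
  (2 * Ci * RtoC (sin theta) /
   (RtoC (m + lambda m theta) * W m q theta))%C.
Definition reflection_plus (m : R) (q : Z -> R) (theta : R) : C :=
  (W_plus m q theta / W m q theta)%C.
Definition reflection_minus (m : R) (q : Z -> R) (theta : R) : C :=
  (- (W_minus m q theta / W m q theta))%C.

(** * Functions on the circle $[-\pi,\pi]/\{-\pi\sim\pi\}$ *)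

Definition punctured (theta : R) : Prop :=
  - PI < theta < 0 \/ 0 < theta < PI.

(* [g] extends [f] from [punctured] to the circle, the values at $0$ and
   $\pm\pi$ being the limits of [f]; the limits at $-\pi$ and $\pi$ are
   one-sided, and must agree because the two points are identified. *)
Definition continuous_extension (f g : R -> C) : Prop :=
  (forall theta, punctured theta -> g theta = f theta) /\
  filterlim f (within punctured (locally 0)) (locally (g 0)) /\
  filterlim f (within punctured (locally PI)) (locally (g PI)) /\
  filterlim f (within punctured (locally (- PI))) (locally (g (- PI))) /\
  g (- PI) = g PI.

Definition wiener (f : R -> C) : Prop :=
  exists c : Z -> C,
    ex_zseries (fun k : Z => Cmod (c k)) /\
    forall theta : R, - PI <= theta <= PI ->
      is_zseries (fun k : Z => (c k * expi (IZR k * theta))%C) (f theta).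

(* For a function given on [punctured] and extended by continuity. *)
Definition extends_to_wiener (f : R -> C) : Prop :=
  exists g : R -> C, continuous_extension f g /\ wiener g.

(* Main.v *)
Require Import Defs.
From Stdlib Require Import Reals ZArith Lra Lia ClassicalEpsilon.
From Coquelicot Require Import Coquelicot.

Open Scope R_scope.

(* Eliminating [v] from the Dirac system leaves the Jacobi equation
   [a_{n+1} u_{n+1} + a_n u_{n-1} = (2 cos theta + a_n^2 - 1) u_n], [a = 1 - q],
   and both [m] and [lambda] cancel from [T], [R+] and [R-], which become
   quotients of brackets [a_1 (u_0 u'_1 - u_1 u'_0)] of Jost solutions of this
   equation.  Writing [u_n = e^{i n theta} h_n], the pair [h_n],
   [h_{n-1} - h_n] obeys a backward recursion over the Wiener algebra; a scalar
   majorant recursion shows that the [h_n] exist and have summable increments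
   as soon as the first moment of [q] is finite.

   The common denominator [D] satisfies [|D| >= 2 |sin theta|].  If [D] has no
   zeros, Wiener's lemma finishes the proof.  If [D] vanishes at an edge
   [e^{i theta} = 1] or [-1], then [u+] and [u-] are proportional there, and
   summation by parts in Green's formula shows that the brackets are divisible
   by [e^{i theta} -+ 1] within the algebra.  After cancelling these factors the
   lower bound makes the new denominator nonzero at the edge.

   For Wiener's lemma it suffices to bound [(P + e)^n] where [P] is a
   trigonometric polynomial and [e] is small: [P^n] has at most [2 n N + 1]
   coefficients, each bounded by [sup |P|^n]. *)

(** * Limits and series of complex numbers *)

(** The edges shape the proof. There [e^{2it} = 1], so a slope [h_{n-1} - h_n] created at distance
    [k] adds up without oscillation to a height of order [k]. The norm of [sum_{j<k} e^{2ijt}] in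
    the algebra is also [k], so estimating by norms loses nothing there, and this weight [k] is the
    first moment of [q]. Replacing each coefficient by a bound for its norm gives a real recursion
    whose heights [H_n] decrease to 1; hence the bounds [H_n - H_{n+1}] for the increments
    telescope, which is the summability that summation by parts consumes. These estimates hold for
    all real [theta], edges included, whereas Jost solutions are identified only where [sin theta]
    is nonzero; continuity covers the rest.

    The lower bound for [D] is a form of unitarity. With [x = e^{i theta}] one has
    [2 |sin theta| = |x - 1| |x + 1|], so zeros occur only at the edges and one factor per resonant
    edge exhausts them. The numerators of the reflection coefficients vanish there too, because each
    pairs two families that are parallel to the same [u+] at the edge. *)

Definition clim (a : nat -> C) (l : C) : Prop :=
  filterlim a eventually (locally l).

Lemma clim_Cmod_minus (a : nat -> C) (l : C) :
  clim a l <-> is_lim_seq (fun n => Cmod (a n - l)) 0.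
Proof.
  unfold clim. rewrite (filterlim_locally_ball_norm (K := C_AbsRing)
    (U := C_NormedModule) a l).
  rewrite <- is_lim_seq_spec. unfold is_lim_seq', ball_norm.
  split; intros H eps; generalize (H eps); apply filter_imp; intros n;
    rewrite Rminus_0_r, Rabs_pos_eq by apply Cmod_ge_0; auto.
Qed.

Lemma Cmod_le_Re_Im (z : C) : Cmod z <= Rabs (Re z) + Rabs (Im z).
Proof.
  destruct z as [x y]. unfold Cmod, Re, Im; simpl fst; simpl snd.
  apply Rsqr_incr_0_var.
  2: pose proof (Rabs_pos x); pose proof (Rabs_pos y); lra.
  rewrite Rsqr_sqrt by nra. unfold Rsqr.
  replace (x ^ 2) with (Rabs x * Rabs x) by (rewrite <- Rabs_mult, Rabs_pos_eq; nra).
  replace (y ^ 2) with (Rabs y * Rabs y) by (rewrite <- Rabs_mult, Rabs_pos_eq; nra).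
  pose proof (Rabs_pos x); pose proof (Rabs_pos y); nra.
Qed.

Lemma im_le_Cmod (z : C) : Rabs (Im z) <= Cmod z.
Proof.
  eapply Rle_trans; [ | apply Rmax_Cmod ]. apply Rmax_r.
Qed.

Lemma is_lim_seq_squeeze_0 (u v : nat -> R) :
  (forall n, Rabs (u n) <= v n) -> is_lim_seq v 0 -> is_lim_seq u 0.
Proof.
  intros H Hv. apply is_lim_seq_abs_0.
  apply (is_lim_seq_le_le (fun _ => 0) _ v); auto using is_lim_seq_const.
  intros n; split; [ apply Rabs_pos | apply H ].
Qed.

Lemma is_lim_seq_minus_0 (u : nat -> R) (l : R) :
  is_lim_seq u l <-> is_lim_seq (fun n => u n - l) 0.
Proof.
  split; intros H.
  - replace 0 with (l - l) by ring.
    apply is_lim_seq_minus'; auto using is_lim_seq_const.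
  - apply (is_lim_seq_ext (fun n => (u n - l) + l)); [ intros; ring | ].
    pose proof (is_lim_seq_plus' _ _ 0 l H (is_lim_seq_const l)) as K.
    rewrite Rplus_0_l in K; exact K.
Qed.

Lemma clim_Re_Im (a : nat -> C) (l : C) :
  clim a l <->
  is_lim_seq (fun n => Re (a n)) (Re l) /\ is_lim_seq (fun n => Im (a n)) (Im l).
Proof.
  rewrite clim_Cmod_minus, (is_lim_seq_minus_0 (fun n => Re (a n))),
    (is_lim_seq_minus_0 (fun n => Im (a n))).
  split.
  - intros H; split; eapply is_lim_seq_squeeze_0; try apply H; intros n; cbv beta.
    + replace (Re (a n) - Re l) with (Re (a n - l)%C) by (unfold Re; simpl; ring).
      apply re_le_Cmod.
    + replace (Im (a n) - Im l) with (Im (a n - l)%C) by (unfold Im; simpl; ring).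
      apply im_le_Cmod.
  - intros [Hr Hi].
    apply (is_lim_seq_squeeze_0 _
      (fun n => Rabs (Re (a n) - Re l) + Rabs (Im (a n) - Im l))).
    + intros n. rewrite Rabs_pos_eq by apply Cmod_ge_0.
      replace (Re (a n) - Re l) with (Re (a n - l)%C) by (unfold Re; simpl; ring).
      replace (Im (a n) - Im l) with (Im (a n - l)%C) by (unfold Im; simpl; ring).
      apply Cmod_le_Re_Im.
    + replace 0 with (Rabs 0 + Rabs 0) by (rewrite Rabs_R0; ring).
      apply is_lim_seq_plus'; [ apply (is_lim_seq_abs _ 0), Hr
                              | apply (is_lim_seq_abs _ 0), Hi ].
Qed.

Lemma clim_ext (a b : nat -> C) (l : C) :
  (forall n, a n = b n) -> clim a l -> clim b l.
Proof. apply filterlim_ext. Qed.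

Lemma clim_const (z : C) : clim (fun _ => z) z.
Proof. apply filterlim_const. Qed.

Lemma clim_plus (a b : nat -> C) (l k : C) :
  clim a l -> clim b k -> clim (fun n => a n + b n)%C (l + k)%C.
Proof.
  rewrite !clim_Re_Im. intros [H1 H2] [H3 H4].
  split; unfold Re, Im in *; simpl; apply is_lim_seq_plus'; assumption.
Qed.

Lemma clim_opp (a : nat -> C) (l : C) :
  clim a l -> clim (fun n => - a n)%C (- l)%C.
Proof.
  rewrite !clim_Re_Im. intros [H1 H2].
  split; unfold Re, Im in *; simpl.
  - apply (is_lim_seq_opp _ (fst l)); assumption.
  - apply (is_lim_seq_opp _ (snd l)); assumption.
Qed.

Lemma clim_minus (a b : nat -> C) (l k : C) :
  clim a l -> clim b k -> clim (fun n => a n - b n)%C (l - k)%C.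
Proof. intros; apply clim_plus; [ | apply clim_opp ]; assumption. Qed.

Lemma clim_mult (a b : nat -> C) (l k : C) :
  clim a l -> clim b k -> clim (fun n => a n * b n)%C (l * k)%C.
Proof.
  rewrite !clim_Re_Im. intros [H1 H2] [H3 H4].
  split; unfold Re, Im in *; simpl;
    [ apply is_lim_seq_minus' | apply is_lim_seq_plus' ];
    apply is_lim_seq_mult'; assumption.
Qed.

Lemma clim_conj (a : nat -> C) (l : C) :
  clim a l -> clim (fun n => Cconj (a n)) (Cconj l).
Proof.
  rewrite !clim_Re_Im. intros [H1 H2].
  split; unfold Re, Im in *; simpl; [ assumption | ].
  apply (is_lim_seq_opp _ (snd l)); assumption.
Qed.

Lemma clim_RtoC (u : nat -> R) (l : R) :
  is_lim_seq u l -> clim (fun n => RtoC (u n)) (RtoC l).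
Proof.
  intros H. apply clim_Re_Im. split; unfold Re, Im; simpl;
    [ assumption | apply is_lim_seq_const ].
Qed.

Lemma clim_Cmod (a : nat -> C) (l : C) :
  clim a l -> is_lim_seq (fun n => Cmod (a n)) (Cmod l).
Proof.
  intros H. apply clim_Cmod_minus in H.
  apply is_lim_seq_minus_0. apply (is_lim_seq_squeeze_0 _ _) with (2 := H).
  intros n. pose proof (Cmod_triangle (a n - l) l) as H1.
  pose proof (Cmod_triangle (l - a n) (a n)) as H2.
  replace (a n - l + l)%C with (a n) in H1 by ring.
  replace (l - a n + a n)%C with l in H2 by ring.
  replace (l - a n)%C with (- (a n - l))%C in H2 by ring.
  rewrite Cmod_opp in H2. apply Rabs_le; lra.
Qed.

Lemma clim_unique (a : nat -> C) (l k : C) : clim a l -> clim a k -> l = k.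
Proof.
  rewrite !clim_Re_Im. intros [H1 H2] [H3 H4].
  apply is_lim_seq_unique in H1, H2, H3, H4.
  destruct l, k; unfold Re, Im in *; simpl in *. f_equal; congruence.
Qed.

Lemma clim_squeeze (a : nat -> C) (l : C) (v : nat -> R) :
  (forall n, Cmod (a n - l) <= v n) -> is_lim_seq v 0 -> clim a l.
Proof.
  intros H Hv. apply clim_Cmod_minus.
  apply (is_lim_seq_squeeze_0 _ v); [ | assumption ].
  intros n; rewrite Rabs_pos_eq by apply Cmod_ge_0; apply H.
Qed.

Lemma clim_incr_1 (a : nat -> C) (l : C) :
  clim a l <-> clim (fun n => a (S n)) l.
Proof. rewrite !clim_Cmod_minus. apply is_lim_seq_incr_1. Qed.

Lemma clim_Cmod_le (a : nat -> C) (l : C) (M : R) :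
  clim a l -> (forall n, Cmod (a n) <= M) -> Cmod l <= M.
Proof.
  intros H HM.
  apply (is_lim_seq_le (fun n => Cmod (a n)) (fun _ => M) (Cmod l) M HM);
    [ apply clim_Cmod, H | apply is_lim_seq_const ].
Qed.

(** A recursion in the field operations of [C], so that [ring] sees the summands directly instead of
    the [plus] of a normed module. *)
Fixpoint csum (a : nat -> C) (n : nat) : C :=
  match n with O => a O | S p => (csum a p + a (S p))%C end.

Lemma csum_sum_n (a : nat -> C) (n : nat) : csum a n = sum_n a n.
Proof.
  induction n as [|n IH]; simpl; [ now rewrite sum_O | ].
  rewrite sum_Sn, IH. reflexivity.
Qed.

Lemma csum_plus (a b : nat -> C) (n : nat) :
  csum (fun k => a k + b k)%C n = (csum a n + csum b n)%C.
Proof. induction n as [|n IH]; simpl; [ | rewrite IH ]; ring. Qed.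

Lemma csum_scal (z : C) (a : nat -> C) (n : nat) :
  csum (fun k => z * a k)%C n = (z * csum a n)%C.
Proof. induction n as [|n IH]; simpl; [ | rewrite IH ]; ring. Qed.

Lemma csum_ext (a b : nat -> C) (n : nat) :
  (forall k, a k = b k) -> csum a n = csum b n.
Proof. intros H; induction n as [|n IH]; simpl; rewrite ?IH, H; reflexivity. Qed.

Lemma csum_shift (a : nat -> C) (n : nat) :
  csum a (S n) = (a O + csum (fun k => a (S k)) n)%C.
Proof.
  induction n as [|n IH]; [ reflexivity | ].
  change (csum a (S (S n))) with (csum a (S n) + a (S (S n)))%C.
  rewrite IH; simpl; ring.
Qed.

Definition cseries (a : nat -> C) (l : C) : Prop := clim (csum a) l.

Lemma cseries_is_series (a : nat -> C) (l : C) :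
  cseries a l <-> is_series (K := C_AbsRing) (V := C_NormedModule) a l.
Proof.
  unfold cseries, clim, is_series.
  split; apply filterlim_ext; intros n; [ | symmetry ]; apply csum_sum_n.
Qed.

Lemma cseries_ext (a b : nat -> C) (l : C) :
  (forall n, a n = b n) -> cseries a l -> cseries b l.
Proof. intros H; apply clim_ext; intros n; apply csum_ext, H. Qed.

Lemma cseries_unique (a : nat -> C) (l k : C) :
  cseries a l -> cseries a k -> l = k.
Proof. apply clim_unique. Qed.

Lemma cseries_plus (a b : nat -> C) (l k : C) :
  cseries a l -> cseries b k -> cseries (fun n => a n + b n)%C (l + k)%C.
Proof.
  intros Ha Hb.
  apply (clim_ext (fun n => csum a n + csum b n)%C);
    [ intros; symmetry; apply csum_plus | apply clim_plus; assumption ].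
Qed.

Lemma cseries_scal (z : C) (a : nat -> C) (l : C) :
  cseries a l -> cseries (fun n => z * a n)%C (z * l)%C.
Proof.
  intros Ha. apply (clim_ext (fun n => z * csum a n)%C);
    [ intros; symmetry; apply csum_scal
    | apply clim_mult; [ apply clim_const | assumption ] ].
Qed.

Lemma cseries_shift (a : nat -> C) (l : C) :
  cseries (fun k => a (S k)) l -> cseries a (a O + l)%C.
Proof.
  intros H. apply clim_incr_1.
  apply (clim_ext (fun n => a O + csum (fun k => a (S k)) n)%C).
  - intros n; symmetry; apply csum_shift.
  - apply clim_plus; [ apply clim_const | apply H ].
Qed.

Lemma cseries_telescope (a : nat -> C) (l : C) :
  clim a l -> cseries (fun n => a n - a (S n))%C (a O - l)%C.
Proof.
  intros H. apply (clim_ext (fun n => a O - a (S n))%C).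
  - intros n; induction n as [|n IH]; simpl; [ | rewrite <- IH ]; ring.
  - apply clim_minus; [ apply clim_const | apply clim_incr_1 in H; apply H ].
Qed.

Lemma is_series_is_lim_seq (b : nat -> R) (B : R) :
  is_series b B <-> is_lim_seq (sum_n b) B.
Proof. reflexivity. Qed.

Lemma sum_n_nonneg_incr (b : nat -> R) (n : nat) :
  (forall k, 0 <= b k) -> sum_n b n <= sum_n b (S n).
Proof.
  intros H. rewrite sum_Sn. unfold plus; simpl. specialize (H (S n)); lra.
Qed.

Lemma sum_n_le_series (b : nat -> R) (B : R) (n : nat) :
  (forall k, 0 <= b k) -> is_series b B -> sum_n b n <= B.
Proof.
  intros H HB. apply (is_lim_seq_incr_compare (sum_n b) B HB).
  intros p; apply sum_n_nonneg_incr, H.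
Qed.

Lemma ex_series_bounded (b : nat -> R) (B : R) :
  (forall k, 0 <= b k) -> (forall n, sum_n b n <= B) ->
  exists l, is_series b l /\ l <= B.
Proof.
  intros H HB.
  destruct (ex_finite_lim_seq_incr (sum_n b) B) as [l Hl]; auto.
  { intros n; apply sum_n_nonneg_incr, H. }
  exists l; split; [ exact Hl | ].
  apply (is_lim_seq_le (sum_n b) (fun _ => B) l B HB Hl (is_lim_seq_const B)).
Qed.

Lemma Cmod_csum_le (a : nat -> C) (b : nat -> R) (n : nat) :
  (forall k, Cmod (a k) <= b k) -> Cmod (csum a n) <= sum_n b n.
Proof.
  intros H; induction n as [|n IH]; simpl; [ rewrite sum_O; apply H | ].
  rewrite sum_Sn. eapply Rle_trans; [ apply Cmod_triangle | ].
  apply Rplus_le_compat; auto.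
Qed.

Lemma cseries_dominated (a : nat -> C) (b : nat -> R) (B : R) :
  (forall k, Cmod (a k) <= b k) -> is_series b B ->
  exists l, cseries a l /\ Cmod l <= B.
Proof.
  intros H HB.
  assert (Hb : forall k, 0 <= b k)
    by (intros k; eapply Rle_trans; [ apply Cmod_ge_0 | apply H ]).
  destruct (ex_series_le (K := C_AbsRing) (V := C_CompleteNormedModule) a b)
    as [l Hl]; [ exact H | exists B; exact HB | ].
  assert (Hl' : cseries a l) by (apply cseries_is_series, Hl).
  exists l; split; [ exact Hl' | ].
  apply (clim_Cmod_le _ _ _ Hl'). intros n.
  eapply Rle_trans; [ apply (Cmod_csum_le _ b); assumption | ].
  apply sum_n_le_series; assumption.
Qed.

(** * The Wiener algebra *)

Lemma expi_plus (a b : R) : expi (a + b) = (expi a * expi b)%C.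
Proof.
  unfold expi, Cmult; simpl. rewrite cos_plus, sin_plus. f_equal; ring.
Qed.

Lemma expi_0 : expi 0 = 1%C.
Proof. unfold expi; rewrite cos_0, sin_0; reflexivity. Qed.

Lemma Cconj_expi (a : R) : Cconj (expi a) = expi (- a).
Proof. unfold expi, Cconj; simpl; rewrite cos_neg, sin_neg; reflexivity. Qed.

Lemma Cmod_expi (a : R) : Cmod (expi a) = 1.
Proof.
  unfold Cmod, expi; simpl fst; simpl snd.
  replace (cos a ^ 2 + sin a ^ 2) with 1; [ apply sqrt_1 | ].
  rewrite <- (sin2_cos2 a); unfold Rsqr; ring.
Qed.

Lemma expi_mult_opp (a : R) : (expi a * expi (- a))%C = 1%C.
Proof. rewrite <- expi_plus, Rplus_opp_r; apply expi_0. Qed.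

(** Symmetric partial sums over [|k| <= n]: they are invariant under [k -> -k], and a shift of the
    index costs only two boundary terms. *)
Fixpoint box (c : Z -> C) (n : nat) : C :=
  match n with
  | O => c 0%Z
  | S p => (box c p + (c (Z.of_nat n) + c (- Z.of_nat n)%Z))%C
  end.

Fixpoint rbox (c : Z -> R) (n : nat) : R :=
  match n with
  | O => c 0%Z
  | S p => rbox c p + (c (Z.of_nat n) + c (- Z.of_nat n)%Z)
  end.

Definition cabs (c : Z -> C) (k : Z) : R := Cmod (c k).

Definition harm (c : Z -> C) (theta : R) (k : Z) : C :=
  (c k * expi (IZR k * theta))%C.

(* [wnorm_le f M] says that [f] is in the Wiener algebra with norm at most
   [M]; unlike [wiener] it speaks of all [theta], so it entails periodicity. *)
Definition wnorm_le (f : R -> C) (M : R) : Prop :=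
  exists c : Z -> C,
    (forall n, rbox (cabs c) n <= M) /\
    (forall theta, clim (box (harm c theta)) (f theta)).

Lemma box_ext (c d : Z -> C) (n : nat) :
  (forall k, c k = d k) -> box c n = box d n.
Proof. intros H; induction n as [|n IH]; simpl; rewrite ?IH, ?H; auto. Qed.

Lemma box_plus (c d : Z -> C) (n : nat) :
  box (fun k => c k + d k)%C n = (box c n + box d n)%C.
Proof. induction n as [|n IH]; simpl; [ | rewrite IH ]; ring. Qed.

Lemma box_scal (z : C) (c : Z -> C) (n : nat) :
  box (fun k => z * c k)%C n = (z * box c n)%C.
Proof. induction n as [|n IH]; simpl; [ | rewrite IH ]; ring. Qed.

Lemma box_opp_index (c : Z -> C) (n : nat) :
  box (fun k => c (- k)%Z) n = box c n.
Proof.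
  induction n as [|n IH]; [ reflexivity | ].
  cbn [box]. rewrite IH, Z.opp_involutive. ring.
Qed.

Lemma box_conj (c : Z -> C) (n : nat) :
  box (fun k => Cconj (c k)) n = Cconj (box c n).
Proof. induction n as [|n IH]; cbn [box]; rewrite ?IH, ?Cplus_conj; ring. Qed.

Lemma box_pred (c : Z -> C) (n : nat) :
  box (fun k => c (k - 1)%Z) n =
  (box c n + c (- Z.of_nat (S n))%Z - c (Z.of_nat n))%C.
Proof.
  induction n as [|n IH]; [ cbn; ring | ].
  cbn [box]. rewrite IH.
  replace (Z.of_nat (S n) - 1)%Z with (Z.of_nat n) by lia.
  replace (- Z.of_nat (S n) - 1)%Z with (- Z.of_nat (S (S n)))%Z by lia.
  ring.
Qed.

Lemma rbox_le (c d : Z -> R) (n : nat) :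
  (forall k, c k <= d k) -> rbox c n <= rbox d n.
Proof.
  intros H; induction n as [|n IH]; cbn [rbox]; [ apply H | ].
  pose proof (H (Z.of_nat (S n))); pose proof (H (- Z.of_nat (S n))%Z); lra.
Qed.

Lemma rbox_plus (c d : Z -> R) (n : nat) :
  rbox (fun k => c k + d k) n = rbox c n + rbox d n.
Proof. induction n as [|n IH]; cbn [rbox]; [ | rewrite IH ]; ring. Qed.

Lemma rbox_scal (z : R) (c : Z -> R) (n : nat) :
  rbox (fun k => z * c k) n = z * rbox c n.
Proof. induction n as [|n IH]; cbn [rbox]; [ | rewrite IH ]; ring. Qed.

Lemma rbox_ext (c d : Z -> R) (n : nat) :
  (forall k, c k = d k) -> rbox c n = rbox d n.
Proof. intros H; induction n as [|n IH]; cbn [rbox]; rewrite ?IH, ?H; auto. Qed.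

Lemma rbox_opp_index (c : Z -> R) (n : nat) :
  rbox (fun k => c (- k)%Z) n = rbox c n.
Proof.
  induction n as [|n IH]; [ reflexivity | ].
  cbn [rbox]. rewrite IH, Z.opp_involutive. ring.
Qed.

Lemma rbox_pred (c : Z -> R) (n : nat) :
  rbox (fun k => c (k - 1)%Z) n =
  rbox c n + c (- Z.of_nat (S n))%Z - c (Z.of_nat n).
Proof.
  induction n as [|n IH]; [ cbn; ring | ].
  cbn [rbox]. rewrite IH.
  replace (Z.of_nat (S n) - 1)%Z with (Z.of_nat n) by lia.
  replace (- Z.of_nat (S n) - 1)%Z with (- Z.of_nat (S (S n)))%Z by lia.
  ring.
Qed.

Lemma cabs_pos (c : Z -> C) (k : Z) : 0 <= cabs c k.
Proof. apply Cmod_ge_0. Qed.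

Lemma rbox_incr (c : Z -> C) (n p : nat) :
  (n <= p)%nat -> rbox (cabs c) n <= rbox (cabs c) p.
Proof.
  induction 1 as [|p _ IH]; [ lra | ]. cbn [rbox].
  pose proof (cabs_pos c (Z.of_nat (S p)));
  pose proof (cabs_pos c (- Z.of_nat (S p))%Z); lra.
Qed.

Lemma Cmod_box_le (c : Z -> C) (n : nat) : Cmod (box c n) <= rbox (cabs c) n.
Proof.
  induction n as [|n IH]; cbn [rbox box]; [ apply Rle_refl | ].
  eapply Rle_trans; [ apply Cmod_triangle | ].
  apply Rplus_le_compat; [ assumption | apply Cmod_triangle ].
Qed.

Lemma cabs_harm (c : Z -> C) (theta : R) (k : Z) :
  cabs (harm c theta) k = cabs c k.
Proof. unfold cabs, harm. rewrite Cmod_mult, Cmod_expi; ring. Qed.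

Lemma Cmod_box_harm_le (c : Z -> C) (theta : R) (n : nat) :
  Cmod (box (harm c theta) n) <= rbox (cabs c) n.
Proof.
  eapply Rle_trans; [ apply Cmod_box_le | ].
  right; apply rbox_ext, cabs_harm.
Qed.

Lemma wnorm_le_sup (f : R -> C) (M theta : R) :
  wnorm_le f M -> Cmod (f theta) <= M.
Proof.
  intros [c [Hc Hf]]. apply (clim_Cmod_le _ _ _ (Hf theta)).
  intros n; eapply Rle_trans; [ apply Cmod_box_harm_le | apply Hc ].
Qed.

Lemma wnorm_le_pos (f : R -> C) (M : R) : wnorm_le f M -> 0 <= M.
Proof.
  intros H; eapply Rle_trans; [ | apply (wnorm_le_sup f M 0 H) ].
  apply Cmod_ge_0.
Qed.

Lemma wnorm_le_weaken (f : R -> C) (M N : R) :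
  wnorm_le f M -> M <= N -> wnorm_le f N.
Proof.
  intros [c [Hc Hf]] H; exists c; split; [ | assumption ].
  intros n; specialize (Hc n); lra.
Qed.

Lemma wnorm_le_ext (f g : R -> C) (M : R) :
  (forall theta, f theta = g theta) -> wnorm_le f M -> wnorm_le g M.
Proof.
  intros H [c [Hc Hf]]; exists c; split; [ assumption | ].
  intros theta; rewrite <- H; apply Hf.
Qed.

Lemma wnorm_le_plus (f g : R -> C) (M N : R) :
  wnorm_le f M -> wnorm_le g N ->
  wnorm_le (fun theta => f theta + g theta)%C (M + N).
Proof.
  intros [c [Hc Hf]] [d [Hd Hg]].
  exists (fun k => c k + d k)%C; split.
  - intros n. apply Rle_trans with (rbox (fun k => cabs c k + cabs d k) n).
    + apply rbox_le; intros k; apply Cmod_triangle.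
    + rewrite rbox_plus; specialize (Hc n); specialize (Hd n); lra.
  - intros theta.
    apply (clim_ext (fun n => box (harm c theta) n + box (harm d theta) n)%C).
    + intros n; rewrite <- box_plus; apply box_ext; intros k; unfold harm; ring.
    + apply clim_plus; auto.
Qed.

Lemma wnorm_le_scal (z : C) (f : R -> C) (M : R) :
  wnorm_le f M -> wnorm_le (fun theta => z * f theta)%C (Cmod z * M).
Proof.
  intros [c [Hc Hf]].
  exists (fun k => z * c k)%C; split.
  - intros n. rewrite (rbox_ext _ (fun k => Cmod z * cabs c k)).
    + rewrite rbox_scal. apply Rmult_le_compat_l; [ apply Cmod_ge_0 | auto ].
    + intros k; apply Cmod_mult.
  - intros theta.
    apply (clim_ext (fun n => z * box (harm c theta) n)%C).
    + intros n; rewrite <- box_scal; apply box_ext; intros k; unfold harm; ring.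
    + apply clim_mult; [ apply clim_const | auto ].
Qed.

Lemma wnorm_le_opp (f : R -> C) (M : R) :
  wnorm_le f M -> wnorm_le (fun theta => - f theta)%C M.
Proof.
  intros H. apply (wnorm_le_scal (- (1))%C) in H.
  rewrite Cmod_opp, Cmod_1, Rmult_1_l in H.
  apply (wnorm_le_ext _ _ _) with (2 := H). intros; ring.
Qed.

Lemma wnorm_le_minus (f g : R -> C) (M N : R) :
  wnorm_le f M -> wnorm_le g N ->
  wnorm_le (fun theta => f theta - g theta)%C (M + N).
Proof. intros Hf Hg; apply wnorm_le_plus; [ | apply wnorm_le_opp ]; auto. Qed.

Lemma rbox_single (z : C) (n : nat) :
  rbox (cabs (fun k => if Z.eqb k 0 then z else 0)%C) n = Cmod z.
Proof.
  induction n as [|n IH]; cbn [rbox]; [ reflexivity | rewrite IH ].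
  unfold cabs; simpl. rewrite Cmod_0; ring.
Qed.

Lemma wnorm_le_const (z : C) : wnorm_le (fun _ => z) (Cmod z).
Proof.
  exists (fun k => if Z.eqb k 0 then z else 0)%C; split.
  - intros n; rewrite rbox_single; apply Rle_refl.
  - intros theta. apply (clim_ext (fun _ => z)); [ | apply clim_const ].
    intros n; induction n as [|n IH]; cbn [box].
    + unfold harm; simpl. rewrite Rmult_0_l, expi_0; ring.
    + rewrite <- IH; unfold harm; simpl; ring.
Qed.

Lemma wnorm_le_opp_arg (f : R -> C) (M : R) :
  wnorm_le f M -> wnorm_le (fun theta => f (- theta)) M.
Proof.
  intros [c [Hc Hf]]. exists (fun k => c (- k)%Z); split.
  - intros n. change (rbox (fun k => cabs c (- k)%Z) n <= M).
    rewrite rbox_opp_index; apply Hc.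
  - intros theta. eapply clim_ext; [ | apply Hf ].
    intros n. rewrite <- box_opp_index. apply box_ext; intros k.
    unfold harm. rewrite opp_IZR. do 2 f_equal; ring.
Qed.

Lemma wnorm_le_conj (f : R -> C) (M : R) :
  wnorm_le f M -> wnorm_le (fun theta => Cconj (f theta)) M.
Proof.
  intros [c [Hc Hf]]. exists (fun k => Cconj (c (- k)%Z)); split.
  - intros n. rewrite (rbox_ext _ (fun k => cabs c (- k)%Z)).
    + rewrite rbox_opp_index; apply Hc.
    + intros k; apply Cmod_conj.
  - intros theta. eapply clim_ext; [ | apply clim_conj, Hf ].
    intros n; cbv beta. rewrite <- box_conj, <- box_opp_index. apply box_ext; intros k.
    unfold harm. rewrite Cmult_conj, Cconj_expi, opp_IZR. do 2 f_equal; ring.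
Qed.

Lemma bounded_rbox_cabs_lim (c : Z -> C) (M : R) :
  (forall n, rbox (cabs c) n <= M) ->
  exists L : R, is_lim_seq (rbox (cabs c)) L /\ L <= M /\
    forall n, rbox (cabs c) n <= L.
Proof.
  intros Hc.
  destruct (ex_finite_lim_seq_incr (rbox (cabs c)) M) as [L HL]; auto.
  { intros n; apply rbox_incr; lia. }
  exists L; repeat split; [ exact HL | | ].
  - apply (is_lim_seq_le (rbox (cabs c)) (fun _ => M) L M Hc HL).
    apply is_lim_seq_const.
  - apply (is_lim_seq_incr_compare _ _ HL). intros n; apply rbox_incr; lia.
Qed.

Lemma bounded_rbox_coef_lim (c : Z -> C) (M : R) :
  (forall n, rbox (cabs c) n <= M) ->
  is_lim_seq (fun n => cabs c (Z.of_nat n)) 0 /\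
  is_lim_seq (fun n => cabs c (- Z.of_nat n)%Z) 0.
Proof.
  intros Hc. destruct (bounded_rbox_cabs_lim c M Hc) as [L [HL _]].
  assert (H0 : is_lim_seq
    (fun n => rbox (cabs c) (S n) - rbox (cabs c) n) 0).
  { replace 0 with (L - L) by ring. apply is_lim_seq_minus'; [ | exact HL ].
    apply (is_lim_seq_incr_1 (rbox (cabs c)) L), HL. }
  split; apply is_lim_seq_incr_1;
    apply (is_lim_seq_squeeze_0 _ _) with (2 := H0); intros n; cbn [rbox];
    rewrite Rabs_pos_eq by apply cabs_pos;
    pose proof (cabs_pos c (Z.of_nat (S n)));
    pose proof (cabs_pos c (- Z.of_nat (S n))%Z); lra.
Qed.

Lemma clim_0_Cmod (a : nat -> C) :
  is_lim_seq (fun n => Cmod (a n)) 0 -> clim a 0.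
Proof.
  intros H; apply clim_squeeze with (2 := H); intros n.
  replace (a n - 0)%C with (a n) by ring; apply Rle_refl.
Qed.

Lemma harm_pred (c : Z -> C) (theta : R) (k : Z) :
  harm (fun k => c (k - 1)%Z) theta k = (expi theta * harm c theta (k - 1))%C.
Proof.
  unfold harm. replace (IZR k * theta) with (theta + IZR (k - 1) * theta)
    by (rewrite minus_IZR; ring).
  rewrite expi_plus; ring.
Qed.

Lemma box_harm_pred (c : Z -> C) (theta : R) (n : nat) :
  box (harm (fun k => c (k - 1)%Z) theta) n =
  (expi theta * (box (harm c theta) n + harm c theta (- Z.of_nat (S n))%Z
                 - harm c theta (Z.of_nat n)))%C.
Proof.
  rewrite <- box_pred, <- box_scal. apply box_ext, harm_pred.
Qed.

(** The shifted window of radius [n] lies inside the window of radius [n + 1], so the bound [M]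
    survives unchanged; the two boundary terms of the shift vanish in the limit because the
    coefficients are summable. *)
Lemma wnorm_le_expi (f : R -> C) (M : R) :
  wnorm_le f M -> wnorm_le (fun theta => expi theta * f theta)%C M.
Proof.
  intros [c [Hc Hf]]. exists (fun k => c (k - 1)%Z); split.
  - intros n. change (rbox (fun k => cabs c (k - 1)%Z) n <= M).
    rewrite rbox_pred. pose proof (Hc (S n)) as H; cbn [rbox] in H.
    pose proof (cabs_pos c (Z.of_nat (S n)));
    pose proof (cabs_pos c (Z.of_nat n)); lra.
  - intros theta. eapply clim_ext;
      [ intros n; symmetry; apply box_harm_pred | ].
    apply clim_mult; [ apply clim_const | ].
    destruct (bounded_rbox_coef_lim c M Hc) as [H1 H2].
    apply is_lim_seq_incr_1 in H2.
    replace (f theta) with (f theta + 0 - 0)%C by ring.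
    apply clim_minus; [ apply clim_plus; [ apply Hf | ] | ];
      apply clim_0_Cmod.
    + eapply is_lim_seq_ext; [ | exact H2 ]; intros n; symmetry; apply cabs_harm.
    + eapply is_lim_seq_ext; [ | exact H1 ]; intros n; symmetry; apply cabs_harm.
Qed.

Lemma wnorm_le_expi_nat (n : nat) (f : R -> C) (M : R) :
  wnorm_le f M ->
  wnorm_le (fun theta => expi (INR n * theta) * f theta)%C M.
Proof.
  intros H; induction n as [|n IH].
  - apply (wnorm_le_ext f); [ | assumption ].
    intros theta; simpl; rewrite Rmult_0_l, expi_0; ring.
  - apply wnorm_le_expi in IH. apply (wnorm_le_ext _ _ _) with (2 := IH).
    intros theta; cbv beta. rewrite S_INR.
    replace ((INR n + 1) * theta) with (theta + INR n * theta) by ring.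
    rewrite expi_plus; ring.
Qed.

Lemma wnorm_le_expi_Z (k : Z) (f : R -> C) (M : R) :
  wnorm_le f M ->
  wnorm_le (fun theta => expi (IZR k * theta) * f theta)%C M.
Proof.
  intros H. destruct (Z_le_gt_dec 0 k) as [Hk|Hk].
  - apply (wnorm_le_ext _ _ _) with (2 := wnorm_le_expi_nat (Z.to_nat k) f M H).
    intros theta; rewrite INR_IZR_INZ, Z2Nat.id by lia; reflexivity.
  - apply wnorm_le_opp_arg in H.
    apply (wnorm_le_expi_nat (Z.to_nat (- k))), wnorm_le_opp_arg in H.
    apply (wnorm_le_ext _ _ _) with (2 := H).
    intros theta; cbv beta.
    rewrite INR_IZR_INZ, Z2Nat.id, opp_IZR, Ropp_involutive by lia.
    do 2 f_equal; ring.
Qed.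

Lemma rbox_cabs_lim (c : nat -> Z -> C) (d : Z -> C) (n : nat) :
  (forall k, clim (fun j => c j k) (d k)) ->
  is_lim_seq (fun j => rbox (cabs (c j)) n) (rbox (cabs d) n).
Proof.
  intros H; induction n as [|n IH]; cbn [rbox]; [ apply clim_Cmod, H | ].
  apply is_lim_seq_plus'; [ assumption | ].
  apply is_lim_seq_plus'; apply clim_Cmod, H.
Qed.

Lemma coef_le_rbox (c : Z -> C) (k : Z) :
  cabs c k <= rbox (cabs c) (Z.to_nat (Z.abs k)).
Proof.
  destruct (Z.to_nat (Z.abs k)) as [|n] eqn:E.
  - replace k with 0%Z by lia. apply Rle_refl.
  - cbn [rbox]. rewrite <- E, Z2Nat.id by lia.
    assert (H0 : 0 <= rbox (cabs c) n)
      by (eapply Rle_trans; [ | apply (rbox_incr c 0 n); lia ]; apply cabs_pos).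
    pose proof (cabs_pos c (Z.abs k)); pose proof (cabs_pos c (- Z.abs k)%Z).
    destruct (Z.abs_eq_or_opp k) as [E'|E'].
    + rewrite E' in *; lra.
    + rewrite E' in *; rewrite Z.opp_involutive in *; lra.
Qed.

Lemma rbox_csum_le (c : nat -> Z -> C) (M : nat -> R) (n J : nat) :
  (forall j, rbox (cabs (c j)) n <= M j) ->
  rbox (cabs (fun k => csum (fun j => c j k) J)) n <= sum_n M J.
Proof.
  intros H; induction J as [|J IH].
  - rewrite sum_O. apply (H O).
  - rewrite sum_Sn. cbn [csum].
    apply Rle_trans with
      (rbox (fun k => cabs (fun k => csum (fun j => c j k) J) k
                      + cabs (c (S J)) k) n).
    + apply rbox_le; intros k; apply Cmod_triangle.
    + rewrite rbox_plus. apply Rplus_le_compat; auto.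
Qed.

Lemma sum_n_tail_le (M : nat -> R) (B : R) (J p : nat) :
  (forall j, 0 <= M j) -> is_series M B ->
  sum_n (fun j => M (S J + j)%nat) p <= B - sum_n M J.
Proof.
  intros HM HB.
  replace (sum_n (fun j => M (S J + j)%nat) p)
    with (sum_n M (S J + p) - sum_n M J).
  - pose proof (sum_n_le_series M B (S J + p) HM HB); lra.
  - induction p as [|p IH].
    + rewrite Nat.add_0_r, sum_Sn, sum_O, Nat.add_0_r. unfold plus; simpl; ring.
    + rewrite Nat.add_succ_r, !sum_Sn, <- IH, Nat.add_succ_r.
      unfold plus; simpl; ring.
Qed.

Lemma csum_split (a : nat -> C) (J p : nat) :
  csum a (S J + p) = (csum a J + csum (fun j => a (S J + j)%nat) p)%C.
Proof.
  induction p as [|p IH].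
  - rewrite Nat.add_0_r. simpl; rewrite Nat.add_0_r; reflexivity.
  - rewrite Nat.add_succ_r. cbn [csum]. rewrite IH, Nat.add_succ_r; ring.
Qed.

(** Completeness of the algebra, with the coefficients summed termwise. Products, the Neumann
    series, the Jost recursion and the division at an edge all rest on it. *)
Lemma wnorm_le_series (f : nat -> R -> C) (M : nat -> R) (F : R -> C) (B : R) :
  (forall j, wnorm_le (f j) (M j)) -> is_series M B ->
  (forall theta, cseries (fun j => f j theta) (F theta)) ->
  wnorm_le F B.
Proof.
  intros Hf HB HF.
  assert (HM : forall j, 0 <= M j) by (intros j; apply (wnorm_le_pos (f j)), Hf).
  destruct (choice (fun j c => (forall n, rbox (cabs c) n <= M j) /\
    (forall theta, clim (box (harm c theta)) (f j theta))) Hf) as [c Hc].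
  assert (Hd : forall k, exists d, cseries (fun j => c j k) d).
  { intros k. destruct (cseries_dominated (fun j => c j k) M B) as [d [Hd _]].
    - intros j; eapply Rle_trans; [ apply (coef_le_rbox (c j) k) | apply Hc ].
    - assumption.
    - exists d; assumption. }
  apply choice in Hd. destruct Hd as [d Hd].
  exists d; split.
  - intros n.
    apply (is_lim_seq_le (fun J => rbox (cabs (fun k => csum (fun j => c j k) J)) n)
      (fun _ => B) (rbox (cabs d) n) B).
    + intros J. eapply Rle_trans; [ apply (rbox_csum_le c M) | ].
      * intros j; apply Hc.
      * apply sum_n_le_series; assumption.
    + apply rbox_cabs_lim, Hd.
    + apply is_lim_seq_const.
  - intros theta. apply clim_Cmod_minus, is_lim_seq_spec. intros eps.
    assert (He : 0 < eps / 4) by (pose proof (cond_pos eps); lra).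
    (* Truncate the series in [j] first, then the trigonometric series. *)
    assert (HJ : exists J, B - sum_n M J < eps / 4 /\
      Cmod (csum (fun j => f j theta) J - F theta) < eps / 4).
    { pose proof (proj1 (is_series_is_lim_seq M B) HB) as H1.
      pose proof (proj1 (clim_Cmod_minus _ _) (HF theta)) as H2.
      apply is_lim_seq_spec in H1, H2.
      destruct (H1 (mkposreal _ He)) as [N1 HN1].
      destruct (H2 (mkposreal _ He)) as [N2 HN2].
      exists (max N1 N2). simpl in *.
      specialize (HN1 (max N1 N2) (Nat.le_max_l _ _)).
      specialize (HN2 (max N1 N2) (Nat.le_max_r _ _)).
      rewrite Rminus_0_r in HN2.
      split; [ apply Rabs_def2 in HN1 | apply Rabs_def2 in HN2 ]; lra. }
    destruct HJ as [J [HJ1 HJ2]].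
    assert (Hfin : clim (fun n => box (fun k => csum (fun j => harm (c j) theta k) J) n)
                        (csum (fun j => f j theta) J)).
    { clear HJ1 HJ2. induction J as [|J IH]; cbn [csum]; [ apply Hc | ].
      eapply clim_ext; [ intros n; symmetry; apply box_plus | ].
      apply clim_plus; [ assumption | apply Hc ]. }
    apply clim_Cmod_minus, is_lim_seq_spec in Hfin.
    destruct (Hfin (mkposreal _ He)) as [N HN]. exists N. intros n Hn.
    specialize (HN n Hn). simpl in HN. rewrite Rminus_0_r in *.
    rewrite Rabs_pos_eq in * by apply Cmod_ge_0.
    (* [T] holds the coefficients of the tail of the series; its norm is at most the tail of [M],
       uniformly in the window [n]. *)
    set (T := fun k => (d k - csum (fun j => c j k) J)%C).
    assert (HT : rbox (cabs T) n <= B - sum_n M J).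
    { apply (is_lim_seq_le
        (fun p => rbox (cabs (fun k => csum (fun j => c (S J + j)%nat k) p)) n)
        (fun _ => B - sum_n M J) (rbox (cabs T) n) (B - sum_n M J)).
      - intros p. eapply Rle_trans;
          [ apply (rbox_csum_le (fun j => c (S J + j)%nat)
                     (fun j => M (S J + j)%nat)); intros j; apply Hc | ].
        apply sum_n_tail_le; assumption.
      - apply rbox_cabs_lim. intros k. unfold T.
        apply (clim_ext (fun p => csum (fun j => c j k) (S J + p)
                                  - csum (fun j => c j k) J)%C).
        + intros p; rewrite csum_split; ring.
        + apply clim_minus; [ | apply clim_const ].
          specialize (Hd k). unfold cseries in Hd.
          rewrite clim_Cmod_minus in *.
          apply (is_lim_seq_incr_n _ (S J)) in Hd.
          eapply is_lim_seq_ext; [ | exact Hd ].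
          intros p; cbv beta; rewrite (Nat.add_comm p); reflexivity.
      - apply is_lim_seq_const. }
    assert (Hsplit : box (harm d theta) n =
      (box (harm T theta) n + box (fun k => csum (fun j => harm (c j) theta k) J) n)%C).
    { rewrite <- box_plus. apply box_ext; intros k.
      rewrite (csum_ext _ (fun j => expi (IZR k * theta) * c j k)%C)
        by (intros j; unfold harm; ring).
      rewrite csum_scal. unfold harm, T; ring. }
    rewrite Hsplit.
    pose proof (Cmod_box_harm_le T theta n) as HT'.
    replace (box (harm T theta) n +
       box (fun k => csum (fun j => harm (c j) theta k) J) n - F theta)%C
      with (box (harm T theta) n +
       ((box (fun k => csum (fun j => harm (c j) theta k) J) n
         - csum (fun j => f j theta) J)
        + (csum (fun j => f j theta) J - F theta)))%C by ring.
    eapply Rle_lt_trans; [ apply Cmod_triangle | ].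
    pose proof (Cmod_triangle
      (box (fun k => csum (fun j => harm (c j) theta k) J) n
         - csum (fun j => f j theta) J)
      (csum (fun j => f j theta) J - F theta)). lra.
Qed.

Lemma csum_box (c : Z -> C) (n : nat) :
  csum (fun j => match j with
                 | O => c 0%Z
                 | S _ => (c (Z.of_nat j) + c (- Z.of_nat j)%Z)%C
                 end) n = box c n.
Proof. induction n as [|n IH]; [ reflexivity | cbn [csum box]; now rewrite IH ]. Qed.

Lemma sum_n_rbox (c : Z -> R) (n : nat) :
  sum_n (fun j => match j with
                 | O => c 0%Z
                 | S _ => c (Z.of_nat j) + c (- Z.of_nat j)%Z
                 end) n = rbox c n.
Proof.
  induction n as [|n IH]; [ rewrite sum_O; reflexivity | ].
  rewrite sum_Sn, IH; reflexivity.
Qed.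

(** The product is summed as a series of shifts of [g] weighted by the coefficients of [f], the
    frequencies [j] and [-j] being paired as in [box]; this replaces a convolution over [Z]. *)
Lemma wnorm_le_mult (f g : R -> C) (M N : R) :
  wnorm_le f M -> wnorm_le g N ->
  wnorm_le (fun theta => f theta * g theta)%C (M * N).
Proof.
  intros [c [Hc Hf]] Hg.
  (* [wnorm_le_series] asks for a majorant with a known sum; [L] is the exact sum that [M] only
     bounds. *)
  destruct (bounded_rbox_cabs_lim c M Hc) as [L [HL [HLM _]]].
  pose proof (wnorm_le_pos g N Hg) as HN.
  apply wnorm_le_weaken with (N * L);
    [ | rewrite Rmult_comm; apply Rmult_le_compat_r; assumption ].
  apply (wnorm_le_series
    (fun j theta => g theta * match j with
                 | O => harm c theta 0%Z
                 | S _ => (harm c theta (Z.of_nat j) + harm c theta (- Z.of_nat j)%Z)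
                 end)%C
    (fun j => N * match j with
                 | O => cabs c 0%Z
                 | S _ => cabs c (Z.of_nat j) + cabs c (- Z.of_nat j)%Z
                 end)).
  - assert (Hk : forall k,
      wnorm_le (fun theta => g theta * harm c theta k)%C (N * cabs c k)).
    { intros k. apply (wnorm_le_expi_Z k), (wnorm_le_scal (c k)) in Hg.
      rewrite Rmult_comm. apply (wnorm_le_ext _ _ _) with (2 := Hg).
      intros theta; unfold harm; ring. }
    intros [|j]; [ apply Hk | ].
    rewrite Rmult_plus_distr_l.
    apply (wnorm_le_ext (fun theta =>
      g theta * harm c theta (Z.of_nat (S j)) +
      g theta * harm c theta (- Z.of_nat (S j))%Z)%C);
      [ intros; ring | apply wnorm_le_plus; apply Hk ].
  - apply (is_series_scal_l N (fun j => match j with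
                 | O => cabs c 0%Z
                 | S _ => cabs c (Z.of_nat j) + cabs c (- Z.of_nat j)%Z
                 end) L). apply is_series_is_lim_seq.
    apply (is_lim_seq_ext (rbox (cabs c))); [ | exact HL ].
    intros n; symmetry; apply sum_n_rbox.
  - intros theta. rewrite (Cmult_comm (f theta)). apply cseries_scal.
    eapply clim_ext; [ | apply Hf ].
    intros n; symmetry; apply (csum_box (harm c theta)).
Qed.

(** * Periodicity, approximation by partial sums and uniform continuity *)

Lemma expi_2PI_nat (n : nat) : expi (INR n * (2 * PI)) = 1%C.
Proof.
  induction n as [|n IH]; [ simpl; rewrite Rmult_0_l; apply expi_0 | ].
  rewrite S_INR, Rmult_plus_distr_r, Rmult_1_l, expi_plus, IH.
  unfold expi; rewrite cos_2PI, sin_2PI. apply Cmult_1_l.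
Qed.

Lemma expi_2PI_Z (k : Z) : expi (IZR k * (2 * PI)) = 1%C.
Proof.
  destruct (Z_le_gt_dec 0 k) as [Hk|Hk].
  - rewrite <- (Z2Nat.id k), <- INR_IZR_INZ by assumption. apply expi_2PI_nat.
  - replace (IZR k * (2 * PI)) with (- (INR (Z.to_nat (- k)) * (2 * PI)))
      by (rewrite INR_IZR_INZ, Z2Nat.id, opp_IZR by lia; ring).
    rewrite <- Cconj_expi, expi_2PI_nat.
    apply injective_projections; simpl; ring.
Qed.

Lemma wnorm_le_periodic (f : R -> C) (M theta : R) (k : Z) :
  wnorm_le f M -> f (theta + IZR k * (2 * PI)) = f theta.
Proof.
  intros [c [_ Hf]]. eapply clim_unique; [ apply Hf | ].
  eapply clim_ext; [ | apply Hf ]. intros n; apply box_ext; intros j.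
  unfold harm. rewrite Rmult_plus_distr_l, expi_plus, <- Rmult_assoc, <- mult_IZR,
    expi_2PI_Z. ring.
Qed.

Lemma wnorm_le_sub_2PI (f : R -> C) (M theta : R) :
  wnorm_le f M -> exists t, 0 <= t <= 2 * PI /\ f theta = f t.
Proof.
  intros Hf. pose proof PI_RGT_0.
  exists (theta + IZR (- Int_part (theta / (2 * PI))) * (2 * PI)).
  rewrite (wnorm_le_periodic f M) by assumption. split; [ | reflexivity ].
  rewrite opp_IZR. destruct (base_Int_part (theta / (2 * PI))) as [H1 H2].
  set (k := IZR (Int_part (theta / (2 * PI)))) in *.
  replace theta with (theta / (2 * PI) * (2 * PI)) by (field; lra).
  set (y := theta / (2 * PI)) in *. nra.
Qed.

Lemma Rabs_sin_le (x : R) : Rabs (sin x) <= Rabs x.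
Proof.
  assert (H : forall y, 0 <= y -> Rabs (sin y) <= y).
  { intros y Hy. destruct (Rle_lt_dec 1 y) as [H1|H1].
    - eapply Rle_trans; [ apply Rabs_le, SIN_bound | assumption ].
    - destruct Hy as [Hy|Hy]; [ | subst y; rewrite sin_0, Rabs_R0; lra ].
      pose proof PI2_1. rewrite Rabs_pos_eq.
      + apply Rlt_le, sin_lt_x, Hy.
      + apply Rlt_le, sin_gt_0; lra. }
  destruct (Rle_lt_dec 0 x) as [Hx|Hx].
  - rewrite (Rabs_pos_eq x) by assumption; apply H, Hx.
  - rewrite (Rabs_left x) by assumption.
    rewrite <- (Rabs_Ropp (sin x)), <- sin_neg. apply H; lra.
Qed.

Lemma expi_lipschitz (a b : R) : Cmod (expi a - expi b) <= 2 * Rabs (a - b).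
Proof.
  eapply Rle_trans; [ apply Cmod_le_Re_Im | ].
  unfold Re, Im, expi; simpl.
  change (cos a + - cos b) with (cos a - cos b).
  change (sin a + - sin b) with (sin a - sin b).
  rewrite form2, form4, !Rabs_mult, (Rabs_pos_eq 2) by lra.
  replace (Rabs (-2)) with 2 by (rewrite Rabs_left; lra).
  pose proof (Rabs_sin_le ((a - b) / 2)) as H.
  replace (Rabs (a - b)) with (2 * Rabs ((a - b) / 2)).
  2: { rewrite <- (Rabs_pos_eq 2) at 1 by lra. rewrite <- Rabs_mult.
       f_equal; field. }
  assert (Rabs (sin ((a + b) / 2)) <= 1) by (apply Rabs_le, SIN_bound).
  assert (Rabs (cos ((a + b) / 2)) <= 1) by (apply Rabs_le, COS_bound).
  pose proof (Rabs_pos (sin ((a - b) / 2))).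
  pose proof (Rabs_pos (sin ((a + b) / 2))).
  pose proof (Rabs_pos (cos ((a + b) / 2))). nra.
Qed.

Lemma box_harm_lipschitz (c : Z -> C) (n : nat) :
  exists K, 0 <= K /\ forall a b,
    Cmod (box (harm c a) n - box (harm c b) n) <= K * Rabs (a - b).
Proof.
  assert (H1 : forall k, exists K, 0 <= K /\
    forall a b, Cmod (harm c a k - harm c b k) <= K * Rabs (a - b)).
  { intros k. exists (Cmod (c k) * (2 * Rabs (IZR k))).
    pose proof (Cmod_ge_0 (c k)); pose proof (Rabs_pos (IZR k)).
    split; [ nra | ]. intros a b. unfold harm.
    replace (c k * expi (IZR k * a) - c k * expi (IZR k * b))%C
      with (c k * (expi (IZR k * a) - expi (IZR k * b)))%C by ring.
    rewrite Cmod_mult, (Rmult_assoc (Cmod (c k))), (Rmult_assoc 2), <- Rabs_mult.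
    apply Rmult_le_compat_l; [ assumption | ].
    eapply Rle_trans; [ apply expi_lipschitz | right; do 2 f_equal; ring ]. }
  induction n as [|n [K [HK IH]]]; [ apply H1 | ].
  destruct (H1 (Z.of_nat (S n))) as [K1 [HK1 H2]].
  destruct (H1 (- Z.of_nat (S n))%Z) as [K2 [HK2 H3]].
  exists (K + (K1 + K2)); split; [ lra | ].
  intros a b; cbn [box]. specialize (IH a b); specialize (H2 a b); specialize (H3 a b).
  match goal with |- Cmod (?x + (?y + ?z) - (?x' + (?y' + ?z'))) <= _ =>
    replace (x + (y + z) - (x' + (y' + z')))%C
      with ((x - x') + ((y - y') + (z - z')))%C by ring;
    pose proof (Cmod_triangle (x - x') ((y - y') + (z - z')));
    pose proof (Cmod_triangle (y - y') (z - z')) end.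
  lra.
Qed.

Definition trunc (N : nat) (c : Z -> C) (k : Z) : C :=
  if Z.leb (Z.abs k) (Z.of_nat N) then c k else 0%C.

Lemma box_trunc (N : nat) (c : Z -> C) (theta : R) (n : nat) :
  box (harm (trunc N c) theta) n = box (harm c theta) (min n N).
Proof.
  induction n as [|n IH].
  - cbn [box Nat.min]. unfold harm, trunc.
    destruct (Z.leb_spec (Z.abs 0) (Z.of_nat N)); [ reflexivity | lia ].
  - cbn [box]. rewrite IH. unfold harm at 2 3, trunc.
    destruct (Z.leb_spec (Z.abs (Z.of_nat (S n))) (Z.of_nat N));
    destruct (Z.leb_spec (Z.abs (- Z.of_nat (S n))) (Z.of_nat N)); try lia.
    + rewrite !Nat.min_l by lia. reflexivity.
    + rewrite !Nat.min_r by lia. ring.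
Qed.

Lemma rbox_trunc (N : nat) (c : Z -> C) (n : nat) :
  rbox (cabs (trunc N c)) n = rbox (cabs c) (min n N).
Proof.
  induction n as [|n IH].
  - cbn [rbox Nat.min]. unfold cabs, trunc.
    destruct (Z.leb_spec (Z.abs 0) (Z.of_nat N)); [ reflexivity | lia ].
  - cbn [rbox]. rewrite IH. unfold cabs at 2 3, trunc.
    destruct (Z.leb_spec (Z.abs (Z.of_nat (S n))) (Z.of_nat N));
    destruct (Z.leb_spec (Z.abs (- Z.of_nat (S n))) (Z.of_nat N)); try lia.
    + rewrite !Nat.min_l by lia. reflexivity.
    + rewrite !Nat.min_r, Cmod_0 by lia. ring.
Qed.

Lemma wnorm_le_trig_approx (f : R -> C) (M eps : R) :
  wnorm_le f M -> 0 < eps ->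
  exists (c : Z -> C) (N : nat),
    wnorm_le (fun theta => f theta - box (harm c theta) N)%C eps.
Proof.
  intros [c [Hc Hf]] Heps. exists c.
  destruct (bounded_rbox_cabs_lim c M Hc) as [L [HL [_ HcL]]].
  apply is_lim_seq_spec in HL. destruct (HL (mkposreal _ Heps)) as [N HN].
  specialize (HN N (Nat.le_refl _)); simpl in HN. exists N.
  exists (fun k => c k - trunc N c k)%C; split.
  - intros n. apply Rle_trans with (L - rbox (cabs c) N);
      [ | apply Rabs_def2 in HN; lra ].
    replace (rbox (cabs (fun k => c k - trunc N c k)%C) n)
      with (rbox (fun k => cabs c k + (-1) * cabs (trunc N c) k) n).
    + rewrite rbox_plus, rbox_scal, rbox_trunc.
      destruct (Nat.le_gt_cases n N).
      * rewrite Nat.min_l by assumption. specialize (HcL N); lra.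
      * rewrite Nat.min_r by lia. specialize (HcL n); lra.
    + apply rbox_ext; intros k. unfold cabs, trunc.
      destruct (Z.leb (Z.abs k) (Z.of_nat N)).
      * replace (c k - c k)%C with (RtoC 0) by ring. rewrite Cmod_0; ring.
      * rewrite Cmod_0; replace (c k - 0)%C with (c k) by ring. ring.
  - intros theta.
    apply (clim_ext (fun n => box (harm c theta) n
                              - box (harm c theta) (min n N))%C).
    + intros n. rewrite <- (box_trunc N).
      replace (box (harm c theta) n - box (harm (trunc N c) theta) n)%C
        with (box (harm c theta) n + (- (1)) * box (harm (trunc N c) theta) n)%C
        by ring.
      rewrite <- box_scal, <- box_plus. apply box_ext; intros k; unfold harm; ring.
    + apply clim_minus; [ apply Hf | ].
      apply clim_Cmod_minus, is_lim_seq_spec. intros e; exists N; intros n Hn.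
      rewrite Nat.min_r by assumption.
      replace (box (harm c theta) N - box (harm c theta) N)%C with (RtoC 0) by ring.
      rewrite Cmod_0, Rminus_0_r, Rabs_R0. apply cond_pos.
Qed.

Lemma wnorm_le_uniformly_continuous (f : R -> C) (M eps : R) :
  wnorm_le f M -> 0 < eps ->
  exists delta, 0 < delta /\
    forall a b, Rabs (a - b) < delta -> Cmod (f a - f b) < eps.
Proof.
  intros Hf Heps.
  destruct (wnorm_le_trig_approx f M (eps / 3) Hf) as [c [N H]]; [ lra | ].
  destruct (box_harm_lipschitz c N) as [K [HK HL]].
  (* [K + 1] instead of the Lipschitz constant [K] keeps the quotient positive when [K = 0]. *)
  exists (eps / (3 * (K + 1))); split; [ apply Rdiv_lt_0_compat; lra | ].
  intros a b Hab.
  pose proof (wnorm_le_sup _ _ a H) as Ha; pose proof (wnorm_le_sup _ _ b H) as Hb.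
  specialize (HL a b). cbv beta in *.
  set (x := box (harm c a) N) in *; set (y := box (harm c b) N) in *.
  assert (K * Rabs (a - b) < eps / 3).
  { apply Rle_lt_trans with ((K + 1) * Rabs (a - b));
      [ pose proof (Rabs_pos (a - b)); nra | ].
    replace (eps / 3) with ((K + 1) * (eps / (3 * (K + 1)))) by (field; lra).
    apply Rmult_lt_compat_l; lra. }
  replace (f a - f b)%C with ((f a - x) + ((x - y) + - (f b - y)))%C by ring.
  pose proof (Cmod_triangle (f a - x) ((x - y) + - (f b - y))).
  pose proof (Cmod_triangle (x - y) (- (f b - y))).
  rewrite Cmod_opp in *. lra.
Qed.

Lemma wnorm_le_filterlim (f : R -> C) (M theta : R) :
  wnorm_le f M -> filterlim f (locally theta) (locally (f theta)).
Proof.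
  intros Hf. apply (filterlim_locally_ball_norm (K := C_AbsRing)
    (U := C_NormedModule)).
  intros eps.
  destruct (wnorm_le_uniformly_continuous f M eps Hf (cond_pos eps))
    as [delta [Hd H]].
  exists (mkposreal _ Hd). intros y Hy. apply H, Hy.
Qed.

(** * Trigonometric polynomials and their coefficients *)

Definition trig_poly (N : nat) (f : R -> C) : Prop :=
  exists c : Z -> C, forall theta, f theta = box (harm c theta) N.

Lemma trig_poly_ext (N : nat) (f g : R -> C) :
  (forall theta, f theta = g theta) -> trig_poly N f -> trig_poly N g.
Proof. intros H [c Hc]; exists c; intros theta; rewrite <- H; apply Hc. Qed.

Lemma trig_poly_const (z : C) : trig_poly 0 (fun _ => z).
Proof.
  exists (fun _ => z). intros theta; unfold harm; simpl.
  rewrite Rmult_0_l, expi_0; ring.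
Qed.

Lemma trig_poly_weaken (N P : nat) (f : R -> C) :
  (N <= P)%nat -> trig_poly N f -> trig_poly P f.
Proof.
  intros H [c Hc]. exists (trunc N c). intros theta.
  rewrite box_trunc, Nat.min_r by assumption. apply Hc.
Qed.

Lemma trig_poly_plus (N : nat) (f g : R -> C) :
  trig_poly N f -> trig_poly N g -> trig_poly N (fun theta => f theta + g theta)%C.
Proof.
  intros [c Hc] [d Hd]. exists (fun k => c k + d k)%C. intros theta.
  rewrite Hc, Hd, <- box_plus. apply box_ext; intros k; unfold harm; ring.
Qed.

Lemma trig_poly_scal (N : nat) (z : C) (f : R -> C) :
  trig_poly N f -> trig_poly N (fun theta => z * f theta)%C.
Proof.
  intros [c Hc]. exists (fun k => z * c k)%C. intros theta.
  rewrite Hc, <- box_scal. apply box_ext; intros k; unfold harm; ring.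
Qed.

Lemma trig_poly_opp_arg (N : nat) (f : R -> C) :
  trig_poly N f -> trig_poly N (fun theta => f (- theta)).
Proof.
  intros [c Hc]. exists (fun k => c (- k)%Z). intros theta.
  rewrite Hc, <- box_opp_index. apply box_ext; intros k.
  unfold harm. rewrite opp_IZR. do 2 f_equal; ring.
Qed.

Lemma trig_poly_expi (N : nat) (f : R -> C) :
  trig_poly N f -> trig_poly (S N) (fun theta => expi theta * f theta)%C.
Proof.
  intros [c Hc]. exists (fun k => trunc N c (k - 1)). intros theta.
  rewrite box_harm_pred, box_trunc, Nat.min_r, <- Hc by lia.
  replace (harm (trunc N c) theta (- Z.of_nat (S (S N)))) with (RtoC 0).
  2: { unfold harm, trunc.
       destruct (Z.leb_spec (Z.abs (- Z.of_nat (S (S N)))) (Z.of_nat N));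
         [ lia | ring ]. }
  replace (harm (trunc N c) theta (Z.of_nat (S N))) with (RtoC 0).
  2: { unfold harm, trunc.
       destruct (Z.leb_spec (Z.abs (Z.of_nat (S N))) (Z.of_nat N));
         [ lia | ring ]. }
  ring.
Qed.

Lemma trig_poly_expi_nat (n N : nat) (f : R -> C) :
  trig_poly N f ->
  trig_poly (n + N) (fun theta => expi (INR n * theta) * f theta)%C.
Proof.
  intros H; induction n as [|n IH].
  - apply (trig_poly_ext _ f); [ | assumption ].
    intros theta; simpl; rewrite Rmult_0_l, expi_0; ring.
  - apply trig_poly_expi in IH. apply (trig_poly_ext _ _ _) with (2 := IH).
    intros theta; cbv beta. rewrite S_INR.
    replace ((INR n + 1) * theta) with (theta + INR n * theta) by ring.
    rewrite expi_plus; ring.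
Qed.

Lemma trig_poly_mult (N P : nat) (f g : R -> C) :
  trig_poly N f -> trig_poly P g ->
  trig_poly (N + P) (fun theta => f theta * g theta)%C.
Proof.
  intros [c Hc] Hg.
  apply (trig_poly_ext _ (fun theta => box (harm c theta) N * g theta)%C);
    [ intros theta; rewrite Hc; reflexivity | ].
  clear f Hc. induction N as [|N IH].
  - apply (trig_poly_ext _ (fun theta => c 0%Z * g theta)%C);
      [ | apply trig_poly_scal, Hg ].
    intros theta; unfold harm; simpl. rewrite Rmult_0_l, expi_0; ring.
  - pose proof (trig_poly_weaken (N + P) (S N + P) _ ltac:(lia) IH) as H1.
    pose proof (trig_poly_scal _ (c (Z.of_nat (S N))) _
                  (trig_poly_expi_nat (S N) P g Hg)) as H2.
    (* The negative frequency is reached by reflecting [g], multiplying by the positive frequency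
       and reflecting back. *)
    pose proof (trig_poly_scal _ (c (- Z.of_nat (S N))%Z) _
      (trig_poly_opp_arg _ _
        (trig_poly_expi_nat (S N) P _ (trig_poly_opp_arg _ _ Hg)))) as H3.
    pose proof (trig_poly_plus _ _ _ H1 (trig_poly_plus _ _ _ H2 H3)) as H4.
    apply (trig_poly_ext _ _ _) with (2 := H4).
    intros theta; cbn [box]; unfold harm at 3 4.
    rewrite Ropp_involutive, INR_IZR_INZ, opp_IZR.
    replace (- IZR (Z.of_nat (S N)) * theta) with (IZR (Z.of_nat (S N)) * - theta)
      by ring.
    ring.
Qed.

Lemma box_ext_le (c d : Z -> C) (n : nat) :
  (forall k, (Z.abs k <= Z.of_nat n)%Z -> c k = d k) -> box c n = box d n.
Proof.
  induction n as [|n IH]; intros H; cbn [box]; [ apply H; lia | ].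
  rewrite IH by (intros k Hk; apply H; lia).
  rewrite !H by lia. reflexivity.
Qed.

Lemma box_delta (k : Z) (z : C) (n : nat) :
  box (fun j => if Z.eqb j k then z else 0%C) n =
  if Z.leb (Z.abs k) (Z.of_nat n) then z else 0%C.
Proof.
  induction n as [|n IH]; cbn [box].
  - destruct (Z.eqb_spec 0 k); destruct (Z.leb_spec (Z.abs k) (Z.of_nat 0));
      try lia; reflexivity.
  - rewrite IH.
    destruct (Z.eqb_spec (Z.of_nat (S n)) k);
    destruct (Z.eqb_spec (- Z.of_nat (S n)) k);
    destruct (Z.leb_spec (Z.abs k) (Z.of_nat n));
    destruct (Z.leb_spec (Z.abs k) (Z.of_nat (S n))); try lia; ring.
Qed.

Lemma csum_box_swap (F : nat -> Z -> C) (n N : nat) :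
  csum (fun j => box (F j) N) n = box (fun k => csum (fun j => F j k) n) N.
Proof.
  induction n as [|n IH]; cbn [csum]; [ reflexivity | ].
  rewrite IH, <- box_plus. reflexivity.
Qed.

Lemma csum_const (z : C) (n : nat) : csum (fun _ => z) n = (RtoC (INR (S n)) * z)%C.
Proof.
  induction n as [|n IH]; [ simpl; ring | ].
  cbn [csum]. rewrite IH, (S_INR (S n)), RtoC_plus. ring.
Qed.

Lemma geometric_expi (t : R) (n : nat) :
  ((expi t - 1) * csum (fun j => expi (INR j * t)) n)%C =
  (expi (INR (S n) * t) - 1)%C.
Proof.
  induction n as [|n IH].
  - simpl csum. rewrite S_INR. simpl INR.
    rewrite Rplus_0_l, Rmult_1_l, Rmult_0_l, expi_0; ring.
  - cbn [csum]. rewrite Cmult_plus_distr_l, IH.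
    rewrite (S_INR (S n)), Rmult_plus_distr_r, Rmult_1_l, expi_plus. ring.
Qed.

Lemma expi_neq_1 (t : R) : 0 < Rabs t < 2 * PI -> expi t <> 1%C.
Proof.
  intros Ht E. assert (Hc : cos (Rabs t) = 1).
  { unfold expi in E. injection E as E1 E2. unfold Rabs; destruct (Rcase_abs t);
      rewrite ?cos_neg; assumption. }
  replace (Rabs t) with (2 * (Rabs t / 2)) in Hc by field.
  rewrite cos_2a_sin in Hc.
  assert (0 < sin (Rabs t / 2)) by (apply sin_gt_0; lra). nra.
Qed.

(** For [0 < |k| <= n] the angle [2 pi k / (n + 1)] has modulus strictly between 0 and [2 pi], so
    the ratio of the geometric sum differs from 1, while its [n + 1]-st power is 1. *)
Lemma csum_roots_of_unity (k : Z) (n : nat) :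
  (Z.abs k <= Z.of_nat n)%Z ->
  csum (fun j => expi (IZR k * (INR j * (2 * PI / INR (S n))))) n =
  if Z.eqb k 0 then RtoC (INR (S n)) else 0%C.
Proof.
  intros Hk.
  assert (Hn : 0 < INR (S n)) by (apply lt_0_INR; lia).
  pose proof PI_RGT_0 as HPI.
  destruct (Z.eqb_spec k 0) as [->|Hk0].
  - rewrite (csum_ext _ (fun _ => 1%C)).
    + rewrite csum_const; ring.
    + intros j; rewrite Rmult_0_l; apply expi_0.
  - rewrite (csum_ext _ (fun j => expi (INR j * (IZR k * (2 * PI / INR (S n))))))
      by (intros j; f_equal; ring).
    set (t := IZR k * (2 * PI / INR (S n))).
    assert (Ht : expi t <> 1%C).
    { apply expi_neq_1. unfold t.
      rewrite Rabs_mult, (Rabs_pos_eq (2 * PI / _))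
        by (apply Rlt_le, Rdiv_lt_0_compat; lra).
      rewrite <- abs_IZR.
      assert (0 < IZR (Z.abs k)) by (apply IZR_lt; lia).
      assert (IZR (Z.abs k) < INR (S n))
        by (rewrite INR_IZR_INZ; apply IZR_lt; lia).
      split.
      - apply Rmult_lt_0_compat; [ | apply Rdiv_lt_0_compat ]; lra.
      - replace (2 * PI) with (INR (S n) * (2 * PI / INR (S n))) at 2
          by (field; lra).
        apply Rmult_lt_compat_r; [ apply Rdiv_lt_0_compat | ]; lra. }
    pose proof (geometric_expi t n) as H.
    replace (INR (S n) * t) with (IZR k * (2 * PI)) in H by (unfold t; field; lra).
    rewrite expi_2PI_Z in H.
    replace (1 - 1)%C with (RtoC 0) in H by ring.
    assert (Hq : (expi t - 1)%C <> 0%C).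
    { intros E; apply Ht. replace (expi t) with (expi t - 1 + 1)%C by ring.
      rewrite E; ring. }
    rewrite <- (Cmult_1_l (csum _ _)), <- (Cinv_l _ Hq), <- Cmult_assoc, H. ring.
Qed.

(* Averaging [f e^{-ik}] over the [2N+1]-st roots of unity isolates the [k]-th
   coefficient. *)
Lemma trig_poly_coef_bound (c : Z -> C) (N : nat) (r : R) (k : Z) :
  (forall theta, Cmod (box (harm c theta) N) <= r) ->
  (Z.abs k <= Z.of_nat N)%Z -> Cmod (c k) <= r.
Proof.
  (* Two frequencies of modulus at most [N] differ by at most [n = 2 N], the range in which [n + 1]
     sample points separate them. *)
  intros Hr Hk. set (n := (2 * N)%nat).
  assert (Hn : 0 < INR (S n)) by (apply lt_0_INR; lia).
  set (x := fun j => INR j * (2 * PI / INR (S n))).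
  assert (E : csum (fun j => expi (IZR (- k) * x j) * box (harm c (x j)) N)%C n =
              (RtoC (INR (S n)) * c k)%C).
  { rewrite (csum_ext _
      (fun j => box (fun i => c i * expi (IZR (i - k) * x j))%C N)).
    - rewrite csum_box_swap.
      rewrite (box_ext_le _ (fun i => if Z.eqb i k then RtoC (INR (S n)) * c k
                                      else 0)%C).
      + rewrite box_delta. destruct (Z.leb_spec (Z.abs k) (Z.of_nat N));
          [ reflexivity | lia ].
      + intros i Hi. rewrite csum_scal. unfold x.
        rewrite csum_roots_of_unity by lia.
        destruct (Z.eqb_spec i k) as [->|Hik].
        * rewrite Z.sub_diag; simpl Z.eqb; cbv iota. ring.
        * destruct (Z.eqb_spec (i - k) 0); [ lia | ring ].
    - intros j. rewrite <- box_scal. apply box_ext; intros i. unfold harm.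
      unfold Z.sub; rewrite plus_IZR, Rmult_plus_distr_r, expi_plus. ring. }
  assert (H : INR (S n) * Cmod (c k) <= INR (S n) * r).
  { replace (INR (S n) * Cmod (c k)) with (Cmod (RtoC (INR (S n)) * c k)).
    2: { rewrite Cmod_mult, Cmod_R, Rabs_pos_eq by lra; reflexivity. }
    rewrite <- E. eapply Rle_trans; [ apply (Cmod_csum_le _ (fun _ => r)) | ].
    - intros j. rewrite Cmod_mult, Cmod_expi, Rmult_1_l; apply Hr.
    - rewrite sum_n_const; lra. }
  apply Rmult_le_reg_l in H; assumption.
Qed.

Lemma rbox_const_bound (c : Z -> R) (r : R) (n : nat) :
  (forall k, (Z.abs k <= Z.of_nat n)%Z -> c k <= r) ->
  rbox c n <= (2 * INR n + 1) * r.
Proof.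
  induction n as [|n IH]; intros H; cbn [rbox].
  - simpl. specialize (H 0%Z ltac:(lia)); lra.
  - rewrite S_INR.
    pose proof (H (Z.of_nat (S n)) ltac:(lia)).
    pose proof (H (- Z.of_nat (S n))%Z ltac:(lia)).
    assert (rbox c n <= (2 * INR n + 1) * r) by (apply IH; intros; apply H; lia).
    lra.
Qed.

Lemma trig_poly_wnorm_le (f : R -> C) (N : nat) (r : R) :
  trig_poly N f -> (forall theta, Cmod (f theta) <= r) ->
  wnorm_le f ((2 * INR N + 1) * r).
Proof.
  intros [c Hc] Hr. exists (trunc N c); split.
  - intros n. rewrite rbox_trunc.
    eapply Rle_trans; [ apply (rbox_incr c (min n N) N); lia | ].
    apply rbox_const_bound. intros k Hk.
    apply (trig_poly_coef_bound c N r k); [ | assumption ].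
    intros theta; rewrite <- Hc; apply Hr.
  - intros theta. rewrite Hc.
    apply clim_Cmod_minus, is_lim_seq_spec. intros e; exists N; intros n Hn.
    rewrite box_trunc, Nat.min_r by assumption.
    replace (box (harm c theta) N - box (harm c theta) N)%C with (RtoC 0) by ring.
    rewrite Cmod_0, Rminus_0_r, Rabs_R0. apply cond_pos.
Qed.

(** * Powers, the Neumann series and inversion *)

Lemma trig_poly_pow (f : R -> C) (N n : nat) :
  trig_poly N f -> trig_poly (n * N) (fun theta => f theta ^ n)%C.
Proof.
  intros H; induction n as [|n IH]; [ apply (trig_poly_const 1%C) | ].
  apply (trig_poly_mult N (n * N) f); assumption.
Qed.

(* Splitting [g = P + e] one factor at a time avoids the binomial formula. *)
Lemma wnorm_le_pow_mixed (P g : R -> C) (N : nat) (r eps : R) :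
  trig_poly N P -> (forall theta, Cmod (P theta) <= r) ->
  wnorm_le (fun theta => g theta - P theta)%C eps ->
  forall n j, wnorm_le (fun theta => P theta ^ j * g theta ^ n)%C
    ((2 * INR (n + j) * INR N + 1) * (r ^ j * (r + eps) ^ n)).
Proof.
  intros HP Hr He.
  assert (Hr0 : 0 <= r) by (eapply Rle_trans; [ | apply (Hr 0) ]; apply Cmod_ge_0).
  pose proof (wnorm_le_pos _ _ He) as He0.
  induction n as [|n IH]; intros j.
  - simpl Nat.add; simpl pow. rewrite Rmult_1_r.
    apply (wnorm_le_ext (fun theta => P theta ^ j)%C);
      [ intros; simpl; ring | ].
    rewrite Rmult_assoc, <- mult_INR.
    apply trig_poly_wnorm_le; [ apply trig_poly_pow, HP | ].
    intros theta. rewrite Cmod_pow.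
    apply pow_incr; split; [ apply Cmod_ge_0 | apply Hr ].
  (* [P^j g^{n+1} = P^{j+1} g^n + (g - P) P^j g^n]. The first term keeps the total exponent
     [n + 1 + j], the second gains a factor [eps]; together they produce the factor [r + eps]. *)
  - pose proof (wnorm_le_plus _ _ _ _ (IH (S j)) (wnorm_le_mult _ _ _ _ He (IH j)))
      as H.
    apply (wnorm_le_ext _
      (fun theta => P theta ^ j * g theta ^ (S n))%C) in H;
      [ | intros; simpl; ring ].
    apply (wnorm_le_weaken _ _ _ H).
    rewrite Nat.add_succ_r. change (S n + j)%nat with (S (n + j)).
    rewrite S_INR. simpl pow. set (A := r ^ j * (r + eps) ^ n).
    assert (HA : 0 <= A)
      by (apply Rmult_le_pos; apply pow_le; lra).
    pose proof (pos_INR (n + j)); pose proof (pos_INR N).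
    replace (r * r ^ j * (r + eps) ^ n) with (r * A) by (unfold A; ring).
    replace (r ^ j * ((r + eps) * (r + eps) ^ n)) with ((r + eps) * A)
      by (unfold A; ring).
    assert (0 <= eps * A) by (apply Rmult_le_pos; assumption).
    assert (0 <= eps * A * INR N) by (apply Rmult_le_pos; assumption).
    nra.
Qed.

(** [n t^n] is at most [1 + t + ... + t^{n-1}], since each of these terms is at least [t^n]. *)
Lemma INR_pow_bound (t : R) (n : nat) :
  0 <= t < 1 -> INR n * t ^ n <= / (1 - t).
Proof.
  intros Ht.
  assert (H : INR n * t ^ n * (1 - t) <= 1 - t ^ n).
  { induction n as [|n IH]; [ simpl; lra | ].
    rewrite S_INR. simpl pow.
    assert (0 <= t ^ n <= 1)
      by (split; [ apply pow_le; lra | rewrite <- (pow1 n); apply pow_incr; lra ]).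
    assert (t * (INR n * t ^ n * (1 - t)) <= t * (1 - t ^ n))
      by (apply Rmult_le_compat_l; lra).
    assert ((1 - t) * (t * t ^ n) <= (1 - t) * 1)
      by (apply Rmult_le_compat_l; nra).
    lra. }
  assert (0 <= t ^ n) by (apply pow_le; lra).
  apply (Rmult_le_reg_r (1 - t)); [ lra | ].
  rewrite Rinv_l by lra. lra.
Qed.

(** With [s = t^2], one factor [t^n] absorbs the linear growth and the other remains as a convergent
    geometric series. *)
Lemma ex_series_affine_geometric (a s : R) :
  0 <= a -> 0 <= s < 1 -> ex_series (fun n => (2 * INR n * a + 1) * s ^ n).
Proof.
  intros Ha Hs. set (t := sqrt s).
  assert (Ht : 0 <= t < 1).
  { split; [ apply sqrt_pos | rewrite <- sqrt_1; apply sqrt_lt_1; lra ]. }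
  assert (Hst : s = t * t) by (symmetry; apply sqrt_sqrt; lra).
  apply (ex_series_le (K := R_AbsRing) (V := R_CompleteNormedModule) _
    (fun n => (2 * a * / (1 - t) + 1) * t ^ n)).
  - intros n. unfold norm; simpl; unfold abs; simpl.
    assert (0 <= t ^ n <= 1)
      by (split; [ apply pow_le; lra | rewrite <- (pow1 n); apply pow_incr; lra ]).
    pose proof (pos_INR n). pose proof (INR_pow_bound t n Ht).
    assert (Hna : 0 <= INR n * a) by (apply Rmult_le_pos; assumption).
    rewrite Hst, Rpow_mult_distr, Rabs_pos_eq
      by (apply Rmult_le_pos; [ lra | apply Rmult_le_pos; lra ]).
    rewrite <- Rmult_assoc. apply Rmult_le_compat_r; [ lra | ].
    assert (a * (INR n * t ^ n) <= a * / (1 - t))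
      by (apply Rmult_le_compat_l; assumption). nra.
  - apply (ex_series_scal_l (2 * a * / (1 - t) + 1) (fun n => t ^ n)).
    apply ex_series_geom. rewrite Rabs_pos_eq; lra.
Qed.

Lemma cseries_geometric (z : C) :
  Cmod z < 1 -> cseries (fun n => z ^ n)%C (/ (1 - z))%C.
Proof.
  intros Hz. assert (Hz1 : (1 - z)%C <> 0%C).
  { intros E. assert (z = 1%C) by (rewrite <- (Cplus_0_r z), <- E; ring).
    subst z. rewrite Cmod_1 in Hz; lra. }
  apply (clim_ext (fun n => / (1 - z) * (1 - z * z ^ n))%C).
  - intros n; induction n as [|n IH].
    + simpl. field. exact Hz1.
    + cbn [csum]. rewrite <- IH. simpl. field. exact Hz1.
  - apply (eq_ind (/ (1 - z) * (1 - z * 0))%C (clim _)); [ | ring ].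
    apply clim_mult; [ apply clim_const | ].
    apply clim_minus; [ apply clim_const | ].
    apply clim_mult; [ apply clim_const | ].
    apply clim_0_Cmod. eapply is_lim_seq_ext;
      [ intros n; symmetry; apply Cmod_pow | ].
    apply is_lim_seq_geom. rewrite Rabs_pos_eq; [ assumption | apply Cmod_ge_0 ].
Qed.

(** Only the supremum of [g] is below 1, not its norm: the norms of the powers [g^n] are controlled
    by [n] times the [n]-th power of a number slightly above the supremum, so the Neumann series
    still converges in the algebra. *)
Lemma wnorm_le_inv_1_minus (g : R -> C) (M rho : R) :
  wnorm_le g M -> rho < 1 -> (forall theta, Cmod (g theta) <= rho) ->
  exists K, wnorm_le (fun theta => / (1 - g theta))%C K.
Proof.
  intros Hg Hrho Hsup.
  assert (Hrho0 : 0 <= rho)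
    by (eapply Rle_trans; [ | apply (Hsup 0) ]; apply Cmod_ge_0).
  (* The polynomial has supremum at most [rho + eps], and the powers grow with ratio
     [rho + 2 eps = (1 + rho) / 2 < 1]. *)
  set (eps := (1 - rho) / 4).
  destruct (wnorm_le_trig_approx g M eps Hg) as [c [N He]];
    [ unfold eps; lra | ].
  set (P := fun theta => box (harm c theta) N).
  assert (HP : forall theta, Cmod (P theta) <= rho + eps).
  { intros theta. pose proof (wnorm_le_sup _ _ theta He) as H1. cbv beta in H1.
    fold (P theta) in H1.
    replace (P theta) with (g theta + - (g theta - P theta))%C by ring.
    eapply Rle_trans; [ apply Cmod_triangle | ].
    rewrite Cmod_opp. specialize (Hsup theta); lra. }
  assert (Hs : 0 <= rho + eps + eps < 1) by (unfold eps; lra).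
  destruct (ex_series_affine_geometric (INR N) _ (pos_INR N) Hs) as [K HK].
  exists K.
  apply (wnorm_le_series (fun n theta => g theta ^ n)%C) with (2 := HK).
  - intros n.
    assert (Htrig : trig_poly N P) by (exists c; reflexivity).
    pose proof (wnorm_le_pow_mixed P g N _ eps Htrig HP He n 0) as H.
    rewrite Nat.add_0_r in H. simpl pow in H. rewrite Rmult_1_l in H.
    apply (wnorm_le_ext _ _ _) with (2 := H). intros theta; simpl; ring.
  - intros theta. apply cseries_geometric. specialize (Hsup theta); lra.
Qed.

Lemma wnorm_le_Cmod_continuous (f : R -> C) (M : R) :
  wnorm_le f M -> forall t, continuity_pt (fun theta => Cmod (f theta)) t.
Proof.
  intros Hf t eps Heps.
  destruct (wnorm_le_uniformly_continuous f M eps Hf Heps) as [delta [Hd H]].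
  exists delta; split; [ assumption | ]. intros y [_ Hy].
  simpl in Hy |- *; unfold R_dist in *. specialize (H y t Hy).
  pose proof (Cmod_triangle (f y - f t) (f t)) as H1.
  pose proof (Cmod_triangle (f t - f y) (f y)) as H2.
  replace (f y - f t + f t)%C with (f y) in H1 by ring.
  replace (f t - f y + f y)%C with (f t) in H2 by ring.
  replace (f t - f y)%C with (- (f y - f t))%C in H2 by ring.
  rewrite Cmod_opp in H2. apply Rabs_def1; lra.
Qed.

Lemma wnorm_le_bounded_below (f : R -> C) (M : R) :
  wnorm_le f M -> (forall theta, f theta <> 0%C) ->
  exists mu, 0 < mu /\ forall theta, mu <= Cmod (f theta).
Proof.
  intros Hf H0. pose proof PI_RGT_0.
  destruct (continuity_ab_min (fun theta => Cmod (f theta)) 0 (2 * PI)) as [x [Hx _]];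
    [ lra | intros; apply (wnorm_le_Cmod_continuous f M Hf) | ].
  exists (Cmod (f x)); split; [ apply Cmod_gt_0, H0 | ].
  intros theta. destruct (wnorm_le_sub_2PI f M theta Hf) as [t [Ht ->]].
  apply Hx, Ht.
Qed.

(* Wiener's lemma.  The Neumann series is applied to [|f|^2], whose values lie
   in a compact subinterval of the positive axis. *)
Theorem wnorm_le_inv (f : R -> C) (M : R) :
  wnorm_le f M -> (forall theta, f theta <> 0%C) ->
  exists K, wnorm_le (fun theta => / f theta)%C K.
Proof.
  intros Hf H0.
  destruct (wnorm_le_bounded_below f M Hf H0) as [mu [Hmu Hlow]].
  pose proof (wnorm_le_pos f M Hf) as HM.
  pose proof (wnorm_le_mult _ _ _ _ Hf (wnorm_le_conj f M Hf)) as Hsq.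
  (* Since [mu^2 <= |f|^2 <= M^2 <= L], the function [1 - |f|^2 / L] takes its values in
     [[0, 1 - mu^2 / L]]. *)
  set (L := M ^ 2 + mu ^ 2).
  assert (HL : 0 < L) by (unfold L; nra).
  pose proof (wnorm_le_minus _ _ _ _ (wnorm_le_const 1%C)
    (wnorm_le_scal (RtoC (/ L)) _ _ Hsq)) as Hg.
  destruct (wnorm_le_inv_1_minus _ _ (1 - mu ^ 2 / L) Hg) as [K HK].
  - assert (0 < mu ^ 2 / L) by (apply Rdiv_lt_0_compat; nra). lra.
  - intros theta; cbv beta. rewrite <- Cmod2_conj, <- RtoC_mult,
      <- RtoC_minus, Cmod_R.
    pose proof (wnorm_le_sup f M theta Hf). specialize (Hlow theta).
    assert (mu ^ 2 <= Cmod (f theta) ^ 2) by (apply pow_incr; lra).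
    assert (Cmod (f theta) ^ 2 <= M ^ 2)
      by (apply pow_incr; split; [ apply Cmod_ge_0 | assumption ]).
    assert (HiL : 0 < / L) by (apply Rinv_0_lt_compat, HL).
    assert (HLL : / L * L = 1) by (apply Rinv_l; lra).
    unfold Rdiv. rewrite Rabs_pos_eq.
    + nra.
    + assert (/ L * Cmod (f theta) ^ 2 <= / L * L)
        by (apply Rmult_le_compat_l; [ lra | unfold L; nra ]). lra.
  - exists (M * (Cmod (RtoC (/ L)) * K)).
    apply (wnorm_le_ext (fun theta => Cconj (f theta) *
      (RtoC (/ L) * / (1 - (1 - RtoC (/ L) * (f theta * Cconj (f theta))))))%C).
    + intros theta. specialize (H0 theta).
      assert (Cconj (f theta) <> 0%C).
      { intros E. apply H0. rewrite <- (Cconj_conj (f theta)), E.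
        apply injective_projections; simpl; ring. }
      assert (HL' : RtoC (/ L) <> 0%C).
      { intros E; apply RtoC_inj in E. apply Rinv_0_lt_compat in HL. lra. }
      replace (1 - (1 - RtoC (/ L) * (f theta * Cconj (f theta))))%C
        with (RtoC (/ L) * (f theta * Cconj (f theta)))%C by ring.
      field. repeat split; assumption.
    + apply wnorm_le_mult; [ apply wnorm_le_conj, Hf | apply wnorm_le_scal, HK ].
Qed.

(** * From symmetric partial sums to bilateral series *)

Lemma sum_n_halves_le (c : Z -> C) (n : nat) :
  sum_n (fun n => cabs c (Z.of_nat n)) n <= rbox (cabs c) n /\
  sum_n (fun n => cabs c (- Z.of_nat (S n))%Z) n <= rbox (cabs c) (S n).
Proof.
  induction n as [|n [IH1 IH2]].
  - rewrite !sum_O. cbn [rbox]. change (Z.of_nat 0) with 0%Z.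
    pose proof (cabs_pos c 0); pose proof (cabs_pos c (Z.of_nat 1)); lra.
  - rewrite !sum_Sn. unfold plus; simpl plus.
    change (rbox (cabs c) (S (S n))) with (rbox (cabs c) (S n) +
      (cabs c (Z.of_nat (S (S n))) + cabs c (- Z.of_nat (S (S n)))%Z)).
    change (rbox (cabs c) (S n)) with (rbox (cabs c) n +
      (cabs c (Z.of_nat (S n)) + cabs c (- Z.of_nat (S n))%Z)) at 1.
    pose proof (cabs_pos c (- Z.of_nat (S n))%Z).
    pose proof (cabs_pos c (Z.of_nat (S (S n)))).
    split; [ apply Rplus_le_compat | apply Rplus_le_compat ]; try lra.
Qed.

Lemma wnorm_le_wiener (f : R -> C) (M : R) : wnorm_le f M -> wiener f.
Proof.
  intros [c [Hc Hf]]. exists c.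
  destruct (ex_series_bounded (fun n => cabs c (Z.of_nat n)) M) as [p [Hp _]].
  { intros; apply cabs_pos. }
  { intros n; eapply Rle_trans; [ apply sum_n_halves_le | apply Hc ]. }
  destruct (ex_series_bounded (fun n => cabs c (- Z.of_nat (S n))%Z) M) as [q [Hq _]].
  { intros; apply cabs_pos. }
  { intros n; eapply Rle_trans; [ apply sum_n_halves_le | apply Hc ]. }
  split; [ exists (plus p q), p, q; auto | ].
  intros theta _.
  destruct (cseries_dominated (fun n => harm c theta (Z.of_nat n))
    (fun n => cabs c (Z.of_nat n)) p)
    with (2 := Hp) as [x [Hx _]].
  { intros n; right; apply cabs_harm. }
  destruct (cseries_dominated (fun n => harm c theta (- Z.of_nat (S n))%Z)
    (fun n => cabs c (- Z.of_nat (S n))%Z) q)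
    with (2 := Hq) as [y [Hy _]].
  { intros n; right; apply cabs_harm. }
  exists x, y. split; [ apply cseries_is_series, Hx | ].
  split; [ apply cseries_is_series, Hy | ].
  apply (clim_unique (fun n => box (harm c theta) (S n))).
  - apply (proj1 (clim_incr_1 _ _)), Hf.
  - apply (clim_ext (fun n => csum (fun n => harm c theta (Z.of_nat n)) (S n) +
                      csum (fun n => harm c theta (- Z.of_nat (S n))%Z) n)%C).
    + induction n as [|n IH]; [ simpl; ring | ].
      change (box (harm c theta) (S (S n))) with (box (harm c theta) (S n) +
        (harm c theta (Z.of_nat (S (S n))) + harm c theta (- Z.of_nat (S (S n)))%Z))%C.
      rewrite <- IH. cbn [csum]. ring.
    + apply clim_plus; [ apply (proj1 (clim_incr_1 _ _)), Hx | exact Hy ].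
Qed.

(** Continuity of [g] on the whole line supplies the limits at the three missing points, and its
    period [2 PI] identifies the two endpoints. *)
Lemma wnorm_le_extends_to_wiener (f g : R -> C) (M : R) :
  wnorm_le g M -> (forall theta, punctured theta -> g theta = f theta) ->
  extends_to_wiener f.
Proof.
  intros Hg H. exists g. split; [ | apply (wnorm_le_wiener g M Hg) ].
  assert (Hlim : forall t,
    filterlim f (within punctured (locally t)) (locally (g t))).
  { intros t. apply (filterlim_within_ext punctured g f H).
    eapply filterlim_filter_le_1;
      [ apply (filter_le_within punctured)
      | apply (wnorm_le_filterlim g M t Hg) ]. }
  repeat split; auto.
  rewrite <- (wnorm_le_periodic g M (- PI) 1) by assumption. f_equal; ring.
Qed.

(** * Jost solutions of Jacobi equations *)

Lemma exp_le_compat (x y : R) : x <= y -> exp x <= exp y.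
Proof.
  intros [H| ->]; [ apply Rlt_le, exp_increasing, H | apply Rle_refl ].
Qed.

(* One-sided version of [l11] that is stable under shifts of the index. *)
Definition moment (p : Z -> R) : Prop :=
  forall n : Z,
    ex_series (fun k : nat => (INR k + 1) * Rabs (p (n + Z.of_nat k)%Z)).

(** * The backward recursion and its scalar majorant *)

Section Propagator.

Variables (kappa B : Z -> C).

(** The state at index [n] is [(h_n, h_n - h_{n+1})]; [step n] returns the state at [n - 1]. *)
Definition step (n : Z) (s : C * C) : C * C :=
  let g := (kappa n * snd s + B n * fst s)%C in ((fst s + g)%C, g).

(* [propag n k] carries the state from index [n + k] down to index [n]. *)
Fixpoint propag (n : Z) (k : nat) (s : C * C) : C * C :=
  match k with
  | O => s
  | S p => propag n p (step (n + Z.of_nat k) s)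
  end.

(** [propag] recurses at its far end, which suits estimates that vary the initial state; comparing
    the indices [n] and [n + 1] requires peeling off the near end. *)
Lemma propag_outer (n : Z) (k : nat) (s : C * C) :
  propag n (S k) s = step (n + 1) (propag (n + 1) k s).
Proof.
  revert s; induction k as [|k IH]; intros s; [ reflexivity | ].
  change (propag n (S (S k)) s)
    with (propag n (S k) (step (n + Z.of_nat (S (S k))) s)).
  rewrite IH. cbn [propag].
  do 3 f_equal; lia.
Qed.

End Propagator.

Section Majorant.

Variables (beta : Z -> R).
Hypothesis beta_pos : forall n, 0 <= beta n.

(** [step] with [kappa] and [B] replaced by the bounds [1 + beta] and [beta] for their norms. *)
Definition rstep (n : Z) (s : R * R) : R * R :=
  let g := (1 + beta n) * snd s + beta n * fst s in (fst s + g, g).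

Fixpoint rpropag (n : Z) (k : nat) (s : R * R) : R * R :=
  match k with
  | O => s
  | S p => rpropag n p (rstep (n + Z.of_nat k) s)
  end.

Lemma rpropag_outer (n : Z) (k : nat) (s : R * R) :
  rpropag n (S k) s = rstep (n + 1) (rpropag (n + 1) k s).
Proof.
  revert s; induction k as [|k IH]; intros s; [ reflexivity | ].
  change (rpropag n (S (S k)) s)
    with (rpropag n (S k) (rstep (n + Z.of_nat (S (S k))) s)).
  rewrite IH. cbn [rpropag].
  do 3 f_equal; lia.
Qed.

Lemma rpropag_pos (n : Z) (k : nat) (s : R * R) :
  0 <= fst s -> 0 <= snd s ->
  0 <= fst (rpropag n k s) /\ 0 <= snd (rpropag n k s).
Proof.
  revert s; induction k as [|k IH]; intros s H1 H2; [ auto | ].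
  cbn [rpropag]. set (j := (n + Z.of_nat (S k))%Z).
  pose proof (beta_pos j).
  assert (0 <= beta j * snd s) by (apply Rmult_le_pos; assumption).
  assert (0 <= beta j * fst s) by (apply Rmult_le_pos; assumption).
  apply IH; unfold rstep; simpl; nra.
Qed.

(** Logarithm of the growth: crossing the site at distance [j] multiplies the weighted size of the
    state, with weight adapted to the remaining distance, by at most [1 + (j + 2) beta]. *)
Definition growth (n : Z) (k : nat) : R :=
  sum_n (fun j => (INR j + 2) * beta (n + Z.of_nat j)) k.

(* The weight [k + 1] on the slope makes the free motion an isometry. *)
Lemma rpropag_bound (n : Z) (k : nat) (s : R * R) :
  0 <= fst s -> 0 <= snd s ->
  fst (rpropag n k s) + snd (rpropag n k s) <=
  exp (growth n k) * (fst s + (INR k + 1) * snd s).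
Proof.
  revert s; induction k as [|k IH]; intros s H1 H2.
  - simpl. assert (1 <= exp (growth n 0)).
    { rewrite <- exp_0 at 1. apply exp_le_compat. unfold growth. rewrite sum_O. simpl.
      pose proof (beta_pos (n + 0)); lra. }
    nra.
  - cbn [rpropag]. set (j := (n + Z.of_nat (S k))%Z).
    pose proof (beta_pos j) as Hb.
    assert (0 <= beta j * snd s) by (apply Rmult_le_pos; assumption).
    assert (0 <= beta j * fst s) by (apply Rmult_le_pos; assumption).
    eapply Rle_trans; [ apply IH; unfold rstep; simpl; nra | ].
    unfold growth at 2. rewrite sum_Sn. fold (growth n k). fold j.
    unfold plus; simpl plus. rewrite exp_plus, Rmult_assoc.
    apply Rmult_le_compat_l; [ apply Rlt_le, exp_pos | ].
    apply Rle_trans with ((1 + (INR (S k) + 2) * beta j) *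
                          (fst s + (INR (S k) + 1) * snd s)).
    + unfold rstep; simpl fst; simpl snd. rewrite S_INR.
      pose proof (pos_INR k). set (x := INR k) in *.
      set (b := beta j) in *. set (h := fst s) in *. set (G := snd s) in *.
      assert (0 <= x * b * h) by (apply Rmult_le_pos; [ apply Rmult_le_pos | ]; lra).
      assert (0 <= b * G) by assumption.
      assert (0 <= x * (b * G)) by (apply Rmult_le_pos; assumption).
      assert (0 <= x * (x * (b * G))) by (apply Rmult_le_pos; assumption).
      nra.
    + apply Rmult_le_compat_r; [ | apply exp_ineq1_le ].
      pose proof (pos_INR (S k)). apply Rplus_le_le_0_compat; [ assumption | ].
      apply Rmult_le_pos; [ lra | assumption ].
Qed.

Hypothesis beta_moment : moment beta.

Lemma ex_series_growth (n : Z) :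
  ex_series (fun j => (INR j + 2) * beta (n + Z.of_nat j)).
Proof.
  apply (ex_series_le (K := R_AbsRing) (V := R_CompleteNormedModule) _
    (fun j => 2 * ((INR j + 1) * Rabs (beta (n + Z.of_nat j)%Z)))).
  - intros j. unfold norm; simpl; unfold abs; simpl.
    pose proof (pos_INR j). pose proof (beta_pos (n + Z.of_nat j)).
    rewrite Rabs_mult, (Rabs_pos_eq (beta _)), Rabs_pos_eq by lra. nra.
  - apply (ex_series_scal_l 2 (fun j => (INR j + 1) *
      Rabs (beta (n + Z.of_nat j)%Z))), beta_moment.
Qed.

(** A Duhamel term. Writing [h] as 1 plus a remainder, the constant 1 at site [n + k + 1] injects
    [beta] into both height and slope at [n + k], and the full recursion carries this down to [n];
    the remainder is the sum over [k]. *)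
Definition source (n : Z) (k : nat) : R * R :=
  let b := beta (n + Z.of_nat k + 1) in rpropag n k (b, b).

Lemma source_pos (n : Z) (k : nat) :
  0 <= fst (source n k) /\ 0 <= snd (source n k).
Proof. apply rpropag_pos; apply beta_pos. Qed.

Lemma source_bound (n : Z) (k : nat) :
  fst (source n k) + snd (source n k) <=
  exp (Series (fun j => (INR j + 2) * beta (n + Z.of_nat j))) *
  ((INR k + 2) * beta (n + Z.of_nat k + 1)).
Proof.
  set (b := beta (n + Z.of_nat k + 1)).
  assert (Hb : 0 <= b) by apply beta_pos.
  pose proof (rpropag_bound n k (b, b) Hb Hb) as H. simpl fst in H; simpl snd in H.
  eapply Rle_trans; [ exact H | ].
  replace (b + (INR k + 1) * b) with ((INR k + 2) * b) by ring.
  apply Rmult_le_compat_r.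
  - pose proof (pos_INR k); apply Rmult_le_pos; lra.
  - apply exp_le_compat, sum_n_le_series.
    + intros j. pose proof (pos_INR j).
      apply Rmult_le_pos; [ lra | apply beta_pos ].
    + apply Series_correct, ex_series_growth.
Qed.

Lemma ex_series_source_bound (n : Z) :
  ex_series (fun k => (INR k + 2) * beta (n + Z.of_nat k + 1)).
Proof.
  pose proof (proj1 (ex_series_incr_1 _) (beta_moment n)) as H.
  eapply ex_series_ext; [ | exact H ].
  intros k; cbv beta. rewrite Rabs_pos_eq by apply beta_pos.
  rewrite S_INR. f_equal; [ ring | f_equal; lia ].
Qed.

Lemma ex_series_source (n : Z) :
  ex_series (fun k => fst (source n k)) /\ ex_series (fun k => snd (source n k)).
Proof.
  split;
    apply (ex_series_le (K := R_AbsRing) (V := R_CompleteNormedModule) _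
      (fun k => exp (Series (fun j => (INR j + 2) * beta (n + Z.of_nat j))) *
        ((INR k + 2) * beta (n + Z.of_nat k + 1))));
    try (apply (ex_series_scal_l
      (exp (Series (fun j => (INR j + 2) * beta (n + Z.of_nat j))))
      (fun k => (INR k + 2) * beta (n + Z.of_nat k + 1))), ex_series_source_bound);
    intros k; unfold norm; simpl; unfold abs; simpl;
    pose proof (source_bound n k); pose proof (source_pos n k);
    rewrite Rabs_pos_eq; lra.
Qed.

Definition hmaj (n : Z) : R := 1 + Series (fun k => fst (source n k)).

(* In the majorant system the slopes are exactly the increments of the heights,
   so they are summable because the heights are monotone. *)
Lemma hmaj_diff (n : Z) :
  hmaj n - hmaj (n + 1) = Series (fun k => snd (source n k)).
Proof.
  destruct (ex_series_source n) as [E1 E2].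
  destruct (ex_series_source (n + 1)) as [E3 _].
  unfold hmaj.
  assert (E : Series (fun k => fst (source n k)) - Series (fun k => snd (source n k))
              = Series (fun k => fst (source (n + 1) k))).
  { rewrite <- Series_minus by assumption.
    rewrite Series_incr_1.
    2: { apply (ex_series_minus (V := R_NormedModule)); assumption. }
    replace (fst (source n 0) - snd (source n 0)) with 0
      by (unfold source; simpl; ring).
    rewrite Rplus_0_l. apply Series_ext. intros k.
    unfold source. rewrite !rpropag_outer.
    replace (n + Z.of_nat (S k) + 1)%Z with (n + 1 + Z.of_nat k + 1)%Z by lia.
    unfold rstep; simpl; ring. }
  lra.
Qed.

(** For [n >= 0] the excess over 1 is at most a constant times a tail of the first moment, because
    the weight [k + 2] relative to [n] is at most the weight [n + k + 2] of the same site relative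
    to 0. *)
Lemma hmaj_lim : is_lim_seq (fun k => hmaj (Z.of_nat k)) 1.
Proof.
  set (K := exp (Series (fun j => (INR j + 2) * beta (0 + Z.of_nat j)))).
  pose proof (beta_moment 0%Z) as HM.
  set (M := fun j : nat => (INR j + 1) * Rabs (beta (0 + Z.of_nat j)%Z)) in *.
  destruct (HM : exists L : R, is_series M L) as [L HL]. clear HM.
  assert (HMpos : forall j, 0 <= M j).
  { intros j; unfold M. pose proof (pos_INR j).
    apply Rmult_le_pos; [ lra | apply Rabs_pos ]. }
  (* The growth exponent from [n] is dominated by the one from 0, where every site carries a larger
     weight; this gives one constant [K] for all [n]. *)
  assert (Hgrow : forall n : nat,
    Series (fun j => (INR j + 2) * beta (Z.of_nat n + Z.of_nat j)) <=
    Series (fun j => (INR j + 2) * beta (0 + Z.of_nat j))).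
  { assert (Hpos : forall j : nat, 0 <= (INR j + 2) * beta (0 + Z.of_nat j)).
    { intros j. pose proof (pos_INR j).
      apply Rmult_le_pos; [ lra | apply beta_pos ]. }
    intros n. pose proof (ex_series_growth 0%Z) as H0.
    destruct n as [|n]; [ right; reflexivity | ].
    rewrite (Series_incr_n (fun j => (INR j + 2) * beta (0 + Z.of_nat j)) (S n))
      by (lia || assumption).
    apply Rle_trans with (Series (fun k => (INR (S n + k) + 2) *
      beta (0 + Z.of_nat (S n + k)))).
    - apply Series_le.
      + intros j. pose proof (pos_INR j). pose proof (pos_INR (S n)).
        rewrite plus_INR. replace (0 + Z.of_nat (S n + j))%Z
          with (Z.of_nat (S n) + Z.of_nat j)%Z by lia.
        pose proof (beta_pos (Z.of_nat (S n) + Z.of_nat j)).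
        split; [ apply Rmult_le_pos; lra | apply Rmult_le_compat_r; lra ].
      + apply (proj1 (ex_series_incr_n (K := R_AbsRing) (V := R_NormedModule)
          (fun j => (INR j + 2) * beta (0 + Z.of_nat j)) (S n))), H0.
    - simpl pred. rewrite <- (Rplus_0_l (Series _)) at 1.
      apply Rplus_le_compat_r.
      clear -Hpos. rewrite <- sum_n_Reals.
      induction n as [|n IH]; [ rewrite sum_O; apply Hpos | ].
      rewrite sum_Sn. apply Rplus_le_le_0_compat; auto. }
  apply is_lim_seq_minus_0.
  apply (is_lim_seq_squeeze_0 _ (fun n => K * (L - sum_n M n))).
  - intros n. unfold hmaj.
    replace (1 + Series (fun k => fst (source (Z.of_nat n) k)) - 1)
      with (Series (fun k => fst (source (Z.of_nat n) k))) by ring.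
    destruct (ex_series_source (Z.of_nat n)) as [E1 _].
    assert (Htail : is_series (fun k => K * M (S n + k)%nat) (K * (L - sum_n M n))).
    { apply (is_series_scal_l K (fun k => M (S n + k)%nat)).
      apply (is_series_incr_n M (S n)); [ lia | ]. simpl pred.
      apply (eq_ind L (is_series M)); 
        [ exact HL | change (L = L - sum_n M n + sum_n M n); ring ]. }
    rewrite <- (is_series_unique _ _ Htail).
    assert (Hle : forall k, 0 <= fst (source (Z.of_nat n) k) <= K * M (S n + k)%nat).
    { intros k. pose proof (source_pos (Z.of_nat n) k).
      split; [ lra | ].
      pose proof (source_bound (Z.of_nat n) k) as Hb.
      match type of Hb with _ <= ?x => apply Rle_trans with x; [ lra | ] end.
      apply Rmult_le_compat.
      - apply Rlt_le, exp_pos.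
      - pose proof (pos_INR k). apply Rmult_le_pos; [ lra | apply beta_pos ].
      - apply exp_le_compat, Hgrow.
      - unfold M. rewrite Rabs_pos_eq by apply beta_pos.
        replace (0 + Z.of_nat (S n + k))%Z with (Z.of_nat n + Z.of_nat k + 1)%Z by lia.
        apply Rmult_le_compat_r; [ apply beta_pos | ].
        rewrite plus_INR, S_INR. pose proof (pos_INR n); lra. }
    rewrite Rabs_pos_eq.
    + apply Series_le; [ exact Hle | exists (K * (L - sum_n M n)); exact Htail ].
    + apply Rle_trans with (sum_n (fun k => fst (source (Z.of_nat n) k)) 0).
      * rewrite sum_O; apply Hle.
      * apply sum_n_le_series; [ apply Hle | apply Series_correct, E1 ].
  - replace 0 with (K * (L - L)) by ring.
    apply is_lim_seq_mult'; [ apply is_lim_seq_const | ].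
    apply is_lim_seq_minus'; [ apply is_lim_seq_const | exact HL ].
Qed.

End Majorant.

(** * Solving the recursion over the Wiener algebra *)

Lemma wnorm_le_propag (kappa B : Z -> R -> C) (beta : Z -> R) :
  (forall n, wnorm_le (kappa n) (1 + beta n)) ->
  (forall n, wnorm_le (B n) (beta n)) ->
  forall n k (s : R -> C * C) (S : R * R),
    wnorm_le (fun t => fst (s t)) (fst S) ->
    wnorm_le (fun t => snd (s t)) (snd S) ->
    let p t := propag (fun j => kappa j t) (fun j => B j t) n k (s t) in
    wnorm_le (fun t => fst (p t)) (fst (rpropag beta n k S)) /\
    wnorm_le (fun t => snd (p t)) (snd (rpropag beta n k S)).
Proof.
  intros Hk HB n k; induction k as [|k IH]; intros s S H1 H2; [ split; assumption | ].
  cbn [propag rpropag].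
  set (j := (n + Z.of_nat (Datatypes.S k))%Z).
  pose proof (wnorm_le_plus _ _ _ _ (wnorm_le_mult _ _ _ _ (Hk j) H2)
    (wnorm_le_mult _ _ _ _ (HB j) H1)) as H3.
  apply (IH (fun t => step (fun j => kappa j t) (fun j => B j t) j (s t))
            (rstep beta j S)).
  - apply wnorm_le_plus; [ exact H1 | exact H3 ].
  - exact H3.
Qed.

(** [h] is 1 plus the Duhamel series and [g] the series of its slopes, both dominated termwise by
    [source]. Taking [H] to be [hmaj], the bound for [g] becomes a difference of consecutive values
    of [H]. *)
Lemma backward_system_solution (kappa B : Z -> R -> C) (beta : Z -> R) :
  (forall n, wnorm_le (kappa n) (1 + beta n)) ->
  (forall n, wnorm_le (B n) (beta n)) ->
  moment beta ->
  exists (h g : Z -> R -> C) (H : Z -> R),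
    (forall n t, g n t = (kappa (n + 1)%Z t * g (n + 1)%Z t +
                          B (n + 1)%Z t * h (n + 1)%Z t)%C) /\
    (forall n t, h n t = (h (n + 1)%Z t + g n t)%C) /\
    (forall n, wnorm_le (h n) (H n)) /\
    (forall n, wnorm_le (fun t => h n t - 1)%C (H n - 1)) /\
    (forall n, wnorm_le (g n) (H n - H (n + 1)%Z)) /\
    is_lim_seq (fun k => H (Z.of_nat k)) 1.
Proof.
  intros Hkappa HB Hmom.
  assert (Hpos : forall n, 0 <= beta n)
    by (intros n; apply (wnorm_le_pos (B n)), HB).
  set (src := fun n k t => propag (fun j => kappa j t) (fun j => B j t) n k
    (B (n + Z.of_nat k + 1)%Z t, B (n + Z.of_nat k + 1)%Z t)).
  assert (Hsrc : forall n k,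
    wnorm_le (fun t => fst (src n k t)) (fst (source beta n k)) /\
    wnorm_le (fun t => snd (src n k t)) (snd (source beta n k))).
  { intros n k. apply (wnorm_le_propag kappa B beta Hkappa HB n k
      (fun t => (B (n + Z.of_nat k + 1)%Z t, B (n + Z.of_nat k + 1)%Z t))); apply HB. }
  assert (Hser1 : forall n, is_series (fun k => fst (source beta n k)) (hmaj beta n - 1)).
  { intros n. unfold hmaj.
    replace (1 + Series (fun k => fst (source beta n k)) - 1)
      with (Series (fun k => fst (source beta n k))) by ring.
    apply Series_correct, ex_series_source; assumption. }
  assert (Hser2 : forall n, is_series (fun k => snd (source beta n k))
                                      (hmaj beta n - hmaj beta (n + 1))).
  { intros n. rewrite hmaj_diff by assumption.
    apply Series_correct, ex_series_source; assumption. }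
  (* Pairing the index with the parameter lets a single [choice] select all the sums. *)
  assert (Hex : forall nt : Z * R, exists hg : C * C,
    cseries (fun k => fst (src (fst nt) k (snd nt))) (fst hg) /\
    cseries (fun k => snd (src (fst nt) k (snd nt))) (snd hg)).
  { intros [n t]; simpl.
    destruct (cseries_dominated (fun k => fst (src n k t))
      (fun k => fst (source beta n k)) (hmaj beta n - 1)) with (2 := Hser1 n)
      as [x [Hx _]]; [ intros k; apply (wnorm_le_sup _ _ t (proj1 (Hsrc n k))) | ].
    destruct (cseries_dominated (fun k => snd (src n k t))
      (fun k => snd (source beta n k)) (hmaj beta n - hmaj beta (n + 1)))
      with (2 := Hser2 n)
      as [y [Hy _]]; [ intros k; apply (wnorm_le_sup _ _ t (proj2 (Hsrc n k))) | ].
    exists (x, y); split; assumption. }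
  apply choice in Hex. destruct Hex as [hg Hhg].
  assert (Hshift : forall n k t, src n (S k) t =
    step (fun j => kappa j t) (fun j => B j t) (n + 1) (src (n + 1)%Z k t)).
  { intros n k t. unfold src. rewrite propag_outer.
    replace (n + Z.of_nat (S k) + 1)%Z with (n + 1 + Z.of_nat k + 1)%Z by lia.
    reflexivity. }
  (* By linearity, the series at [n] is its first term, the injected [B_{n+1}], plus [step (n + 1)]
     applied to the series at [n + 1]. *)
  assert (Hg : forall n t, snd (hg (n, t)) =
    (kappa (n + 1)%Z t * snd (hg ((n + 1)%Z, t)) +
     B (n + 1)%Z t * (1 + fst (hg ((n + 1)%Z, t))))%C).
  { intros n t. destruct (Hhg (n, t)) as [_ H2].
    destruct (Hhg ((n + 1)%Z, t)) as [H3 H4]. simpl in *.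
    apply (cseries_unique _ _ _ H2).
    replace (kappa (n + 1)%Z t * snd (hg ((n + 1)%Z, t)) +
     B (n + 1)%Z t * (1 + fst (hg ((n + 1)%Z, t))))%C
    with (snd (src n 0%nat t) + (kappa (n + 1)%Z t * snd (hg ((n + 1)%Z, t)) +
     B (n + 1)%Z t * fst (hg ((n + 1)%Z, t))))%C.
    - apply cseries_shift.
      apply (cseries_ext (fun k => kappa (n + 1)%Z t * snd (src (n + 1)%Z k t) +
        B (n + 1)%Z t * fst (src (n + 1)%Z k t))%C).
      + intros k; rewrite Hshift; reflexivity.
      + apply cseries_plus; apply cseries_scal; assumption.
    - unfold src; simpl. replace (n + 0 + 1)%Z with (n + 1)%Z by lia. ring. }
  exists (fun n t => 1 + fst (hg (n, t)))%C, (fun n t => snd (hg (n, t))), (hmaj beta).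
  repeat split.
  - exact Hg.
  - intros n t. destruct (Hhg (n, t)) as [H1 H2].
    destruct (Hhg ((n + 1)%Z, t)) as [H3 _]. simpl in *.
    assert (E : fst (hg (n, t)) =
      (0 + fst (hg ((n + 1)%Z, t)) + snd (hg (n, t)))%C); [ | rewrite E; ring ].
    apply (cseries_unique _ _ _ H1).
    (* Height minus slope at [n] is the height at [n + 1], with the index [k] shifted by one and a
       zero term in front. *)
    set (d := fun k => (fst (src n k t) - snd (src n k t))%C).
    apply (cseries_ext (fun k => d k + snd (src n k t))%C);
      [ intros k; unfold d; ring | ].
    apply cseries_plus; [ | assumption ].
    replace (RtoC 0) with (d O) by (unfold d, src; simpl; ring).
    apply cseries_shift. apply (cseries_ext (fun k => fst (src (n + 1)%Z k t)));
      [ | assumption ].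
    intros k. unfold d. rewrite Hshift. unfold step; simpl. ring.
  - intros n. apply (wnorm_le_weaken _ (1 + (hmaj beta n - 1))); [ | lra ].
    rewrite <- Cmod_1 at 1. apply wnorm_le_plus; [ apply wnorm_le_const | ].
    apply (wnorm_le_series (fun k t => fst (src n k t))) with (2 := Hser1 n).
    + intros k; apply Hsrc.
    + intros t; apply (Hhg (n, t)).
  - intros n. apply (wnorm_le_ext (fun t => fst (hg (n, t)))); [ intros; ring | ].
    apply (wnorm_le_series (fun k t => fst (src n k t))) with (2 := Hser1 n).
    + intros k; apply Hsrc.
    + intros t; apply (Hhg (n, t)).
  - intros n.
    apply (wnorm_le_series (fun k t => snd (src n k t))) with (2 := Hser2 n).
    + intros k; apply Hsrc.
    + intros t; apply (Hhg (n, t)).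
  - apply hmaj_lim; assumption.
Qed.

(** * Sequences with finite first moment *)

Lemma moment_le (p q : Z -> R) :
  (forall n, Rabs (p n) <= Rabs (q n)) -> moment q -> moment p.
Proof.
  intros H Hq n.
  apply (ex_series_le (K := R_AbsRing) (V := R_CompleteNormedModule) _ _)
    with (2 := Hq n).
  intros k. unfold norm; simpl; unfold abs; simpl.
  pose proof (pos_INR k).
  rewrite Rabs_mult, Rabs_Rabsolu, Rabs_pos_eq by lra.
  apply Rmult_le_compat_l; [ lra | apply H ].
Qed.

Lemma moment_plus (p q : Z -> R) :
  moment p -> moment q -> moment (fun n => Rabs (p n) + Rabs (q n)).
Proof.
  intros Hp Hq n.
  pose proof (ex_series_plus (V := R_NormedModule) _ _ (Hp n) (Hq n)) as H.
  eapply ex_series_ext; [ | exact H ].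
  intros k. unfold plus; simpl.
  set (x := p (n + Z.of_nat k)%Z); set (y := q (n + Z.of_nat k)%Z).
  rewrite (Rabs_pos_eq (Rabs x + Rabs y)); [ ring | ].
  pose proof (Rabs_pos x); pose proof (Rabs_pos y); lra.
Qed.

Lemma moment_mult_bounded (r p : Z -> R) :
  (forall n, exists K, forall k : nat, Rabs (r (n + Z.of_nat k)%Z) <= K) ->
  moment p -> moment (fun n => r n * p n).
Proof.
  intros Hr Hp n. destruct (Hr n) as [K HK].
  apply (ex_series_le (K := R_AbsRing) (V := R_CompleteNormedModule) _
    (fun k => K * ((INR k + 1) * Rabs (p (n + Z.of_nat k)%Z)))).
  - intros k. unfold norm; simpl; unfold abs; simpl.
    pose proof (pos_INR k). specialize (HK k).
    rewrite Rabs_mult, Rabs_Rabsolu, Rabs_mult, (Rabs_pos_eq (INR k + 1)) by lra.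
    rewrite <- !Rmult_assoc, (Rmult_comm K).
    apply Rmult_le_compat_r; [ apply Rabs_pos | ].
    apply Rmult_le_compat_l; [ lra | assumption ].
  - apply (ex_series_scal_l K (fun k => (INR k + 1) * Rabs (p (n + Z.of_nat k)%Z))),
      Hp.
Qed.

Lemma moment_shift (p : Z -> R) : moment p -> moment (fun n => p (n + 1)%Z).
Proof.
  intros Hp n. specialize (Hp (n + 1)%Z). eapply ex_series_ext; [ | exact Hp ].
  intros k; cbv beta. do 3 f_equal; lia.
Qed.

Lemma moment_lim_0 (p : Z -> R) (n : Z) :
  moment p -> is_lim_seq (fun k => p (n + Z.of_nat k)%Z) 0.
Proof.
  intros Hp. pose proof (ex_series_lim_0 _ (Hp n)) as H.
  apply (is_lim_seq_squeeze_0 _ _) with (2 := H).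
  intros k. pose proof (pos_INR k). pose proof (Rabs_pos (p (n + Z.of_nat k)%Z)).
  nra.
Qed.

Lemma is_lim_seq_shift_Z (u : Z -> R) (l : R) (n : Z) :
  is_lim_seq (fun k => u (Z.of_nat k)) l ->
  is_lim_seq (fun k => u (n + Z.of_nat k)%Z) l.
Proof.
  intros H. destruct (Z_le_gt_dec 0 n) as [Hn|Hn].
  - apply (is_lim_seq_incr_n _ (Z.to_nat n)) in H.
    eapply is_lim_seq_ext; [ | exact H ].
    intros k; cbv beta; f_equal; lia.
  - apply (is_lim_seq_incr_n _ (Z.to_nat (- n))).
    eapply is_lim_seq_ext; [ | exact H ].
    intros k; cbv beta; f_equal; lia.
Qed.

(** * Jacobi equation, brackets and Jost waves *)

(** The diagonal [d] is kept independent of [a]. For the Dirac operator [d n = a n ^ 2 - 1], but on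
    the reflected line this relation reads [d n = a (n + 1) ^ 2 - 1], and both half-lines must be
    instances. *)
Definition jacobi (a d : Z -> R) (t : R) (u : Z -> C) : Prop :=
  forall n : Z,
    (RtoC (a (n + 1)%Z) * u (n + 1)%Z + RtoC (a n) * u (n - 1)%Z =
     RtoC (2 * cos t + d n) * u n)%C.

Definition bracket (a : Z -> R) (n : Z) (u v : Z -> C) : C :=
  (RtoC (a (n + 1)%Z) * (u n * v (n + 1)%Z - u (n + 1)%Z * v n))%C.

Definition wave (h : Z -> R -> C) (t : R) (n : Z) : C :=
  (expi (IZR n * t) * h n t)%C.

(* [wave h] is the family of Jost solutions at [+oo]; [H] dominates it. *)
Definition jost_profile (a d : Z -> R) (h : Z -> R -> C) (H : Z -> R) : Prop :=
  (forall t, jacobi a d t (wave h t)) /\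
  (forall n, wnorm_le (h n) (H n)) /\
  (forall n, wnorm_le (fun t => h n t - 1)%C (H n - 1)) /\
  (forall n, wnorm_le (fun t => h n t - h (n + 1)%Z t)%C (H n - H (n + 1)%Z)) /\
  is_lim_seq (fun k => H (Z.of_nat k)) 1.

Lemma expi_succ (n : Z) (t : R) :
  expi (IZR (n + 1) * t) = (expi t * expi (IZR n * t))%C.
Proof. rewrite <- expi_plus, plus_IZR. f_equal; ring. Qed.

Lemma expi_pred (n : Z) (t : R) :
  expi (IZR (n - 1) * t) = (expi (- t) * expi (IZR n * t))%C.
Proof. rewrite <- expi_plus, minus_IZR. f_equal; ring. Qed.

Lemma expi_plus_opp (t : R) : (expi t + expi (- t))%C = RtoC (2 * cos t).
Proof.
  unfold expi; rewrite cos_neg, sin_neg.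
  apply injective_projections; simpl; ring.
Qed.

Lemma expi_minus_opp (t : R) : (expi t - expi (- t))%C = (2 * Ci * RtoC (sin t))%C.
Proof.
  unfold expi; rewrite cos_neg, sin_neg.
  apply injective_projections; simpl; ring.
Qed.

Lemma inverse_bounded (a : Z -> R) :
  moment (fun n => 1 - a n) -> (forall n, a n <> 0) ->
  forall n, exists K, forall k : nat, Rabs (/ a (n + Z.of_nat k)%Z) <= K.
Proof.
  intros Ha Ha0 n.
  assert (H : is_lim_seq (fun k => a (n + Z.of_nat k)%Z) 1).
  { pose proof (moment_lim_0 _ n Ha) as H. cbv beta in H.
    apply (is_lim_seq_ext (fun k => 1 - (1 - a (n + Z.of_nat k)%Z))); [ intros; ring | ].
    pose proof (is_lim_seq_minus' _ _ 1 0 (is_lim_seq_const 1) H) as H1.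
    rewrite Rminus_0_r in H1; exact H1. }
  apply is_lim_seq_inv in H; [ | intros E; injection E; lra ].
  destruct (filterlim_bounded (fun k : nat => / a (n + Z.of_nat k)%Z)) as [K HK].
  - exists (/ 1). exact H.
  - exists K. exact HK.
Qed.

(** With [x = e^{it}], multiplying the equation for [h] by [x / a_n] gives [h_{n-1} - h_n = kappa_n
    (h_n - h_{n+1}) + B_n h_n]. In the free case [kappa = x^2] and [B = 0]. The same three
    perturbations that make up [B] also bound the deviation of [a_{n+1} / a_n] from 1, so one [beta]
    serves both. *)
Theorem jost_profile_exists (a d : Z -> R) :
  (forall n, a n <> 0) -> moment (fun n => 1 - a n) -> moment d ->
  exists h H, jost_profile a d h H.
Proof.
  intros Ha0 Ha Hd.
  set (r := fun n => / a n).
  set (kappa := fun n t => (RtoC (a (n + 1)%Z * r n) * (expi t * expi t))%C).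
  set (B := fun n t => (RtoC (r n * (1 - a n)) + (RtoC (r n * d n) * expi t +
    RtoC (r n * (1 - a (n + 1)%Z)) * (expi t * expi t)))%C).
  (* The nested absolute values match the conclusion of [moment_plus] applied twice. *)
  set (beta := fun n => Rabs (r n * (1 - a n)) + Rabs (Rabs (r n * d n) +
    Rabs (r n * (1 - a (n + 1)%Z)))).
  assert (Hx : wnorm_le expi 1).
  { apply (wnorm_le_ext (fun t => expi t * 1)%C); [ intros; ring | ].
    apply (wnorm_le_weaken _ (Cmod 1)); [ | rewrite Cmod_1; lra ].
    apply wnorm_le_expi, wnorm_le_const. }
  assert (Hx2 : wnorm_le (fun t => expi t * expi t)%C 1) by (apply wnorm_le_expi, Hx).
  destruct (backward_system_solution kappa B beta) as
    [h [g [H [Hg [Hh [H1 [H2 [H3 H4]]]]]]]].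
  - intros n. pose proof (wnorm_le_scal (RtoC (a (n + 1)%Z * r n)) _ _ Hx2) as HK.
    apply (wnorm_le_weaken _ _ _ HK). rewrite Cmod_R, Rmult_1_r. unfold beta.
    replace (a (n + 1)%Z * r n) with
      (1 + (r n * (1 - a n) + - (r n * (1 - a (n + 1)%Z))))
      by (unfold r; field; apply Ha0).
    eapply Rle_trans; [ apply Rabs_triang | ].
    rewrite (Rabs_pos_eq 1) by lra. apply Rplus_le_compat_l.
    eapply Rle_trans; [ apply Rabs_triang | ]. apply Rplus_le_compat_l.
    rewrite Rabs_Ropp. set (x := Rabs (r n * d n)); set (y := Rabs (r n * (1 - _))).
    assert (0 <= x) by apply Rabs_pos. assert (0 <= y) by apply Rabs_pos.
    rewrite Rabs_pos_eq; lra.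
  - intros n. unfold beta, B.
    rewrite <- (Cmod_R (r n * (1 - a n))).
    rewrite (Rabs_pos_eq (_ + _))
      by (apply Rplus_le_le_0_compat; apply Rabs_pos).
    rewrite <- (Cmod_R (r n * d n)), <- (Cmod_R (r n * (1 - a (n + 1)%Z))).
    apply wnorm_le_plus; [ apply wnorm_le_const | ].
    rewrite <- (Rmult_1_r (Cmod (RtoC (r n * d n)))),
      <- (Rmult_1_r (Cmod (RtoC (r n * (1 - a (n + 1)%Z))))).
    apply wnorm_le_plus; apply wnorm_le_scal; assumption.
  - pose proof (inverse_bounded a Ha Ha0) as Hr.
    apply moment_plus; [ | apply moment_plus ].
    + apply (moment_mult_bounded r); assumption.
    + apply (moment_mult_bounded r); assumption.
    + apply (moment_mult_bounded r); [ exact Hr | ].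
      apply (moment_shift (fun n => 1 - a n) Ha).
  - exists h, H. repeat split; auto.
    + intros t n. unfold wave. rewrite expi_succ, expi_pred.
      rewrite RtoC_plus, <- expi_plus_opp.
      rewrite (Hh (n - 1)%Z), (Hg (n - 1)%Z).
      replace (n - 1 + 1)%Z with n by lia.
      assert (Eg : g n t = (h n t - h (n + 1)%Z t)%C) by (rewrite (Hh n t); ring).
      rewrite Eg. unfold kappa, B, r.
      rewrite !RtoC_mult, !RtoC_minus.
      set (x := expi t). set (y := expi (- t)).
      assert (Exy : (x * y)%C = 1%C) by apply expi_mult_opp.
      assert (Ea : (RtoC (a n) * RtoC (/ a n))%C = 1%C)
        by (rewrite <- RtoC_mult, Rinv_r by apply Ha0; reflexivity).
      set (A := RtoC (a n)) in *. set (A' := RtoC (/ a n)) in *.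
      set (A1 := RtoC (a (n + 1)%Z)). set (e := expi (IZR n * t)).
      set (hn := h n t). set (h1 := h (n + 1)%Z t).
      (* [ring] does not know [A A' = 1] and [x y = 1]; each intermediate form isolates the product
         to be rewritten. The same device recurs wherever [expi t] meets [expi (- t)]. *)
      transitivity (e * (A1 * x * h1 + y * (A * hn + (A * A') *
        (A1 * (x * x) * (hn - h1) + (1 - A + (RtoC (d n) * x + (1 - A1) * (x * x))) * hn))))%C;
        [ ring | ].
      rewrite Ea.
      transitivity (e * (A1 * x * h1 + (x * y) * (A1 * x * (hn - h1)
        + (RtoC (d n) + (1 - A1) * x) * hn) + y * hn))%C; [ ring | ].
      rewrite Exy. ring.
    + intros n. apply (wnorm_le_ext (g n)); [ | apply H3 ].
      intros t; rewrite (Hh n t); ring.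
Qed.

Section Profile.

Variables (a d : Z -> R) (h : Z -> R -> C) (H : Z -> R).
Hypothesis profile : jost_profile a d h H.
Hypothesis a_moment : moment (fun n => 1 - a n).

Lemma wave_jacobi (t : R) : jacobi a d t (wave h t).
Proof. apply profile. Qed.

Lemma profile_decr (n : Z) (k : nat) : H (n + Z.of_nat k)%Z <= H n.
Proof.
  pose proof profile as [_ [_ [_ [H3 _]]]].
  induction k as [|k IH]; [ rewrite Z.add_0_r; lra | ].
  pose proof (wnorm_le_pos _ _ (H3 (n + Z.of_nat k)%Z)) as Hp.
  replace (n + Z.of_nat (S k))%Z with (n + Z.of_nat k + 1)%Z by lia. lra.
Qed.

Lemma profile_lim (n : Z) (t : R) : clim (fun k => h (n + Z.of_nat k)%Z t) 1.
Proof.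
  pose proof profile as [_ [_ [H2 [_ H4]]]].
  apply (clim_squeeze _ _ (fun k => H (n + Z.of_nat k)%Z - 1)).
  - intros k; apply (wnorm_le_sup _ _ t (H2 _)).
  - apply (proj1 (is_lim_seq_minus_0 _ 1)), is_lim_seq_shift_Z, H4.
Qed.

Lemma coefficient_lim (n : Z) : clim (fun k => RtoC (a (n + Z.of_nat k)%Z)) 1.
Proof.
  apply clim_RtoC. pose proof (moment_lim_0 _ n a_moment) as Hl. cbv beta in Hl.
  apply (is_lim_seq_ext (fun k => 1 - (1 - a (n + Z.of_nat k)%Z))); [ intros; ring | ].
  pose proof (is_lim_seq_minus' _ _ 1 0 (is_lim_seq_const 1) Hl) as H1.
  rewrite Rminus_0_r in H1; exact H1.
Qed.

(** The discrete Lagrange identity: [d] cancels and only the difference of the spectral parameters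
    remains. For [s = t] the bracket is constant. *)
Lemma bracket_diff (t s : R) (u v : Z -> C) (n : Z) :
  jacobi a d t u -> jacobi a d s v ->
  (bracket a n u v - bracket a (n - 1) u v)%C =
  (RtoC (2 * cos s - 2 * cos t) * (u n * v n))%C.
Proof.
  intros Hu Hv. specialize (Hu n); specialize (Hv n). unfold bracket.
  replace (n - 1 + 1)%Z with n by lia.
  transitivity (u n * (RtoC (a (n + 1)%Z) * v (n + 1)%Z + RtoC (a n) * v (n - 1)%Z)
    - (RtoC (a (n + 1)%Z) * u (n + 1)%Z + RtoC (a n) * u (n - 1)%Z) * v n)%C;
    [ ring | ].
  rewrite Hu, Hv, RtoC_minus, !RtoC_plus. ring.
Qed.

Lemma bracket_const (t : R) (u v : Z -> C) (n : Z) (k : nat) :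
  jacobi a d t u -> jacobi a d t v ->
  bracket a (n + Z.of_nat k) u v = bracket a n u v.
Proof.
  intros Hu Hv; induction k as [|k IH]; [ rewrite Z.add_0_r; reflexivity | ].
  pose proof (bracket_diff t t u v (n + Z.of_nat (S k)) Hu Hv) as E.
  replace (n + Z.of_nat (S k) - 1)%Z with (n + Z.of_nat k)%Z in E by lia.
  rewrite IH in E.
  replace (2 * cos t - 2 * cos t) with 0 in E by ring.
  replace (bracket a (n + Z.of_nat (S k)) u v)
    with (bracket a (n + Z.of_nat (S k)) u v - bracket a n u v + bracket a n u v)%C
    by ring.
  rewrite E; ring.
Qed.

Lemma jacobi_conj (t : R) (u : Z -> C) :
  jacobi a d t u -> jacobi a d t (fun n => Cconj (u n)).
Proof.
  intros Hu n. specialize (Hu n). apply (f_equal Cconj) in Hu.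
  assert (HR : forall x, Cconj (RtoC x) = RtoC x)
    by (intros; apply injective_projections; simpl; ring).
  rewrite Cplus_conj, !Cmult_conj, !HR in Hu. exact Hu.
Qed.

(** The coefficients are real, so the conjugate wave solves the same equation and the bracket can be
    evaluated at [+oo], where [a] and [h] tend to 1. *)
Lemma bracket_wave_conj (t : R) (n : Z) :
  bracket a n (wave h t) (fun n => Cconj (wave h t n)) = (expi (- t) - expi t)%C.
Proof.
  apply (clim_unique (fun k =>
    bracket a (n + Z.of_nat k) (wave h t) (fun n => Cconj (wave h t n)))).
  - eapply clim_ext; [ | apply clim_const ].
    intros k; symmetry; apply (bracket_const t); [ | apply jacobi_conj ];
      apply wave_jacobi.
  - apply (clim_ext (fun k => RtoC (a (n + 1 + Z.of_nat k)%Z) *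
      (expi (- t) * (h (n + Z.of_nat k)%Z t * Cconj (h (n + 1 + Z.of_nat k)%Z t))
       - expi t * (h (n + 1 + Z.of_nat k)%Z t * Cconj (h (n + Z.of_nat k)%Z t))))%C).
    + intros k. unfold bracket, wave.
      replace (n + Z.of_nat k + 1)%Z with (n + 1 + Z.of_nat k)%Z by lia.
      rewrite !Cmult_conj, !Cconj_expi.
      replace (n + 1 + Z.of_nat k)%Z with (n + Z.of_nat k + 1)%Z by lia.
      set (j := (n + Z.of_nat k)%Z).
      replace (- (IZR (j + 1) * t)) with (- t + - (IZR j * t))
        by (rewrite plus_IZR; ring).
      rewrite expi_succ, expi_plus.
      pose proof (expi_mult_opp (IZR j * t)) as E.
      set (e := expi (IZR j * t)) in *. set (e' := expi (- (IZR j * t))) in *.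
      transitivity (RtoC (a (j + 1)%Z) * ((e * e') *
        (expi (- t) * (h j t * Cconj (h (j + 1)%Z t))
         - expi t * (h (j + 1)%Z t * Cconj (h j t)))))%C; [ rewrite E; ring | ring ].
    + replace (expi (- t) - expi t)%C with
        (1 * (expi (- t) * (1 * Cconj 1) - expi t * (1 * Cconj 1)))%C.
      2: { replace (Cconj 1) with (RtoC 1)
             by (apply injective_projections; simpl; ring). ring. }
      apply clim_mult; [ apply coefficient_lim | ].
      apply clim_minus; apply clim_mult; try apply clim_const;
        apply clim_mult; try apply clim_conj; apply profile_lim.
Qed.

Lemma Cmod_wave_le (t : R) (n : Z) : Cmod (wave h t n) <= H n.
Proof.
  pose proof profile as [_ [H1 _]]. unfold wave.
  rewrite Cmod_mult, Cmod_expi, Rmult_1_l. apply wnorm_le_sup, H1.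
Qed.

Lemma bracket_vanishing (t : R) (u v : Z -> C) (K : R) (n : Z) :
  jacobi a d t u -> jacobi a d t v ->
  clim (fun k => u (n + Z.of_nat k)%Z) 0 ->
  (forall k : nat, Cmod (v (n + Z.of_nat k)%Z) <= K) ->
  bracket a n u v = 0%C.
Proof.
  intros Hu Hv Hlim HK.
  assert (Hprod : forall b c : nat -> C, clim b 0 -> (forall k, Cmod (c k) <= K) ->
    clim (fun k => b k * c k)%C 0).
  { intros b c Hb Hc.
    apply (clim_squeeze _ _ (fun k => Cmod (b k - 0) * K)).
    - intros k. replace (b k * c k - 0)%C with ((b k - 0) * c k)%C by ring.
      rewrite Cmod_mult. apply Rmult_le_compat_l; [ apply Cmod_ge_0 | apply Hc ].
    - apply clim_Cmod_minus in Hb.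
      pose proof (is_lim_seq_mult' _ _ 0 K Hb (is_lim_seq_const K)) as Hm.
      rewrite Rmult_0_l in Hm; exact Hm. }
  apply (clim_unique (fun k => bracket a (n + Z.of_nat k) u v)).
  - eapply clim_ext; [ | apply clim_const ].
    intros k; symmetry; apply (bracket_const t); assumption.
  - replace (RtoC 0) with (1 * (0 - 0))%C by ring.
    assert (Hlim1 : clim (fun k => u (n + Z.of_nat (S k))%Z) 0)
      by apply (proj1 (clim_incr_1 _ _) Hlim).
    apply (clim_ext (fun k => RtoC (a (n + 1 + Z.of_nat k)%Z) *
      (u (n + Z.of_nat k)%Z * v (n + Z.of_nat (S k))%Z -
       u (n + Z.of_nat (S k))%Z * v (n + Z.of_nat k)%Z))%C).
    + intros k. unfold bracket.
      replace (n + 1 + Z.of_nat k)%Z with (n + Z.of_nat k + 1)%Z by lia.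
      replace (n + Z.of_nat (S k))%Z with (n + Z.of_nat k + 1)%Z by lia.
      reflexivity.
    + apply clim_mult; [ apply coefficient_lim | ].
      apply clim_minus; apply Hprod; auto.
Qed.

Lemma expi_opp_minus_neq_0 (t : R) : sin t <> 0 -> (expi (- t) - expi t)%C <> 0%C.
Proof.
  intros Hs E. apply (f_equal Im) in E. unfold Im, expi in E; simpl in E.
  rewrite sin_neg in E. lra.
Qed.

(** The difference of two candidates tends to 0, so its brackets with the wave and with the
    conjugate wave vanish. Off the zeros of [sin] these two solutions are independent, which forces
    the difference to be 0. This is what identifies a Jost solution chosen by [epsilon]. *)
Lemma jost_unique (t : R) (w : Z -> C) :
  sin t <> 0 -> jacobi a d t w ->
  clim (fun k => w (Z.of_nat k) * expi (- (t * IZR (Z.of_nat k))))%C 1 ->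
  forall n, w n = wave h t n.
Proof.
  intros Hs Hw Hlim n.
  set (delta := fun n => (w n - wave h t n)%C).
  assert (Hd : jacobi a d t delta).
  { intros j. specialize (Hw j). pose proof (wave_jacobi t j) as Hj.
    unfold delta.
    transitivity (RtoC (a (j + 1)%Z) * w (j + 1)%Z + RtoC (a j) * w (j - 1)%Z -
      (RtoC (a (j + 1)%Z) * wave h t (j + 1)%Z + RtoC (a j) * wave h t (j - 1)%Z))%C;
      [ ring | ]. rewrite Hw, Hj. ring. }
  assert (Hd0 : is_lim_seq (fun k => Cmod (delta (Z.of_nat k))) 0).
  { pose proof (clim_minus _ _ _ _ Hlim (profile_lim 0 t)) as Hm.
    replace (1 - 1)%C with (RtoC 0) in Hm by ring.
    apply clim_Cmod in Hm. rewrite Cmod_0 in Hm.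
    eapply is_lim_seq_ext; [ | exact Hm ]. intros k; cbv beta.
    rewrite Z.add_0_l.
    rewrite <- (Rmult_1_r (Cmod (delta _))),
      <- (Cmod_expi (- (t * IZR (Z.of_nat k)))), <- Cmod_mult.
    unfold delta, wave. rewrite (Rmult_comm t).
    pose proof (expi_mult_opp (IZR (Z.of_nat k) * t)) as E.
    f_equal. set (e := expi (IZR (Z.of_nat k) * t)) in *.
    set (e' := expi (- (IZR (Z.of_nat k) * t))) in *.
    transitivity (w (Z.of_nat k) * e' - (e * e') * h (Z.of_nat k) t)%C;
      [ rewrite E; ring | ring ]. }
  assert (Hdn : clim (fun k => delta (n + Z.of_nat k)%Z) 0).
  { apply clim_0_Cmod, (is_lim_seq_shift_Z (fun j => Cmod (delta j))), Hd0. }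
  assert (Hb : forall k : nat, Cmod (wave h t (n + Z.of_nat k)%Z) <= H n)
    by (intros k; eapply Rle_trans; [ apply Cmod_wave_le | apply profile_decr ]).
  pose proof (bracket_vanishing t delta _ (H n) n Hd (wave_jacobi t) Hdn Hb) as E1.
  pose proof (bracket_vanishing t delta _ (H n) n Hd
    (jacobi_conj t _ (wave_jacobi t)) Hdn
    (fun k => eq_ind_r (fun x => x <= _) (Hb k) (Cmod_conj _))) as E2.
  pose proof (bracket_wave_conj t n) as E3.
  assert (E : (delta n * bracket a n (wave h t) (fun n => Cconj (wave h t n)))%C = 0%C).
  { transitivity (wave h t n * bracket a n delta (fun n => Cconj (wave h t n))
      - Cconj (wave h t n) * bracket a n delta (wave h t))%C;
      [ unfold bracket; ring | rewrite E1, E2; ring ]. }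
  rewrite E3 in E. pose proof (expi_opp_minus_neq_0 t Hs) as Hne.
  assert (Ed : delta n = 0%C).
  { rewrite <- (Cmult_1_r (delta n)), <- (Cinv_r _ Hne), Cmult_assoc, E. ring. }
  unfold delta in Ed. rewrite <- (Cplus_0_r (wave h t n)), <- Ed. ring.
Qed.

(** * Division of brackets at an edge *)

Lemma is_series_telescope (f : nat -> R) (l : R) :
  is_lim_seq f l -> is_series (fun k => f k - f (S k)) (f O - l).
Proof.
  intros Hf. apply is_series_is_lim_seq.
  apply (is_lim_seq_ext (fun n => f O - f (S n))).
  - induction n as [|n IH]; [ rewrite sum_O; reflexivity | ].
    rewrite sum_Sn, <- IH. unfold plus; simpl; ring.
  - apply is_lim_seq_minus'; [ apply is_lim_seq_const | ].
    apply (proj1 (is_lim_seq_incr_1 f l)), Hf.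
Qed.

(* Green's formula writes the bracket of the solutions at [t] and [t0] as
   [2 cos t0 - 2 cos t] times a divergent sum of [y^j p_j], [y = e^{i(t+t0)}];
   since [e^{it0} = 1 or -1], one factor [e^{it} - e^{it0}] turns this into
   [(y^j - y^{j-1}) p_j], and summation by parts moves the difference to the
   summable increments of [p]. *)
Lemma resonance_quotient (t0 : R) (n : Z) :
  sin t0 = 0 ->
  exists (Phi : R -> C) (K : R), wnorm_le Phi K /\
    forall t, bracket a n (wave h t) (wave h t0) =
              ((expi t - expi t0) * Phi t)%C.
Proof.
  intros Ht0. pose proof profile as [_ [H1 [_ [H3 H4]]]].
  assert (Es : expi (- t0) = expi t0).
  { unfold expi. rewrite cos_neg, sin_neg, Ht0, Ropp_0. reflexivity. }
  assert (Es2 : (expi t0 * expi t0)%C = 1%C)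
    by (rewrite <- Es at 2; apply expi_mult_opp).
  set (sigma := expi t0) in *.
  set (Y := fun j t => (expi (IZR j * t) * expi (IZR j * t0))%C).
  set (p := fun j t => (h j t * h j t0)%C).
  assert (HYsucc : forall j t, Y (j + 1)%Z t = (expi t * sigma * Y j t)%C).
  { intros j t. unfold Y. rewrite !expi_succ. unfold sigma; ring. }
  assert (HYmod : forall j t, Cmod (Y j t) = 1)
    by (intros; unfold Y; rewrite Cmod_mult, !Cmod_expi; ring).
  assert (HYw : forall j f K, wnorm_le f K -> wnorm_le (fun t => Y j t * f t)%C K).
  { intros j f K Hf.
    apply (wnorm_le_expi_Z j), (wnorm_le_scal (expi (IZR j * t0))) in Hf.
    rewrite Cmod_expi, Rmult_1_l in Hf. apply (wnorm_le_ext _ _ _) with (2 := Hf).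
    intros t; unfold Y; ring. }
  assert (Hbr : forall j t, bracket a j (wave h t) (wave h t0) =
    (Y j t * (RtoC (a (j + 1)%Z) * (sigma * (h j t * h (j + 1)%Z t0)
                             - expi t * (h (j + 1)%Z t * h j t0))))%C).
  { intros j t. unfold bracket, wave, Y. rewrite !expi_succ. unfold sigma; ring. }
  (* The second summand is the boundary term of the summation by parts: with it, the increments of
     [E] involve only increments of [p]. *)
  set (E := fun t j => (bracket a j (wave h t) (wave h t0) +
                        (expi t - sigma) * (Y j t * p (j + 1)%Z t))%C).
  assert (HE : forall t j, (E t j - E t (j + 1)%Z)%C =
    ((expi t - sigma) * (Y (j + 1)%Z t * (p (j + 1)%Z t - p (j + 1 + 1)%Z t)))%C).
  { intros t j. unfold E.
    pose proof (bracket_diff t t0 _ _ (j + 1) (wave_jacobi t) (wave_jacobi t0)) as Hbd.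
    replace (j + 1 - 1)%Z with j in Hbd by lia.
    rewrite RtoC_minus, <- !expi_plus_opp, Es in Hbd. fold sigma in Hbd.
    assert (Ep : (wave h t (j + 1)%Z * wave h t0 (j + 1)%Z)%C =
                 (Y (j + 1)%Z t * p (j + 1)%Z t)%C) by (unfold wave, Y, p; ring).
    rewrite Ep in Hbd.
    assert (EY : Y j t = (expi (- t) * sigma * Y (j + 1)%Z t)%C).
    { rewrite HYsucc. pose proof (expi_mult_opp t) as Ex.
      transitivity ((expi t * expi (- t)) * (sigma * sigma) * Y j t)%C;
        [ rewrite Ex, Es2; ring | ring ]. }
    rewrite EY. pose proof (expi_mult_opp t) as Ex.
    set (x := expi t) in *. set (x' := expi (- t)) in *.
    set (y := Y (j + 1)%Z t) in *. set (p1 := p (j + 1)%Z t) in *.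
    set (p2 := p (j + 1 + 1)%Z t).
    transitivity (- (bracket a (j + 1) (wave h t) (wave h t0)
       - bracket a j (wave h t) (wave h t0))
      + (x - sigma) * (x' * sigma * y * p1 - y * p2))%C; [ ring | ].
    rewrite Hbd.
    transitivity (y * p1 * (x + x' - 2 * sigma + (x * x') * sigma
      - x' * (sigma * sigma)) - (x - sigma) * y * p2)%C; [ ring | ].
    rewrite Ex, Es2. ring. }
  (* Divided by [Y], which has modulus 1 but in general no limit, the bracket tends to
     [sigma - expi t]; the boundary term cancels exactly this. *)
  assert (HE0 : forall t, clim (fun k => E t (n + Z.of_nat k)%Z) 0).
  { intros t.
    assert (Hp : forall j, clim (fun k => h (j + Z.of_nat k)%Z t) 1
                        /\ clim (fun k => h (j + Z.of_nat k)%Z t0) 1)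
      by (intros; split; apply profile_lim).
    assert (Hbracket : clim (fun k =>
      RtoC (a (n + 1 + Z.of_nat k)%Z) *
        (sigma * (h (n + Z.of_nat k)%Z t * h (n + 1 + Z.of_nat k)%Z t0)
         - expi t * (h (n + 1 + Z.of_nat k)%Z t * h (n + Z.of_nat k)%Z t0)) +
      (expi t - sigma) * (h (n + 1 + Z.of_nat k)%Z t * h (n + 1 + Z.of_nat k)%Z t0))%C
      (1 * (sigma * (1 * 1) - expi t * (1 * 1)) + (expi t - sigma) * (1 * 1))%C).
    { apply clim_plus.
      - apply clim_mult; [ apply coefficient_lim | ].
        apply clim_minus; apply clim_mult; try apply clim_const;
          apply clim_mult; apply profile_lim.
      - apply clim_mult; [ apply clim_const | ].
        apply clim_mult; apply profile_lim. }
    replace (1 * (sigma * (1 * 1) - expi t * (1 * 1)) + (expi t - sigma) * (1 * 1))%C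
      with (RtoC 0) in Hbracket by ring.
    apply clim_0_Cmod. apply clim_Cmod in Hbracket. rewrite Cmod_0 in Hbracket.
    eapply is_lim_seq_ext; [ | exact Hbracket ]. intros k; cbv beta.
    unfold E. rewrite Hbr.
    replace (n + Z.of_nat k + 1)%Z with (n + 1 + Z.of_nat k)%Z by lia.
    rewrite <- Rmult_1_l at 1. rewrite <- (HYmod (n + Z.of_nat k)%Z t), <- Cmod_mult.
    f_equal. unfold p. ring. }
  set (term := fun k t => (Y (n + 1 + Z.of_nat k)%Z t *
    (p (n + 1 + Z.of_nat k)%Z t - p (n + 1 + Z.of_nat k + 1)%Z t))%C).
  (* An increment of the product [p] splits into two terms, each an increment of one factor times a
     value of the other that is at most [H (n + 1)]; hence the 2. *)
  set (maj := fun k => 2 * H (n + 1)%Z *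
    (H (n + 1 + Z.of_nat k)%Z - H (n + 1 + Z.of_nat (S k))%Z)).
  assert (Hterm : forall k, wnorm_le (term k) (maj k)).
  { intros k. apply HYw. set (j := (n + 1 + Z.of_nat k)%Z).
    assert (Hj : H j <= H (n + 1)%Z) by apply profile_decr.
    assert (Hj1 : H (j + 1)%Z <= H j) by apply (profile_decr j 1).
    pose proof (wnorm_le_scal (h j t0) _ _ (H3 j)) as Ha.
    pose proof (wnorm_le_scal (h j t0 - h (j + 1)%Z t0)%C _ _ (H1 (j + 1)%Z)) as Hb.
    pose proof (wnorm_le_plus _ _ _ _ Ha Hb) as Hab.
    apply (wnorm_le_ext _ (fun t => p j t - p (j + 1)%Z t)%C) in Hab;
      [ | intros t; unfold p; ring ].
    apply (wnorm_le_weaken _ _ _ Hab). unfold maj. fold j.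
    replace (n + 1 + Z.of_nat (S k))%Z with (j + 1)%Z by (unfold j; lia).
    pose proof (wnorm_le_sup _ _ t0 (H1 j)) as Hs1.
    pose proof (wnorm_le_sup _ _ t0 (H3 j)) as Hs2. cbv beta in Hs2.
    pose proof (wnorm_le_pos _ _ (H1 (j + 1)%Z)).
    set (x := Cmod (h j t0)) in *. set (y := Cmod (h j t0 - h (j + 1)%Z t0)) in *.
    assert (x * (H j - H (j + 1)%Z) <= H (n + 1)%Z * (H j - H (j + 1)%Z))
      by (apply Rmult_le_compat_r; lra).
    assert (y * H (j + 1)%Z <= (H j - H (j + 1)%Z) * H (n + 1)%Z)
      by (apply Rmult_le_compat; [ apply Cmod_ge_0 | lra | lra | lra ]).
    lra. }
  assert (Hmaj : is_series maj (2 * H (n + 1)%Z * (H (n + 1)%Z - 1))).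
  { apply (is_series_scal_l (2 * H (n + 1)%Z) (fun k =>
      H (n + 1 + Z.of_nat k)%Z - H (n + 1 + Z.of_nat (S k))%Z)).
    pose proof (is_series_telescope (fun k => H (n + 1 + Z.of_nat k)%Z) 1
      (is_lim_seq_shift_Z H 1 (n + 1) H4)) as Ht.
    cbv beta in Ht. rewrite Z.add_0_r in Ht. exact Ht. }
  assert (Hsum : forall t, exists s, cseries (fun k => term k t) s).
  { intros t. destruct (cseries_dominated (fun k => term k t) maj
      (2 * H (n + 1)%Z * (H (n + 1)%Z - 1))) as [s [Hs _]];
      [ | exact Hmaj | exists s; exact Hs ].
    intros k; apply wnorm_le_sup, Hterm. }
  apply choice in Hsum. destruct Hsum as [Sum HSum].
  pose proof (wnorm_le_series term maj Sum _ Hterm Hmaj HSum) as HSw.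
  pose proof (wnorm_le_minus _ _ _ _ HSw
    (HYw n _ _ (wnorm_le_scal (h (n + 1)%Z t0) _ _ (H1 (n + 1)%Z)))) as HPhi.
  eexists; eexists; split; [ exact HPhi | ].
  intros t; cbv beta.
  assert (EE : E t n = ((expi t - sigma) * Sum t)%C).
  { replace (E t n) with (E t (n + Z.of_nat 0)%Z - 0)%C
      by (rewrite Z.add_0_r; ring).
    apply (cseries_unique (fun k => (expi t - sigma) * term k t)%C);
      [ | apply cseries_scal, HSum ].
    pose proof (cseries_telescope _ _ (HE0 t)) as Ht.
    eapply cseries_ext; [ | exact Ht ].
    intros k; cbv beta. unfold term.
    replace (n + Z.of_nat (S k))%Z with (n + Z.of_nat k + 1)%Z by lia.
    rewrite HE.
    replace (n + 1 + Z.of_nat k)%Z with (n + Z.of_nat k + 1)%Z by lia. reflexivity. }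
  replace (bracket a n (wave h t) (wave h t0)) with
    (E t n - (expi t - sigma) * (Y n t * p (n + 1)%Z t))%C by (unfold E; ring).
  rewrite EE. unfold p. ring.
Qed.

End Profile.

(** * Quotients by the Wronskian *)

Definition in_wiener (f : R -> C) : Prop := exists K, wnorm_le f K.

Lemma in_wiener_ext (f g : R -> C) :
  (forall t, f t = g t) -> in_wiener f -> in_wiener g.
Proof. intros H [K HK]; exists K; apply (wnorm_le_ext f g K H HK). Qed.

Lemma in_wiener_const (z : C) : in_wiener (fun _ => z).
Proof. eexists; apply wnorm_le_const. Qed.

Lemma in_wiener_plus (f g : R -> C) :
  in_wiener f -> in_wiener g -> in_wiener (fun t => f t + g t)%C.
Proof. intros [K HK] [L HL]; eexists; apply wnorm_le_plus; eassumption. Qed.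

Lemma in_wiener_minus (f g : R -> C) :
  in_wiener f -> in_wiener g -> in_wiener (fun t => f t - g t)%C.
Proof. intros [K HK] [L HL]; eexists; apply wnorm_le_minus; eassumption. Qed.

Lemma in_wiener_mult (f g : R -> C) :
  in_wiener f -> in_wiener g -> in_wiener (fun t => f t * g t)%C.
Proof. intros [K HK] [L HL]; eexists; apply wnorm_le_mult; eassumption. Qed.

Lemma in_wiener_opp_arg (f : R -> C) :
  in_wiener f -> in_wiener (fun t => f (- t)).
Proof. intros [K HK]; exists K; apply wnorm_le_opp_arg, HK. Qed.

Lemma in_wiener_expi_Z (k : Z) : in_wiener (fun t => expi (IZR k * t)).
Proof.
  eexists. eapply wnorm_le_ext;
    [ | apply (wnorm_le_expi_Z k), (wnorm_le_const 1%C) ].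
  intros t; cbv beta; ring.
Qed.

Lemma in_wiener_expi : in_wiener expi.
Proof.
  apply (in_wiener_ext (fun t => expi (IZR 1 * t)));
    [ intros; f_equal; ring | apply in_wiener_expi_Z ].
Qed.

Lemma in_wiener_expi_opp : in_wiener (fun t => expi (- t)).
Proof. apply in_wiener_opp_arg, in_wiener_expi. Qed.

Lemma in_wiener_inv (f : R -> C) :
  in_wiener f -> (forall t, f t <> 0%C) -> in_wiener (fun t => / f t)%C.
Proof. intros [K HK]; apply (wnorm_le_inv f K HK). Qed.

(** Reduces all zeros of [sin] to the two representatives [0] and [PI]. *)
Lemma in_wiener_eq_expi (f : R -> C) (t s : R) :
  in_wiener f -> expi t = expi s -> f t = f s.
Proof.
  intros [K [c [_ Hf]]] E. eapply clim_unique; [ apply Hf | ].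
  eapply clim_ext; [ | apply Hf ]. intros n; apply box_ext; intros k.
  unfold harm. f_equal.
  assert (Hn : forall n, expi (INR n * s) = expi (INR n * t)).
  { clear n; induction n as [|n IH]; [ simpl; f_equal; ring | ].
    rewrite S_INR, !Rmult_plus_distr_r, !expi_plus, IH, !Rmult_1_l, E.
    reflexivity. }
  destruct (Z_le_gt_dec 0 k) as [Hk|Hk].
  - rewrite <- (Z2Nat.id k), <- INR_IZR_INZ by assumption. apply Hn.
  - assert (E1 : forall x, IZR k * x = - (INR (Z.to_nat (- k)) * x))
      by (intros; rewrite INR_IZR_INZ, Z2Nat.id, opp_IZR by lia; ring).
    rewrite !E1, <- !Cconj_expi, Hn. reflexivity.
Qed.

Lemma expi_PI : expi PI = (- (1))%C.
Proof. unfold expi; rewrite cos_PI, sin_PI; apply injective_projections; simpl; ring. Qed.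

Lemma expi_sin_0 (t : R) : sin t = 0 -> expi t = expi 0 \/ expi t = expi PI.
Proof.
  intros Hs. pose proof (sin2_cos2 t) as H. rewrite Hs in H. unfold Rsqr in H.
  assert (Hc : (cos t - 1) * (cos t + 1) = 0) by lra.
  apply Rmult_integral in Hc.
  destruct Hc as [Hc|Hc]; [ left | right ]; unfold expi;
    rewrite Hs, ?cos_0, ?sin_0, ?cos_PI, ?sin_PI; f_equal; lra.
Qed.

(** Both sides are continuous and the zeros of [sin] are isolated: if [t] is one, [t + e] with
    [0 < e < 1] is not. *)
Lemma Cmod_le_by_density (f g : R -> C) :
  in_wiener f -> in_wiener g ->
  (forall t, sin t <> 0 -> Cmod (g t) <= Cmod (f t)) ->
  forall t, Cmod (g t) <= Cmod (f t).
Proof.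
  intros [K HK] [L HL] H t.
  destruct (Rle_lt_dec (Cmod (g t)) (Cmod (f t))) as [|Hlt]; [ assumption | exfalso ].
  destruct (Req_dec (sin t) 0) as [Hs|Hs]; [ | specialize (H t Hs); lra ].
  set (eps := (Cmod (g t) - Cmod (f t)) / 2).
  assert (He : 0 < eps) by (unfold eps; lra).
  destruct (wnorm_le_uniformly_continuous f K eps HK He) as [d1 [Hd1 H1]].
  destruct (wnorm_le_uniformly_continuous g L eps HL He) as [d2 [Hd2 H2]].
  set (e := Rmin (Rmin d1 d2) 1 / 2).
  pose proof (Rmin_l (Rmin d1 d2) 1). pose proof (Rmin_r (Rmin d1 d2) 1).
  pose proof (Rmin_l d1 d2). pose proof (Rmin_r d1 d2).
  assert (0 < Rmin (Rmin d1 d2) 1) by (repeat apply Rmin_pos; lra).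
  assert (He1 : 0 < e < 1 /\ e < d1 /\ e < d2) by (unfold e; lra).
  assert (Hs' : sin (t + e) <> 0).
  { rewrite sin_plus, Hs. pose proof PI2_1.
    assert (0 < sin e) by (apply sin_gt_0; lra).
    pose proof (sin2_cos2 t) as Hc. rewrite Hs in Hc. unfold Rsqr in Hc.
    intros E. nra. }
  specialize (H _ Hs').
  assert (Habs : Rabs (t - (t + e)) = e)
    by (replace (t - (t + e)) with (- e) by ring; rewrite Rabs_Ropp;
        apply Rabs_pos_eq; lra).
  specialize (H1 t (t + e)). specialize (H2 t (t + e)). rewrite Habs in *.
  pose proof (Cmod_triangle (- (f t - f (t + e))) (f t)) as Hf3.
  pose proof (Cmod_triangle (g t - g (t + e)) (g (t + e))) as Hg4.
  rewrite Cmod_opp in Hf3.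
  replace (- (f t - f (t + e)%R) + f t)%C with (f (t + e)%R) in Hf3 by ring.
  replace (g t - g (t + e)%R + g (t + e)%R)%C with (g t) in Hg4 by ring.
  assert (Cmod (f t - f (t + e)%R) < eps) by (apply H1; lra).
  assert (Cmod (g t - g (t + e)%R) < eps) by (apply H2; lra).
  unfold eps in *. lra.
Qed.

Definition factors_at (t0 : R) (F : R -> C) : Prop :=
  exists Phi, in_wiener Phi /\ forall t, F t = ((expi t - expi t0) * Phi t)%C.

Lemma neq_0_everywhere (D : R -> C) :
  in_wiener D -> (forall t, sin t <> 0 -> D t <> 0%C) ->
  D 0 <> 0%C -> D PI <> 0%C -> forall t, D t <> 0%C.
Proof.
  intros HD Hs H0 HP t. destruct (Req_dec (sin t) 0) as [E|E]; [ | auto ].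
  destruct (expi_sin_0 t E) as [Et|Et]; rewrite (in_wiener_eq_expi D _ _ HD Et); auto.
Qed.

Lemma Cmod_sin_factor (t : R) :
  Cmod (expi t - expi (- t)) = Cmod (expi t - 1) * Cmod (expi t + 1).
Proof.
  rewrite <- Cmod_mult.
  replace ((expi t - 1) * (expi t + 1))%C with (expi t * (expi t - expi (- t)))%C.
  - rewrite Cmod_mult, Cmod_expi; ring.
  - pose proof (expi_mult_opp t) as E.
    transitivity (expi t * expi t - expi t * expi (- t))%C; [ ring | rewrite E; ring ].
Qed.

(** Once the common factor [p] is cancelled, the denominator [Dp] has no zeros at all: off the edges
    because [D] has none there, at the edges by hypothesis. Wiener's lemma then inverts it. *)
Lemma in_wiener_quotient (D F p Dp Fp : R -> C) :
  (forall t, sin t <> 0 -> D t <> 0%C) ->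
  in_wiener Dp -> in_wiener Fp ->
  (forall t, D t = (p t * Dp t)%C) -> (forall t, F t = (p t * Fp t)%C) ->
  Dp 0 <> 0%C -> Dp PI <> 0%C ->
  exists G, in_wiener G /\ forall t, sin t <> 0 -> G t = (F t / D t)%C.
Proof.
  intros Hs HD HF ED EF H0 HP.
  assert (Hprod : forall t, sin t <> 0 -> p t <> 0%C /\ Dp t <> 0%C).
  { intros t Ht. specialize (Hs t Ht). rewrite ED in Hs.
    split; intros E; apply Hs; rewrite E; ring. }
  assert (Hne : forall t, Dp t <> 0%C)
    by (apply neq_0_everywhere; try assumption; intros; apply Hprod; assumption).
  exists (fun t => Fp t * / Dp t)%C; split.
  - apply in_wiener_mult; [ assumption | apply in_wiener_inv; assumption ].
  - intros t Ht. destruct (Hprod t Ht). rewrite ED, EF. field. auto.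
Qed.

Theorem in_wiener_quotient_factors (D F : R -> C) :
  in_wiener D -> in_wiener F ->
  (forall t, Cmod (expi t - expi (- t)) <= Cmod (D t)) ->
  (D 0 = 0%C -> factors_at 0 D /\ factors_at 0 F) ->
  (D PI = 0%C -> factors_at PI D /\ factors_at PI F) ->
  exists G, in_wiener G /\ forall t, sin t <> 0 -> G t = (F t / D t)%C.
Proof.
  intros HD HF Hlow Hf0 HfP.
  assert (Hsin : forall t, sin t <> 0 -> (expi t - expi (- t))%C <> 0%C).
  { intros t Ht E. apply (expi_opp_minus_neq_0 t Ht).
    replace (expi (- t) - expi t)%C with (- (expi t - expi (- t)))%C by ring.
    rewrite E; ring. }
  assert (Hs : forall t, sin t <> 0 -> D t <> 0%C).
  { intros t Ht E. specialize (Hlow t). rewrite E, Cmod_0 in Hlow.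
    pose proof (proj1 (Cmod_gt_0 _) (Hsin t Ht)). lra. }
  assert (Hplus : in_wiener (fun t => expi t + 1)%C)
    by (apply in_wiener_plus; [ apply in_wiener_expi | apply in_wiener_const ]).
  assert (Hminus : in_wiener (fun t => expi t - 1)%C)
    by (apply in_wiener_minus; [ apply in_wiener_expi | apply in_wiener_const ]).
  (* [D = p Dp] with [p p' = e^{2it} - 1]: the lower bound on [D] carries over
     to [p' <= Dp] off the zeros of [sin], hence everywhere. *)
  assert (Hcancel : forall p p' Dp : R -> C,
    in_wiener p' -> in_wiener Dp -> (forall t, D t = (p t * Dp t)%C) ->
    (forall t, Cmod (expi t - expi (- t)) = Cmod (p t) * Cmod (p' t)) ->
    forall t, Cmod (p' t) <= Cmod (Dp t)).
  { intros p p' Dp Hp' HDp ED Ep. apply Cmod_le_by_density; [ assumption.. | ].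
    intros t Ht. pose proof (Hlow t) as Hl.
    pose proof (proj1 (Cmod_gt_0 _) (Hsin t Ht)) as Hpos.
    rewrite Ep in Hl, Hpos. rewrite ED, Cmod_mult in Hl.
    pose proof (Cmod_ge_0 (p t)).
    apply Rmult_le_reg_l with (Cmod (p t)); [ | assumption ].
    destruct (Req_dec (Cmod (p t)) 0) as [E|E]; [ rewrite E in Hpos | ]; lra. }
  assert (Hnz : forall z p' : C, Cmod p' <= Cmod z -> p' <> 0%C -> z <> 0%C).
  { intros z p' Hle Hp' E. apply Cmod_gt_0 in Hp'. rewrite E, Cmod_0 in Hle. lra. }
  assert (H2 : RtoC 2 <> 0%C) by (intros E; apply RtoC_inj in E; lra).
  assert (H11 : (1 + 1)%C = RtoC 2) by (apply injective_projections; simpl; ring).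
  destruct (excluded_middle_informative (D 0 = 0%C)) as [E0|E0];
  destruct (excluded_middle_informative (D PI = 0%C)) as [EP|EP].
  - destruct (Hf0 E0) as [[D1 [HD1 ED1]] [F1 [HF1 EF1]]].
    destruct (HfP EP) as [[D2 [HD2 ED2]] [F2 [HF2 EF2]]].
    rewrite expi_0 in ED1, EF1. rewrite expi_PI in ED2, EF2.
    (* 1/(x-1) - 1/(x+1) = 2/((x-1)(x+1)) *)
    assert (Hcomb : forall F0 G1 G2 : R -> C,
      (forall t, F0 t = ((expi t - 1) * G1 t)%C) ->
      (forall t, F0 t = ((expi t - - (1)) * G2 t)%C) ->
      forall t, F0 t = ((expi t - 1) * (expi t + 1) * ((G1 t - G2 t) * / 2))%C).
    { intros F0 G1 G2 E1 E2 t.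
      transitivity (((expi t + 1) * ((expi t - 1) * G1 t)
        - (expi t - 1) * ((expi t - - (1)) * G2 t)) * / 2)%C; [ | ring ].
      rewrite <- E1, <- E2. field. }
    assert (HDp : in_wiener (fun t => (D1 t - D2 t) * / 2)%C)
      by (apply in_wiener_mult;
          [ apply in_wiener_minus | apply in_wiener_const ]; assumption).
    assert (HFp : in_wiener (fun t => (F1 t - F2 t) * / 2)%C)
      by (apply in_wiener_mult;
          [ apply in_wiener_minus | apply in_wiener_const ]; assumption).
    assert (Hge : forall t, Cmod 1 <= Cmod ((D1 t - D2 t) * / 2)).
    { apply (Hcancel (fun t => (expi t - 1) * (expi t + 1))%C (fun _ => 1%C));
        [ apply in_wiener_const | exact HDp | apply Hcomb; assumption | ].
      intros t. rewrite Cmod_sin_factor, Cmod_mult, Cmod_1; ring. }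
    assert (H1 : RtoC 1 <> 0%C) by (intros E; apply RtoC_inj in E; lra).
    apply (in_wiener_quotient D F (fun t => (expi t - 1) * (expi t + 1))%C
      _ _ Hs HDp HFp).
    + apply Hcomb; assumption.
    + apply Hcomb; assumption.
    + apply (Hnz _ 1%C); auto.
    + apply (Hnz _ 1%C); auto.
  (* One resonant edge: there the reduced denominator is bounded below by the other factor of
     [x^2 - 1], which has modulus 2; at the other edge [D] itself is nonzero. The next case is
     symmetric. *)
  - destruct (Hf0 E0) as [[D1 [HD1 ED1]] [F1 [HF1 EF1]]].
    rewrite expi_0 in ED1, EF1.
    apply (in_wiener_quotient D F (fun t => expi t - 1)%C
      _ _ Hs HD1 HF1 ED1 EF1).
    + apply (Hnz _ (expi 0 + 1)%C); [ | rewrite expi_0, H11; exact H2 ].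
      apply (Hcancel (fun t => expi t - 1)%C (fun t => expi t + 1)%C); auto.
      intros t; apply Cmod_sin_factor.
    + intros E; apply EP. rewrite ED1, E. ring.
  - destruct (HfP EP) as [[D2 [HD2 ED2]] [F2 [HF2 EF2]]].
    rewrite expi_PI in ED2, EF2.
    apply (in_wiener_quotient D F (fun t => expi t - - (1))%C
      _ _ Hs HD2 HF2 ED2 EF2).
    + intros E; apply E0. rewrite ED2, E. ring.
    + apply (Hnz _ (expi PI - 1)%C).
      * apply (Hcancel (fun t => expi t - - (1))%C (fun t => expi t - 1)%C); auto.
        intros t. rewrite Cmod_sin_factor, Rmult_comm. do 2 f_equal. ring.
      * rewrite expi_PI. intros E; apply H2.
        replace (RtoC 2) with (- (- (1) - 1))%C by (rewrite <- H11; ring).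
        rewrite E; ring.
  - apply (in_wiener_quotient D F (fun _ => 1%C) D F Hs HD HF);
      auto; intros; ring.
Qed.

(** * Families parallel to a fixed vector at an edge *)

Section Factorization.

Variables (a : Z -> R) (t0 : R).
Hypothesis a1_neq_0 : a 1%Z <> 0.
Hypothesis t0_edge : sin t0 = 0.

(** The divided form of the statement that [f t0] is parallel to [phi] at the sites 0 and 1. Like
    parallelism, it passes to multiples of [phi] and makes brackets of two such families
    divisible. *)
Definition factors_with (phi : Z -> C) (f : R -> Z -> C) : Prop :=
  (forall k, in_wiener (fun t => f t k)) /\
  factors_at t0 (fun t => bracket a 0 (f t) phi).

(** With [s = e^{i t0}] and [s^2 = 1], [e^{-it} - s = - s e^{-it} (e^{it} - s)]: reflecting [t]
    keeps the edge and its factor, up to a unit. *)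
Lemma factors_with_opp_arg (phi : Z -> C) (f : R -> Z -> C) :
  factors_with phi f -> factors_with phi (fun t => f (- t)).
Proof.
  intros [Hf [Phi [HPhi E]]]. split.
  - intros k; apply (in_wiener_opp_arg (fun t => f t k)), Hf.
  - exists (fun t => - (expi t0) * (expi (- t) * Phi (- t)%R))%C. split.
    + apply in_wiener_mult; [ apply in_wiener_const | ].
      apply in_wiener_mult; [ apply in_wiener_expi_opp | ].
      apply in_wiener_opp_arg, HPhi.
    + intros t. rewrite E.
      assert (Es : expi (- t0) = expi t0).
      { unfold expi. rewrite cos_neg, sin_neg, t0_edge, Ropp_0. reflexivity. }
      pose proof (expi_mult_opp t0) as E0. rewrite Es in E0.
      pose proof (expi_mult_opp t) as Et.
      transitivity ((- expi t0 * (expi t * expi (- t)) +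
        (expi t0 * expi t0) * expi (- t)) * Phi (- t)%R)%C;
        [ rewrite Et, E0; ring | ring ].
Qed.

(** A vanishing bracket with a nonzero [psi] makes [phi] a multiple of [psi] at the sites 0 and 1,
    the only ones that the bracket at 0 sees. *)
Lemma factors_with_proportional (phi psi : Z -> C) (f : R -> Z -> C) :
  (psi 0%Z <> 0%C \/ psi 1%Z <> 0%C) -> bracket a 0 phi psi = 0%C ->
  factors_with psi f -> factors_with phi f.
Proof.
  intros Hpsi Hbr [Hf [Phi [HPhi E]]]. split; [ assumption | ].
  assert (Hdet : (phi 0%Z * psi 1%Z)%C = (phi 1%Z * psi 0%Z)%C).
  { unfold bracket in Hbr. change (0 + 1)%Z with 1%Z in Hbr.
    assert (Ha : RtoC (a 1%Z) <> 0%C)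
      by (intros Ea; apply a1_neq_0; apply RtoC_inj, Ea).
    transitivity (/ RtoC (a 1%Z) * (RtoC (a 1%Z) *
      (phi 0%Z * psi 1%Z - phi 1%Z * psi 0%Z)) + phi 1%Z * psi 0%Z)%C;
      [ field; exact Ha | rewrite Hbr; ring ]. }
  assert (Hc : exists c, phi 0%Z = (c * psi 0%Z)%C /\ phi 1%Z = (c * psi 1%Z)%C).
  { destruct Hpsi as [H|H].
    - exists (phi 0%Z / psi 0%Z)%C. split; [ field; exact H | ].
      transitivity ((phi 1%Z * psi 0%Z) / psi 0%Z)%C; [ field; exact H | ].
      rewrite <- Hdet. field; exact H.
    - exists (phi 1%Z / psi 1%Z)%C. split; [ | field; exact H ].
      transitivity ((phi 0%Z * psi 1%Z) / psi 1%Z)%C; [ field; exact H | ].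
      rewrite Hdet. field; exact H. }
  destruct Hc as [c [E0 E1]].
  exists (fun t => c * Phi t)%C. split.
  - apply in_wiener_mult; [ apply in_wiener_const | assumption ].
  - intros t. transitivity (c * bracket a 0 (f t) psi)%C.
    + unfold bracket. change (0 + 1)%Z with 1%Z. rewrite E0, E1. ring.
    + rewrite E. ring.
Qed.

(* Any three vectors of the plane satisfy
   [f,g] phi_k = [f,phi] g_k - [g,phi] f_k. *)
Lemma factors_with_bracket (phi : Z -> C) (f g : R -> Z -> C) :
  (phi 0%Z <> 0%C \/ phi 1%Z <> 0%C) ->
  factors_with phi f -> factors_with phi g ->
  factors_at t0 (fun t => bracket a 0 (f t) (g t)).
Proof.
  intros Hphi [Hf [Phi [HPhi Ef]]] [Hg [Psi [HPsi Eg]]].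
  assert (Hk : exists k, phi k <> 0%C /\ (k = 0%Z \/ k = 1%Z))
    by (destruct Hphi; eauto).
  destruct Hk as [k [Hk Hk01]].
  exists (fun t => / phi k * (Phi t * g t k - Psi t * f t k))%C. split.
  - apply in_wiener_mult; [ apply in_wiener_const | ].
    apply in_wiener_minus; apply in_wiener_mult; auto.
  - intros t.
    transitivity (/ phi k * (bracket a 0 (f t) phi * g t k
                             - bracket a 0 (g t) phi * f t k))%C.
    + unfold bracket. change (0 + 1)%Z with 1%Z.
      destruct Hk01 as [-> | ->]; field; exact Hk.
    + rewrite Ef, Eg. ring.
Qed.

End Factorization.

Lemma in_wiener_bracket (a : Z -> R) (f g : R -> Z -> C) :
  (forall k, in_wiener (fun t => f t k)) -> (forall k, in_wiener (fun t => g t k)) ->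
  in_wiener (fun t => bracket a 0 (f t) (g t)).
Proof.
  intros Hf Hg. unfold bracket.
  apply in_wiener_mult; [ apply in_wiener_const | ].
  apply in_wiener_minus; apply in_wiener_mult; auto.
Qed.

Lemma wave_in_wiener (a d : Z -> R) (h : Z -> R -> C) (H : Z -> R) (k : Z) :
  jost_profile a d h H -> in_wiener (fun t => wave h t k).
Proof.
  intros [_ [H1 _]]. apply in_wiener_mult; [ apply in_wiener_expi_Z | ].
  exists (H k); apply H1.
Qed.

(** * Reflection of the line and nonvanishing of waves *)

(** [a n] sits on the bond between [n - 1] and [n], and [d n] on the site [n]; under [n -> -n] the
    bond [n] becomes the bond [1 - n], whence the different index maps. *)
Lemma jacobi_reflect (a d : Z -> R) (t : R) (u : Z -> C) :
  jacobi (fun n => a (1 - n)%Z) (fun n => d (- n)%Z) t u ->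
  jacobi a d t (fun n => u (- n)%Z).
Proof.
  intros Hu n. specialize (Hu (- n)%Z). cbv beta in Hu.
  replace (1 - (- n + 1))%Z with n in Hu by lia.
  replace (1 - - n)%Z with (n + 1)%Z in Hu by lia.
  replace (- - n)%Z with n in Hu by lia.
  replace (- (n + 1))%Z with (- n - 1)%Z by lia.
  replace (- (n - 1))%Z with (- n + 1)%Z by lia.
  rewrite <- Hu. ring.
Qed.

Lemma jacobi_unreflect (a d : Z -> R) (t : R) (u : Z -> C) :
  jacobi a d t u ->
  jacobi (fun n => a (1 - n)%Z) (fun n => d (- n)%Z) t (fun n => u (- n)%Z).
Proof.
  intros Hu n. specialize (Hu (- n)%Z).
  replace (1 - (n + 1))%Z with (- n)%Z by lia.
  replace (1 - n)%Z with (- n + 1)%Z by lia.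
  replace (- (n + 1))%Z with (- n - 1)%Z by lia.
  replace (- (n - 1))%Z with (- n + 1)%Z by lia.
  rewrite <- Hu. ring.
Qed.

Lemma bracket_reflect (a : Z -> R) (n : Z) (u v : Z -> C) :
  bracket a n (fun j => u (- j)%Z) (fun j => v (- j)%Z) =
  (- bracket (fun j => a (1 - j)%Z) (- n - 1) u v)%C.
Proof.
  unfold bracket.
  replace (1 - (- n - 1 + 1))%Z with (n + 1)%Z by lia.
  replace (- n - 1 + 1)%Z with (- n)%Z by lia.
  replace (- (n + 1))%Z with (- n - 1)%Z by lia. ring.
Qed.

Lemma jacobi_zero_forward (a d : Z -> R) (t : R) (u : Z -> C) (n : Z) :
  (forall n, a n <> 0) -> jacobi a d t u ->
  u n = 0%C -> u (n + 1)%Z = 0%C -> forall k : nat, u (n + Z.of_nat k)%Z = 0%C.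
Proof.
  intros Ha Hu H0 H1.
  assert (H : forall k : nat, u (n + Z.of_nat k)%Z = 0%C /\
                              u (n + Z.of_nat k + 1)%Z = 0%C);
    [ | intros k; apply H ].
  induction k as [|k [IH1 IH2]]; [ rewrite Z.add_0_r; auto | ].
  replace (n + Z.of_nat (S k))%Z with (n + Z.of_nat k + 1)%Z by lia.
  split; [ assumption | ].
  specialize (Hu (n + Z.of_nat k + 1)%Z).
  replace (n + Z.of_nat k + 1 - 1)%Z with (n + Z.of_nat k)%Z in Hu by lia.
  rewrite IH1, IH2 in Hu.
  set (j := (n + Z.of_nat k + 1 + 1)%Z) in *.
  assert (Haj : RtoC (a j) <> 0%C) by (intros E; apply (Ha j), RtoC_inj, E).
  transitivity (/ RtoC (a j) * (RtoC (a j) * u j +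
    RtoC (a (n + Z.of_nat k + 1)%Z) * 0))%C; [ field; exact Haj | ].
  rewrite Hu. ring.
Qed.

(** Two consecutive zeros would propagate to [+oo], against [h -> 1]. This holds at the edges as
    well, where it is needed. *)
Lemma wave_neq_0 (a d : Z -> R) (h : Z -> R -> C) (H : Z -> R) (t : R) (n : Z) :
  (forall n, a n <> 0) -> jost_profile a d h H ->
  wave h t n <> 0%C \/ wave h t (n + 1)%Z <> 0%C.
Proof.
  intros Ha Hp.
  destruct (excluded_middle_informative (wave h t n = 0%C)) as [E0|]; [ | auto ].
  destruct (excluded_middle_informative (wave h t (n + 1)%Z = 0%C)) as [E1|]; [ | auto ].
  exfalso.
  pose proof (jacobi_zero_forward a d t _ n Ha (wave_jacobi a d h H Hp t) E0 E1) as Hz.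
  pose proof (clim_Cmod _ _ (profile_lim a d h H Hp n t)) as Hl.
  assert (E : is_lim_seq (fun _ : nat => 0) (Cmod 1)).
  { eapply is_lim_seq_ext; [ | exact Hl ]. intros k; cbv beta.
    rewrite <- Cmod_0, <- (Hz k). unfold wave.
    rewrite Cmod_mult, Cmod_expi. ring. }
  apply is_lim_seq_unique in E. rewrite Lim_seq_const, Cmod_1 in E.
  injection E. lra.
Qed.

(** * Scattering quotients of the Jacobi equation *)

Section Scattering.

Variables (a d : Z -> R) (h h' : Z -> R -> C) (H H' : Z -> R).
Hypothesis a_neq_0 : forall n, a n <> 0.
Hypothesis a_moment : moment (fun n => 1 - a n).
Hypothesis a_moment' : moment (fun n => 1 - a (1 - n)%Z).
Hypothesis profile : jost_profile a d h H.
Hypothesis profile' :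
  jost_profile (fun n => a (1 - n)%Z) (fun n => d (- n)%Z) h' H'.

Definition up (t : R) : Z -> C := wave h t.
Definition um (t : R) : Z -> C := fun n => wave h' t (- n)%Z.

Lemma um_jacobi (t : R) : jacobi a d t (um t).
Proof. apply jacobi_reflect, (wave_jacobi _ _ h' H' profile'). Qed.

Lemma up_in_wiener (k : Z) : in_wiener (fun t => up t k).
Proof. apply (wave_in_wiener a d h H k profile). Qed.

Lemma um_in_wiener (k : Z) : in_wiener (fun t => um t k).
Proof. apply (wave_in_wiener _ _ h' H' (- k) profile'). Qed.

Lemma factors_with_up (t0 : R) : sin t0 = 0 -> factors_with a t0 (up t0) up.
Proof.
  intros Ht0. split; [ apply up_in_wiener | ].
  destruct (resonance_quotient a d h H profile a_moment t0 0 Ht0) as [Phi [K [HK E]]].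
  exists Phi; split; [ exists K; exact HK | exact E ].
Qed.

Lemma factors_with_um (t0 : R) : sin t0 = 0 -> factors_with a t0 (um t0) um.
Proof.
  intros Ht0. split; [ apply um_in_wiener | ].
  (* The bond between the sites 0 and 1 becomes, on the reflected line, the one between -1 and 0;
     the index is left as [- 0 - 1] to match [bracket_reflect]. *)
  destruct (resonance_quotient _ _ h' H' profile' a_moment' t0 (- 0 - 1) Ht0)
    as [Phi [K [HK E]]].
  exists (fun t => - Phi t)%C; split; [ exists K; apply wnorm_le_opp, HK | ].
  intros t. unfold um. rewrite bracket_reflect, E. ring.
Qed.

Lemma up_neq_0 (t : R) : up t 0%Z <> 0%C \/ up t 1%Z <> 0%C.
Proof. apply (wave_neq_0 a d h H t 0 a_neq_0 profile). Qed.

Lemma um_neq_0 (t : R) : um t 0%Z <> 0%C \/ um t 1%Z <> 0%C.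
Proof.
  destruct (wave_neq_0 _ _ h' H' t (-1) (fun n => a_neq_0 (1 - n)%Z) profile'); auto.
Qed.

Definition jost_bracket (t : R) : C := bracket a 0 (up t) (um t).

(* Plücker's identity for [u+], its conjugate, [u-] and its conjugate:
   [|[u+,u-]|^2 = 4 sin^2 t + |[u+,conj u-]|^2]. *)
Lemma jost_bracket_lower_bound (t : R) :
  Cmod (expi t - expi (- t)) <= Cmod (jost_bracket t).
Proof.
  set (cup := fun n => Cconj (up t n)). set (cum := fun n => Cconj (um t n)).
  assert (HRc : forall x, Cconj (RtoC x) = RtoC x)
    by (intros; apply injective_projections; simpl; ring).
  assert (Hconj : forall u v : Z -> C,
    bracket a 0 (fun n => Cconj (u n)) (fun n => Cconj (v n)) =
    Cconj (bracket a 0 u v)).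
  { intros u v. unfold bracket. rewrite Cmult_conj, Cminus_conj, !Cmult_conj, HRc.
    reflexivity. }
  pose proof (bracket_wave_conj a d h H profile a_moment t 0) as E1.
  pose proof (bracket_wave_conj _ _ h' H' profile' a_moment' t (- 0 - 1)) as E2.
  assert (E2' : bracket a 0 (um t) cum = (expi t - expi (- t))%C).
  { unfold cum, um. rewrite (bracket_reflect a 0 (wave h' t)
      (fun n => Cconj (wave h' t n))), E2. ring. }
  assert (E3 : bracket a 0 cup cum = Cconj (jost_bracket t))
    by apply (Hconj (up t) (um t)).
  assert (E4 : bracket a 0 cup (um t) = Cconj (bracket a 0 (up t) cum)).
  { rewrite <- (Hconj (up t) cum). unfold bracket, cum.
    rewrite !Cconj_conj. reflexivity. }
  set (s := (expi t - expi (- t))%C) in *.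
  assert (Hs : Cconj s = (- s)%C).
  { unfold s. rewrite Cminus_conj, !Cconj_expi, Ropp_involutive. ring. }
  assert (Hpl : (bracket a 0 (up t) cup * bracket a 0 (um t) cum
    - jost_bracket t * bracket a 0 cup cum
    + bracket a 0 (up t) cum * bracket a 0 cup (um t))%C = 0%C)
    by (unfold jost_bracket, bracket; ring).
  change (bracket a 0 (up t) cup = (expi (- t) - expi t)%C) in E1.
  rewrite E1, E2', E3, E4, <- !Cmod2_conj in Hpl.
  replace (expi (- t) - expi t)%C with (Cconj s) in Hpl by (rewrite Hs; unfold s; ring).
  rewrite (Cmult_comm (Cconj s)), <- Cmod2_conj in Hpl.
  rewrite <- RtoC_minus, <- RtoC_plus in Hpl. apply RtoC_inj in Hpl.
  pose proof (pow2_ge_0 (Cmod (bracket a 0 (up t) cum))).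
  apply Rsqr_incr_0_var; [ unfold Rsqr; nra | apply Cmod_ge_0 ].
Qed.

Lemma jost_bracket_in_wiener : in_wiener jost_bracket.
Proof. apply in_wiener_bracket; [ apply up_in_wiener | apply um_in_wiener ]. Qed.

(** All families are compared with the single vector [up t0]: [up] by Green's formula, [um] because
    the vanishing bracket makes [um t0] parallel to it, and their reflections in [t] because the
    edge is fixed by [t -> -t]. *)
Lemma resonance_factors (t0 : R) :
  sin t0 = 0 -> jost_bracket t0 = 0%C ->
  factors_at t0 jost_bracket /\
  factors_at t0 (fun t => bracket a 0 (um t) (up (- t))) /\
  factors_at t0 (fun t => bracket a 0 (up t) (um (- t))).
Proof.
  intros Ht0 E.
  pose proof (factors_with_up t0 Ht0) as Hp.
  assert (Hm : factors_with a t0 (up t0) um).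
  { apply (factors_with_proportional a t0 (a_neq_0 1) (up t0) (um t0));
      [ apply um_neq_0 | exact E | apply factors_with_um, Ht0 ]. }
  pose proof (up_neq_0 t0) as Hne.
  repeat split; apply (factors_with_bracket a t0 (up t0)); auto;
    apply factors_with_opp_arg; assumption.
Qed.

(** For [s^2 = 1], [x - 1 / x = (x - s) (x + s) / x]. *)
Lemma sine_factors (t0 : R) :
  sin t0 = 0 -> factors_at t0 (fun t => expi t - expi (- t))%C.
Proof.
  intros Ht0.
  assert (Es : expi (- t0) = expi t0).
  { unfold expi. rewrite cos_neg, sin_neg, Ht0, Ropp_0. reflexivity. }
  exists (fun t => expi (- t) * (expi t + expi t0))%C. split.
  - apply in_wiener_mult; [ apply in_wiener_expi_opp | ].
    apply in_wiener_plus; [ apply in_wiener_expi | apply in_wiener_const ].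
  - intros t. pose proof (expi_mult_opp t0) as E0. rewrite Es in E0.
    pose proof (expi_mult_opp t) as Et.
    transitivity ((expi t * expi (- t)) * expi t - (expi t0 * expi t0) * expi (- t))%C;
      [ rewrite Et, E0; ring | ring ].
Qed.

Lemma scattering_quotients :
  (exists G, in_wiener G /\ forall t, sin t <> 0 ->
     G t = ((expi t - expi (- t)) / jost_bracket t)%C) /\
  (exists G, in_wiener G /\ forall t, sin t <> 0 ->
     G t = (bracket a 0 (um t) (up (- t)) / jost_bracket t)%C) /\
  (exists G, in_wiener G /\ forall t, sin t <> 0 ->
     G t = (bracket a 0 (up t) (um (- t)) / jost_bracket t)%C).
Proof.
  assert (H0 : sin 0 = 0) by apply sin_0. assert (HP : sin PI = 0) by apply sin_PI.
  repeat split; apply in_wiener_quotient_factors;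
    try exact jost_bracket_in_wiener; try exact jost_bracket_lower_bound;
    try (intros E; split; [ apply resonance_factors; assumption | ]).
  - apply in_wiener_minus; [ apply in_wiener_expi | apply in_wiener_expi_opp ].
  - apply sine_factors, H0.
  - apply sine_factors, HP.
  - apply (in_wiener_bracket a um (fun t => up (- t))); [ apply um_in_wiener | ].
    intros k; apply (in_wiener_opp_arg (fun t => up t k)), up_in_wiener.
  - apply resonance_factors; assumption.
  - apply resonance_factors; assumption.
  - apply (in_wiener_bracket a up (fun t => um (- t))); [ apply up_in_wiener | ].
    intros k; apply (in_wiener_opp_arg (fun t => um t k)), um_in_wiener.
  - apply resonance_factors; assumption.
  - apply resonance_factors; assumption.
Qed.

End Scattering.

(** * The Dirac operator *)

(** A base point to the right only lowers the weights; one [N] places to the left adds [N] terms and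
    raises the others by at most the factor [N + 1]. *)
Lemma moment_of_half_line (p : Z -> R) :
  ex_series (fun k : nat => (INR k + 1) * Rabs (p (Z.of_nat k))) -> moment p.
Proof.
  intros Hp n. destruct (Z_le_gt_dec 0 n) as [Hn|Hn].
  - pose proof (proj1 (ex_series_incr_n (K := R_AbsRing) (V := R_NormedModule)
      _ (Z.to_nat n)) Hp) as H. cbv beta in H.
    apply (ex_series_le (K := R_AbsRing) (V := R_CompleteNormedModule) _ _) with (2 := H).
    intros k. unfold norm; simpl; unfold abs; simpl.
    pose proof (pos_INR k). pose proof (pos_INR (Z.to_nat n)).
    rewrite Rabs_mult, Rabs_Rabsolu, Rabs_pos_eq, plus_INR by lra.
    replace (Z.of_nat (Z.to_nat n + k)) with (n + Z.of_nat k)%Z by lia.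
    apply Rmult_le_compat_r; [ apply Rabs_pos | lra ].
  - set (N := Z.to_nat (- n)).
    apply (proj2 (ex_series_incr_n (K := R_AbsRing) (V := R_NormedModule)
      (fun k => (INR k + 1) * Rabs (p (n + Z.of_nat k)%Z)) N)).
    apply (ex_series_le (K := R_AbsRing) (V := R_CompleteNormedModule) _
      (fun k => (INR N + 1) * ((INR k + 1) * Rabs (p (Z.of_nat k))))).
    + intros k. unfold norm; simpl; unfold abs; simpl.
      pose proof (pos_INR k). pose proof (pos_INR N).
      rewrite plus_INR, Rabs_mult, Rabs_Rabsolu, Rabs_pos_eq by lra.
      replace (n + Z.of_nat (N + k))%Z with (Z.of_nat k) by (unfold N; lia).
      rewrite <- Rmult_assoc.
      apply Rmult_le_compat_r; [ apply Rabs_pos | nra ].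
    + apply (ex_series_scal_l (INR N + 1)
        (fun k => (INR k + 1) * Rabs (p (Z.of_nat k)))), Hp.
Qed.

Lemma l11_moment (q : Z -> R) :
  l11 q -> moment q /\ moment (fun n => q (- n)%Z).
Proof.
  intros [s [s1 [s2 [H1 [H2 _]]]]]. split; apply moment_of_half_line.
  - exists s1. eapply is_series_ext; [ | exact H1 ].
    intros k; cbv beta. rewrite <- INR_IZR_INZ, Rabs_pos_eq by apply pos_INR.
    f_equal; ring.
  - apply ex_series_incr_1. exists s2. eapply is_series_ext; [ | exact H2 ].
    intros k; cbv beta.
    rewrite opp_IZR, Rabs_Ropp, <- INR_IZR_INZ, (Rabs_pos_eq (INR _)) by apply pos_INR.
    f_equal; ring.
Qed.

Lemma moment_square_minus_double (p : Z -> R) :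
  moment p -> moment (fun n => (p n - 2) * p n).
Proof.
  intros Hp. apply moment_mult_bounded; [ | assumption ]. intros n.
  pose proof (moment_lim_0 p n Hp) as Hl.
  pose proof (is_lim_seq_minus' _ _ 0 2 Hl (is_lim_seq_const 2)) as Hm.
  destruct (filterlim_bounded (fun k : nat => p (n + Z.of_nat k)%Z - 2)) as [K HK].
  - exists (0 - 2). exact Hm.
  - exists K. exact HK.
Qed.

Lemma lambda_facts (m t : R) :
  0 < m -> 0 < m + lambda m t /\
  (lambda m t - m) * (m + lambda m t) = 2 - 2 * cos t.
Proof.
  intros Hm. unfold lambda.
  pose proof (COS_bound t).
  pose proof (sqrt_pos (2 - 2 * cos t + m ^ 2)).
  split; [ lra | ].
  assert (E : sqrt (2 - 2 * cos t + m ^ 2) * sqrt (2 - 2 * cos t + m ^ 2) =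
              2 - 2 * cos t + m ^ 2) by (apply sqrt_sqrt; nra).
  nra.
Qed.

Definition hop (q : Z -> R) (n : Z) : R := 1 - q n.
(** Equals [hop q n ^ 2 - 1]; the factored form shows a bounded multiple of [q], hence a finite
    first moment. *)
Definition site (q : Z -> R) (n : Z) : R := (q n - 2) * q n.

Lemma is_solution_components (m lam : R) (q : Z -> R) (w : Z -> C * C) :
  is_solution m q lam w <->
  forall n,
    (RtoC (m + lam) * vcomp w n = ucomp w (n - 1)%Z - RtoC (hop q n) * ucomp w n)%C /\
    (vcomp w (n + 1)%Z = RtoC (hop q n) * vcomp w n
                         + RtoC (lam - m) * ucomp w n)%C.
Proof.
  unfold is_solution, dirac, dirac0, potential, dfwd, dadj, hop; simpl.
  split; intros H n; specialize (H n).
  - injection H as H1 H2. rewrite RtoC_plus, !RtoC_minus.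
    assert (H1' : (RtoC m * ucomp w n + (vcomp w (n + 1)%Z - vcomp w n)
      + RtoC (q n) * vcomp w n)%C = (RtoC lam * ucomp w n)%C)
      by (apply injective_projections; simpl; assumption).
    assert (H2' : (ucomp w (n - 1)%Z - ucomp w n - RtoC m * vcomp w n
      + RtoC (q n) * ucomp w n)%C = (RtoC lam * vcomp w n)%C)
      by (apply injective_projections; simpl; assumption).
    split.
    + rewrite Cmult_plus_distr_r, <- H2'. ring.
    + transitivity (RtoC lam * ucomp w n - RtoC m * ucomp w n
        + (1 - RtoC (q n)) * vcomp w n)%C; [ rewrite <- H1'; ring | ring ].
  - rewrite RtoC_plus, !RtoC_minus in H. destruct H as [H1 H2].
    f_equal.
    + rewrite H2. ring.
    + transitivity ((RtoC m + RtoC lam) * vcomp w n - RtoC m * vcomp w n)%C;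
        [ rewrite H1; ring | ring ].
Qed.

(** * Equivalence of the Dirac system and the Jacobi equation *)

Section Dirac.

Variables (m t : R) (q : Z -> R).
Hypothesis m_pos : 0 < m.

Let lam := lambda m t.

Lemma Clambda_neq_0 : RtoC (m + lam) <> 0%C.
Proof.
  intros E; apply RtoC_inj in E.
  pose proof (lambda_facts m t m_pos) as [H _]. fold lam in H. lra.
Qed.

Lemma Clambda_mult :
  (RtoC (lam - m) * RtoC (m + lam))%C = (2 - RtoC (2 * cos t))%C.
Proof.
  rewrite <- RtoC_mult. destruct (lambda_facts m t m_pos) as [_ E].
  fold lam in E. rewrite E, RtoC_minus. reflexivity.
Qed.

Lemma Csite (n : Z) :
  (RtoC (2 * cos t + site q n))%C =
  (RtoC (2 * cos t) + RtoC (hop q n) * RtoC (hop q n) - 1)%C.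
Proof.
  rewrite <- RtoC_mult, <- RtoC_plus, <- RtoC_minus. f_equal.
  unfold site, hop. ring.
Qed.

(** The second Dirac equation gives [v] at [n] and at [n + 1], and the first one links the two
    values. Then [m] and [lambda] enter only through [(lambda - m) (m + lambda) = 2 - 2 cos t]. *)
Lemma dirac_jacobi (w : Z -> C * C) :
  is_solution m q lam w -> jacobi (hop q) (site q) t (ucomp w).
Proof.
  intros Hw n. rewrite is_solution_components in Hw.
  destruct (Hw n) as [E1 E2]. destruct (Hw (n + 1)%Z) as [E3 _].
  replace (n + 1 - 1)%Z with n in E3 by lia.
  rewrite Csite. pose proof Clambda_mult as El.
  set (A := RtoC (hop q n)) in *. set (A1 := RtoC (hop q (n + 1)%Z)) in *.
  set (c := RtoC (2 * cos t)) in *.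
  transitivity (ucomp w n - (ucomp w n - A1 * ucomp w (n + 1)%Z)
    + A * (ucomp w (n - 1)%Z - A * ucomp w n) + A * A * ucomp w n)%C; [ ring | ].
  rewrite <- E3, <- E1, E2.
  transitivity (ucomp w n + A * A * ucomp w n
    - (RtoC (lam - m) * RtoC (m + lam)) * ucomp w n)%C; [ ring | ].
  rewrite El. ring.
Qed.

(** The second component is the one forced by the second Dirac equation. *)
Definition spinor (u : Z -> C) (n : Z) : C * C :=
  (u n, (u (n - 1)%Z - RtoC (hop q n) * u n) / RtoC (m + lam))%C.

Lemma jacobi_dirac (u : Z -> C) :
  jacobi (hop q) (site q) t u -> is_solution m q lam (spinor u).
Proof.
  intros Hu. apply is_solution_components. intros n.
  unfold spinor, ucomp, vcomp; simpl fst; simpl snd.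
  pose proof Clambda_neq_0 as Hne. split; [ field; exact Hne | ].
  specialize (Hu n). rewrite Csite in Hu. pose proof Clambda_mult as El.
  replace (n + 1 - 1)%Z with n by lia.
  set (A := RtoC (hop q n)) in *. set (A1 := RtoC (hop q (n + 1)%Z)) in *.
  set (c := RtoC (2 * cos t)) in *. set (M := RtoC (m + lam)) in *.
  assert (E : (u n - A1 * u (n + 1)%Z)%C =
              (A * (u (n - 1)%Z - A * u n) + (RtoC (lam - m) * M) * u n)%C).
  { rewrite El.
    transitivity (u n + A * u (n - 1)%Z - (A1 * u (n + 1)%Z + A * u (n - 1)%Z))%C;
      [ ring | ]. rewrite Hu. ring. }
  rewrite E. field. exact Hne.
Qed.

(** Expressing [v_1] through [u_0] and [u_1] makes the products of the two values [u_0] cancel. *)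
Lemma wronskian_bracket (w1 w2 : Z -> C * C) :
  is_solution m q lam w1 -> is_solution m q lam w2 ->
  wronskian w1 w2 =
  (- (bracket (hop q) 0 (ucomp w1) (ucomp w2) / RtoC (m + lam)))%C.
Proof.
  intros H1 H2. rewrite is_solution_components in H1, H2.
  destruct (H1 1%Z) as [E1 _]. destruct (H2 1%Z) as [E2 _].
  change (1 - 1)%Z with 0%Z in E1, E2.
  pose proof Clambda_neq_0 as Hne.
  unfold wronskian, wronskian_at, bracket. change (0 + 1)%Z with 1%Z.
  transitivity ((ucomp w1 0%Z * (RtoC (m + lam) * vcomp w2 1%Z)
    - ucomp w2 0%Z * (RtoC (m + lam) * vcomp w1 1%Z)) / RtoC (m + lam))%C;
    [ field; exact Hne | ].
  rewrite E1, E2. field. exact Hne.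
Qed.

End Dirac.

(** * Identification of the chosen Jost solutions *)

Section JostSolutions.

Variables (m : R) (q : Z -> R) (h h' : Z -> R -> C) (H H' : Z -> R).
Hypothesis m_pos : 0 < m.
Hypothesis q_moment : moment (fun n => 1 - hop q n).
Hypothesis q_moment' : moment (fun n => 1 - hop q (1 - n)).
Hypothesis profile : jost_profile (hop q) (site q) h H.
Hypothesis profile' :
  jost_profile (fun n => hop q (1 - n)) (fun n => site q (- n)) h' H'.

(** After removal of the phase, the second component tends to [(e^{-it} - 1) / (m + lambda)],
    because [h] and [hop] tend to 1; this limit is [alpha_minus]. *)
Lemma spinor_up_jost (t : R) : is_jost_plus m q t (spinor m t q (up h t)).
Proof.
  pose proof (Clambda_neq_0 m t m_pos) as Hne.
  repeat split.
  - apply (jacobi_dirac m t q m_pos), (wave_jacobi _ _ h H profile).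
  - unfold ucomp, spinor, up, wave; simpl fst.
    apply (clim_ext (fun k => h (0 + Z.of_nat k)%Z t));
      [ | apply (profile_lim _ _ h H profile) ].
    intros k. rewrite Z.add_0_l, (Rmult_comm t).
    pose proof (expi_mult_opp (IZR (Z.of_nat k) * t)) as E.
    set (e := expi (IZR (Z.of_nat k) * t)) in *.
    set (e' := expi (- (IZR (Z.of_nat k) * t))) in *.
    transitivity ((e * e') * h (Z.of_nat k) t)%C; [ rewrite E; ring | ring ].
  - unfold vcomp, spinor, up, wave; simpl snd.
    apply (clim_ext (fun k => (expi (- t) * h (-1 + Z.of_nat k)%Z t
      - RtoC (hop q (0 + Z.of_nat k)) * h (0 + Z.of_nat k)%Z t)
      * / RtoC (m + lambda m t))%C).
    + intros k. rewrite !Z.add_0_l, expi_pred, (Rmult_comm t (IZR _)).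
      replace (-1 + Z.of_nat k)%Z with (Z.of_nat k - 1)%Z by lia.
      pose proof (expi_mult_opp (IZR (Z.of_nat k) * t)) as E.
      set (e := expi (IZR (Z.of_nat k) * t)) in *.
      set (e' := expi (- (IZR (Z.of_nat k) * t))) in *.
      transitivity ((e * e') * (expi (- t) * h (Z.of_nat k - 1)%Z t
        - RtoC (hop q (Z.of_nat k)) * h (Z.of_nat k) t)
        * / RtoC (m + lambda m t))%C; [ rewrite E; ring | field; exact Hne ].
    + unfold alpha_minus.
      apply (eq_ind ((expi (- t) * 1 - 1 * 1) * / RtoC (m + lambda m t))%C
        (clim _)); [ | field; exact Hne ].
      apply clim_mult; [ | apply clim_const ].
      apply clim_minus; apply clim_mult; try apply clim_const;
        try (apply (profile_lim _ _ h H profile)).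
      apply (coefficient_lim (hop q) q_moment).
Qed.

Lemma spinor_um_jost (t : R) : is_jost_minus m q t (spinor m t q (um h' t)).
Proof.
  pose proof (Clambda_neq_0 m t m_pos) as Hne.
  assert (Eneg : forall k : nat, expi (t * IZR (- Z.of_nat k)) =
                                 expi (- (IZR (Z.of_nat k) * t)))
    by (intros; rewrite opp_IZR; f_equal; ring).
  repeat split.
  - apply (jacobi_dirac m t q m_pos), (um_jacobi _ _ h' H' profile').
  - unfold ucomp, spinor, um, wave; simpl fst.
    apply (clim_ext (fun k => h' (0 + Z.of_nat k)%Z t));
      [ | apply (profile_lim _ _ h' H' profile') ].
    intros k. rewrite Z.add_0_l, Z.opp_involutive, Eneg.
    pose proof (expi_mult_opp (IZR (Z.of_nat k) * t)) as E.
    set (e := expi (IZR (Z.of_nat k) * t)) in *.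
    set (e' := expi (- (IZR (Z.of_nat k) * t))) in *.
    transitivity ((e * e') * h' (Z.of_nat k) t)%C; [ rewrite E; ring | ring ].
  - unfold vcomp, spinor, um, wave; simpl snd.
    apply (clim_ext (fun k => (expi t * h' (1 + Z.of_nat k)%Z t
      - RtoC (hop q (1 - (1 + Z.of_nat k))) * h' (0 + Z.of_nat k)%Z t)
      * / RtoC (m + lambda m t))%C).
    + intros k. rewrite Z.add_0_l, Eneg, Z.opp_involutive.
      replace (- (- Z.of_nat k - 1))%Z with (Z.of_nat k + 1)%Z by lia.
      replace (1 - (1 + Z.of_nat k))%Z with (- Z.of_nat k)%Z by lia.
      replace (1 + Z.of_nat k)%Z with (Z.of_nat k + 1)%Z by lia.
      rewrite expi_succ.
      pose proof (expi_mult_opp (IZR (Z.of_nat k) * t)) as E.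
      set (e := expi (IZR (Z.of_nat k) * t)) in *.
      set (e' := expi (- (IZR (Z.of_nat k) * t))) in *.
      transitivity ((e * e') * (expi t * h' (Z.of_nat k + 1)%Z t
        - RtoC (hop q (- Z.of_nat k)) * h' (Z.of_nat k) t)
        * / RtoC (m + lambda m t))%C; [ rewrite E; ring | field; exact Hne ].
    + unfold alpha_plus.
      apply (eq_ind ((expi t * 1 - 1 * 1) * / RtoC (m + lambda m t))%C
        (clim _)); [ | field; exact Hne ].
      apply clim_mult; [ | apply clim_const ].
      apply clim_minus; apply clim_mult; try apply clim_const;
        try (apply (profile_lim _ _ h' H' profile')).
      apply (coefficient_lim (fun n => hop q (1 - n)) q_moment').
Qed.

(** The spinor shows that [epsilon] has something to choose, and uniqueness for the Jacobi equation
    fixes the first component of whatever it chooses. *)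
Lemma jost_plus_spec (t : R) :
  sin t <> 0 ->
  is_solution m q (lambda m t) (jost_plus m q t) /\
  forall n, ucomp (jost_plus m q t) n = up h t n.
Proof.
  intros Hs.
  destruct (epsilon_spec seq_inhabited (is_jost_plus m q t)
    (ex_intro _ _ (spinor_up_jost t))) as [Hsol [Hlim _]].
  fold (jost_plus m q t) in Hsol, Hlim.
  split; [ exact Hsol | ].
  apply (jost_unique _ _ h H profile q_moment t); [ exact Hs | | exact Hlim ].
  apply (dirac_jacobi m t q m_pos), Hsol.
Qed.

Lemma jost_minus_spec (t : R) :
  sin t <> 0 ->
  is_solution m q (lambda m t) (jost_minus m q t) /\
  forall n, ucomp (jost_minus m q t) n = um h' t n.
Proof.
  intros Hs.
  destruct (epsilon_spec seq_inhabited (is_jost_minus m q t)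
    (ex_intro _ _ (spinor_um_jost t))) as [Hsol [Hlim _]].
  fold (jost_minus m q t) in Hsol, Hlim.
  split; [ exact Hsol | ]. intros n.
  pose proof (jost_unique _ _ h' H' profile' q_moment' t
    (fun k => ucomp (jost_minus m q t) (- k)%Z) Hs) as Hu.
  cbv beta in Hu. unfold um. rewrite <- Hu.
  - rewrite Z.opp_involutive. reflexivity.
  - apply jacobi_unreflect, (dirac_jacobi m t q m_pos), Hsol.
  - eapply clim_ext; [ | exact Hlim ]. intros k; cbv beta.
    rewrite opp_IZR. do 2 f_equal. ring.
Qed.

Lemma bracket_ext (a : Z -> R) (n : Z) (u v u' v' : Z -> C) :
  (forall k, u k = u' k) -> (forall k, v k = v' k) ->
  bracket a n u v = bracket a n u' v'.
Proof. intros Hu Hv; unfold bracket; rewrite !Hu, !Hv; reflexivity. Qed.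

Lemma lambda_opp (t : R) : lambda m (- t) = lambda m t.
Proof. unfold lambda; rewrite cos_neg; reflexivity. Qed.

Lemma W_bracket (t : R) :
  sin t <> 0 ->
  W m q t = (- (jost_bracket (hop q) h h' t / RtoC (m + lambda m t)))%C.
Proof.
  intros Hs. destruct (jost_plus_spec t Hs) as [S1 E1].
  destruct (jost_minus_spec t Hs) as [S2 E2].
  unfold W. rewrite (wronskian_bracket m t q m_pos _ _ S1 S2).
  rewrite (bracket_ext _ _ _ _ _ _ E1 E2). reflexivity.
Qed.

Lemma W_plus_bracket (t : R) :
  sin t <> 0 ->
  W_plus m q t =
  (- (bracket (hop q) 0 (um h' t) (up h (- t)) / RtoC (m + lambda m t)))%C.
Proof.
  intros Hs. assert (Hs' : sin (- t) <> 0) by (rewrite sin_neg; lra).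
  destruct (jost_plus_spec (- t) Hs') as [S1 E1].
  destruct (jost_minus_spec t Hs) as [S2 E2].
  rewrite lambda_opp in S1.
  unfold W_plus. rewrite (wronskian_bracket m t q m_pos _ _ S2 S1).
  rewrite (bracket_ext _ _ _ _ _ _ E2 E1). reflexivity.
Qed.

Lemma W_minus_bracket (t : R) :
  sin t <> 0 ->
  W_minus m q t =
  (- (bracket (hop q) 0 (up h t) (um h' (- t)) / RtoC (m + lambda m t)))%C.
Proof.
  intros Hs. assert (Hs' : sin (- t) <> 0) by (rewrite sin_neg; lra).
  destruct (jost_plus_spec t Hs) as [S1 E1].
  destruct (jost_minus_spec (- t) Hs') as [S2 E2].
  rewrite lambda_opp in S2.
  unfold W_minus. rewrite (wronskian_bracket m t q m_pos _ _ S1 S2).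
  rewrite (bracket_ext _ _ _ _ _ _ E1 E2). reflexivity.
Qed.

End JostSolutions.

(** * The scattering coefficients of the Dirac operator *)

Lemma punctured_sin (t : R) : punctured t -> sin t <> 0.
Proof.
  intros [Ht|Ht] E.
  - assert (0 < sin (- t)) by (apply sin_gt_0; lra). rewrite sin_neg in *. lra.
  - assert (0 < sin t) by (apply sin_gt_0; lra). lra.
Qed.

Lemma in_wiener_extends (f G : R -> C) :
  in_wiener G -> (forall t, punctured t -> G t = f t) -> extends_to_wiener f.
Proof. intros [K HK]. apply (wnorm_le_extends_to_wiener f G K HK). Qed.

Theorem theorem5p1 :
  forall (m : R) (q : Z -> R),
    0 < m ->
    (forall n : Z, q n <> 1) ->
    l11 q ->
    extends_to_wiener (transmission m q) /\
    extends_to_wiener (reflection_plus m q) /\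
    extends_to_wiener (reflection_minus m q).
Proof.
  intros m q Hm Hq1 Hq.
  destruct (l11_moment q Hq) as [Hmom Hmom'].
  assert (Ha0 : forall n, hop q n <> 0)
    by (intros n E; apply (Hq1 n); unfold hop in E; lra).
  assert (Ha : moment (fun n => 1 - hop q n)).
  { revert Hmom. apply moment_le. intros n. unfold hop. right; f_equal; ring. }
  (* The reflected bonds are the reflected sites moved by one, so the base point moves to
     [n - 1]. *)
  assert (Ha' : moment (fun n => 1 - hop q (1 - n))).
  { intros n. specialize (Hmom' (n - 1)%Z). eapply ex_series_ext; [ | exact Hmom' ].
    intros k; cbv beta. unfold hop.
    replace (- (n - 1 + Z.of_nat k))%Z with (1 - (n + Z.of_nat k))%Z by lia.
    do 2 f_equal. ring. }
  destruct (jost_profile_exists (hop q) (site q) Ha0 Ha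
    (moment_square_minus_double q Hmom)) as [h [H Hp]].
  (* The Jost solutions at [-oo] are those at [+oo] of the reflected equation. *)
  destruct (jost_profile_exists (fun n => hop q (1 - n)) (fun n => site q (- n))
    (fun n => Ha0 (1 - n)%Z) Ha'
    (moment_square_minus_double (fun n => q (- n)%Z) Hmom')) as [h' [H' Hp']].
  destruct (scattering_quotients (hop q) (site q) h h' H H' Ha0 Ha Ha' Hp Hp')
    as [[G1 [HG1 E1]] [[G2 [HG2 E2]] [G3 [HG3 E3]]]].
  assert (HD : forall t, sin t <> 0 ->
    RtoC (m + lambda m t) <> 0%C /\ jost_bracket (hop q) h h' t <> 0%C).
  { intros t Hs. split; [ apply (Clambda_neq_0 m t Hm) | ]. intros E.
    pose proof (jost_bracket_lower_bound (hop q) (site q) h h' H H' Ha Ha' Hp Hp' t)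
      as Hl.
    rewrite E, Cmod_0 in Hl.
    pose proof (expi_opp_minus_neq_0 t Hs) as Hne. apply Cmod_gt_0 in Hne.
    replace (expi (- t) - expi t)%C with (- (expi t - expi (- t)))%C in Hne by ring.
    rewrite Cmod_opp in Hne. lra. }
  split; [ | split ].
  (* The sign comes from [W = - D / (m + lambda)]. It cancels in the quotient of two Wronskians, so
     [reflection_plus] carries none and [reflection_minus] only the one of its definition. *)
  - apply (in_wiener_extends _ (fun t => - (1) * G1 t)%C).
    + apply in_wiener_mult; [ apply in_wiener_const | exact HG1 ].
    + intros t Ht. apply punctured_sin in Ht. destruct (HD t Ht).
      unfold transmission.
      rewrite (W_bracket m q h h' H H' Hm Ha Ha' Hp Hp' t Ht), E1, <- expi_minus_opp
        by exact Ht.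
      field. auto.
  - apply (in_wiener_extends _ G2 HG2).
    intros t Ht. apply punctured_sin in Ht. destruct (HD t Ht).
    unfold reflection_plus.
    rewrite (W_bracket m q h h' H H' Hm Ha Ha' Hp Hp' t Ht),
      (W_plus_bracket m q h h' H H' Hm Ha Ha' Hp Hp' t Ht), E2 by exact Ht.
    field. auto.
  - apply (in_wiener_extends _ (fun t => - (1) * G3 t)%C).
    + apply in_wiener_mult; [ apply in_wiener_const | exact HG3 ].
    + intros t Ht. apply punctured_sin in Ht. destruct (HD t Ht).
      unfold reflection_minus.
      rewrite (W_bracket m q h h' H H' Hm Ha Ha' Hp Hp' t Ht),
        (W_minus_bracket m q h h' H H' Hm Ha Ha' Hp Hp' t Ht), E3 by exact Ht.
      field. auto.
Qed.
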